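(* Let $n\ge1$, $H:[0,1]\times\mathbb{R}^n\times\mathbb{R}^n\to\mathbb{R}$, and $L(t,x,v):=\sup_{p\in\mathbb{R}^n}\{\langle v,p\rangle-H(t,x,p)\}$. Assume: 1. $H(\cdot,x,p)$ is measurable for all $x,p\in\mathbb{R}^n$; $H(t,\cdot,\cdot)$ is continuous for every $t$; $H(t,x,\cdot)$ is convex for all $(t,x)$. 2. There is an integrable $c:[0,1]\to[0,+\infty)$ with $|H(t,x,p)-H(t,x,q)|\le c(t)(1+|x|)|p-q|$ for all $t\in[0,1]$, $x,p,q\in\mathbb{R}^n$. 3. For every $R>0$ there is an integrable $k_R:[0,1]\to[0,+\infty)$ with $|H(t,x,p)-H(t,y,p)|\le k_R(t)(1+|p|)|x-y|$ for all $t\in[0,1]$, $x,y\in\mathbb{B}_R$, $p\in\mathbb{R}^n$. 4. There is $\lambda:[0,1]\times\mathbb{R}^n\to\mathbb{R}$, measurable in $t$ and continuous in $x$, with $L(t,x,v)\le\lambda(t,x)$ for all $(t,x)$ and $v\in\operatorname{dom}L(t,x,\cdot)$, and with $\lambda(t,\cdot)$ being $k_R(t)$-Lipschitz on $\mathbb{B}_R$ for every $R>0$, $t\in[0,1]$. 5. $H(\cdot,0,0)$ and $\lambda(\cdot,0)$ are integrable. Let $\mathbb{B}$ be the closed unit ball of $\mathbb{R}^{n+1}$ and let $(\mathbb{B},f,l)$ be a faithful representation of $H$ (in the sense of the context). Let $\phi:\mathbb{R}^n\times\mathbb{R}^n\to\mathbb{R}\cup\{+\infty\}$ be proper and lower semicontinuous,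 and suppose there exists $M\ge0$ such that $\min\{|z|,|x|\}\le M$ for all $(z,x)\in\operatorname{dom}\phi$. Consider the variational problem $(\mathcal{P}_v)$: minimize $$\Gamma[x(\cdot)]:=\phi(x(0),x(1))+\int_0^1L(t,x(t),\dot x(t))\,dt$$ over all absolutely continuous $x:[0,1]\to\mathbb{R}^n$; and the optimal control problem $(\mathcal{P}_c)$: minimize $$\Lambda[(x,a)(\cdot)]:=\phi(x(0),x(1))+\int_0^1l(t,x(t),a(t))\,dt$$ over all pairs $(x,a)$ with $x:[0,1]\to\mathbb{R}^n$ absolutely continuous, $a\in L^1([0,1],\mathbb{R}^{n+1})$, $\dot x(t)=f(t,x(t),a(t))$ and $a(t)\in\mathbb{B}$ for a.e. $t\in[0,1]$. Then both minima are attained and $$\min\Gamma[x(\cdot)]=\min\Lambda[(x,a)(\cdot)].$$ Besides, if $\bar x(\cdot)$ is an optimal arc of $(\mathcal{P}_v)$ with $\bar x(\cdot)\in\operatorname{dom}\Gamma$, then there exists $\bar a(\cdot)$ such that $(\bar x,\bar a)(\cdot)$ is an optimal arc of $(\mathcal{P}_c)$ and $(\bar x,\bar a)(\cdot)\in\operatorname{dom}\Lambda$. Conversely, if $(\bar x,\bar a)(\cdot)$ is an optimal arc of $(\mathcal{P}_c)$, then $\bar x(\cdot)$ is an optimal arc of $(\mathcal{P}_v)$.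
   Context: $\mathbb{B}_R$: closed ball of radius $R$ about $0$ in $\mathbb{R}^n$. $\operatorname{dom}$ of an extended-real-valued function: the set where it is finite; $\operatorname{gph}\varphi=\{(x,r):\varphi(x)=r\in\mathbb{R}\}$. A function is proper if it never equals $-\infty$ and is not identically $+\infty$. The functionals $\Gamma,\Lambda$ take values in $\mathbb{R}\cup\{+\infty\}$ and minima are understood in $\mathbb{R}\cup\{+\infty\}$ (the common value $+\infty$ is allowed). An optimal arc is a minimizer. Faithful representation $(\mathbb{B},f,l)$ of $H$ here means: $f:[0,1]\times\mathbb{R}^n\times\mathbb{B}\to\mathbb{R}^n$ and $l:[0,1]\times\mathbb{R}^n\times\mathbb{B}\to\mathbb{R}$ are measurable in $t$ for all $(x,a)$ and continuous in $(x,a)$ for all $t$; $H(t,x,p)=\sup_{a\in\mathbb{B}}\{\langle p,f(t,x,a)\rangle-l(t,x,a)\}$ and $f(t,x,\mathbb{B})=\operatorname{dom}L(t,x,\cdot)$ for all $t,x,p$; and (A1) for all $R>0$, $t\in[0,1]$, $x,y\in\mathbb{B}_R$, $a,b\in\mathbb{B}$, both $|f(t,x,a)-f(t,y,b)|$ and $|l(t,x,a)-l(t,y,b)|$ are at most $10(n+1)(\omega_R(t)+3(1+R)k_R(t)+1)(|x-y|+|a-b|)$, where $\omega_R(t)=|\lambda(t,0)|+|H(t,0,0)|+c(t)(2+R)$; (A2) $|f(t,x,a)|\le c(t)(1+|x|)$ for all $t,x,a$; (A3) $\operatorname{gph}L(t,x,\cdot)\subset\{(f(t,x,a),l(t,x,a)):a\in\mathbb{B}\}$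 for all $t,x$; (A4) if $H,\lambda,c$ are continuous, so are $f,l$. (Under assumptions 1–4 such $f,l$ exist.) *)

(* Defs.v *)
From mathcomp Require Import all_boot all_order all_algebra.
From mathcomp Require Import all_classical all_reals all_analysis.

Set Implicit Arguments.
Unset Strict Implicit.
Unset Printing Implicit Defensive.

Import Order.TTheory GRing.Theory Num.Theory.
Import numFieldNormedType.Exports.

Local Open Scope classical_set_scope.
Local Open Scope ring_scope.

(** Throughout, functions of [t] have domain [R]; only their restriction to
    [0, 1] matters. *)

(** ** Euclidean structure of R^n

    The norm carried by ['rV[R]_n] in the library is the max norm, so the
    Euclidean norm and its balls are introduced separately; both norms give
    the same topology, and the library's one is used. *)

Definition dotv (R : realType) n (u v : 'rV[R]_n) : R :=
  \sum_(i < n) u ord0 i * v ord0 i.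

Definition enorm (R : realType) n (u : 'rV[R]_n) : R := Num.sqrt (dotv u u).

Definition eball (R : realType) n (r : R) : set 'rV[R]_n :=
  [set u | enorm u <= r].
Arguments eball {R} n r.

(** ** Lebesgue measurability on [0, 1]

    [R] with the sigma-algebra of all Lebesgue measurable sets (the library's
    [measurableTypeR] has only the Borel sets). *)

Notation lebesgueR R := (caratheodory_type ((wlength (@idfun R))^*)%mu).

Definition leb (R : realType) : {measure set (lebesgueR R) -> \bar R} :=
  @completed_lebesgue_measure R.

Definition I01 (R : realType) : set (lebesgueR R) := `[0%R : R, 1%R : R]%classic.
Arguments I01 {R}.

Definition measurable01 (R : realType) (g : R -> R) : Prop :=
  measurable_fun I01 (g : lebesgueR R -> R).

Definition integrable01 (R : realType) (g : R -> R) : Prop :=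
  (leb R).-integrable I01 (fun t : lebesgueR R => (g t)%:E).

Definition integral01 (R : realType) (g : R -> \bar R) : \bar R :=
  (\int[leb R]_(t in I01) g t)%E.

Definition ae01 (R : realType) (P : R -> Prop) : Prop :=
  {ae leb R, forall t : lebesgueR R, I01 t -> P t}.

(** ** Absolutely continuous arcs on [0, 1] *)

Definition abs_continuous01 (R : realType) n (x : R -> 'rV[R]_n) : Prop :=
  forall e : R, 0 < e -> exists2 d : R, 0 < d &
    forall (m : nat) (a b : 'I_m -> R),
      (forall i, 0 <= a i /\ a i <= b i /\ b i <= 1) ->
      trivIset setT (fun i => `]a i, b i[%classic) ->
      \sum_(i < m) (b i - a i) < d ->
      \sum_(i < m) enorm (x (b i) - x (a i)) < e.

(** ** Extended-real-valued functions *)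

Definition edom (R : realType) (T : Type) (g : T -> \bar R) : set T :=
  [set x | g x \is a fin_num].

Definition egph (R : realType) (T : Type) (g : T -> \bar R) : set (T * R) :=
  [set z | g z.1 = z.2%:E].

Definition proper_efun (R : realType) (T : Type) (g : T -> \bar R) : Prop :=
  (forall x, g x <> -oo%E) /\ (exists x, g x <> +oo%E).

Definition minimizer (R : realType) (T : Type) (A : set T) (F : T -> \bar R)
  (x : T) : Prop := A x /\ forall y, A y -> (F x <= F y)%E.

(** ** Lagrangian and representations *)

Definition lagrangian (R : realType) n (H : R -> 'rV[R]_n -> 'rV[R]_n -> R)
    (t : R) (x v : 'rV[R]_n) : \bar R :=
  ereal_sup [set (dotv v p - H t x p)%:E | p in [set: 'rV[R]_n]].

Definition omega (R : realType) n (H : R -> 'rV[R]_n -> 'rV[R]_n -> R)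
    (lam : R -> 'rV[R]_n -> R) (c : R -> R) (r t : R) : R :=
  `|lam t 0| + `|H t 0 0| + c t * (2 + r).

Record faithful_representation (R : realType) (n : nat)
    (H : R -> 'rV[R]_n -> 'rV[R]_n -> R) (c : R -> R) (k : R -> R -> R)
    (lam : R -> 'rV[R]_n -> R)
    (f : R -> 'rV[R]_n -> 'rV[R]_n.+1 -> 'rV[R]_n)
    (l : R -> 'rV[R]_n -> 'rV[R]_n.+1 -> R) : Prop := FaithfulRepresentation {
  repr_f_measurable : forall x a, eball n.+1 1 a ->
    forall i, measurable01 (fun t => f t x a ord0 i);
  repr_l_measurable : forall x a, eball n.+1 1 a ->
    measurable01 (fun t => l t x a);
  repr_f_continuous : forall t : R, I01 t ->
    {within [set: 'rV[R]_n] `*` eball n.+1 1,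
       continuous (fun z : 'rV[R]_n * 'rV[R]_n.+1 => f t z.1 z.2)};
  repr_l_continuous : forall t : R, I01 t ->
    {within [set: 'rV[R]_n] `*` eball n.+1 1,
       continuous (fun z : 'rV[R]_n * 'rV[R]_n.+1 => l t z.1 z.2)};
  repr_sup : forall (t : R) x p, I01 t ->
    (H t x p)%:E =
      ereal_sup [set (dotv p (f t x a) - l t x a)%:E | a in eball n.+1 1];
  repr_dom : forall (t : R) x, I01 t ->
    f t x @` eball n.+1 1 = edom (lagrangian H t x);
  repr_A1 : forall (r t : R) x y a b, 0 < r -> I01 t ->
    eball n r x -> eball n r y -> eball n.+1 1 a -> eball n.+1 1 b ->
    let bound := 10 * n.+1%:R
      * (omega H lam c r t + 3 * (1 + r) * k r t + 1)
      * (enorm (x - y) + enorm (a - b)) in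
    enorm (f t x a - f t y b) <= bound /\ `|l t x a - l t y b| <= bound;
  repr_A2 : forall (t : R) x a, I01 t -> eball n.+1 1 a ->
    enorm (f t x a) <= c t * (1 + enorm x);
  repr_A3 : forall (t : R) x, I01 t ->
    egph (lagrangian H t x) `<=` [set (f t x a, l t x a) | a in eball n.+1 1];
  repr_A4 :
    {within (`[0%R, 1%R]%classic : set R) `*` ([set: 'rV[R]_n] `*` [set: 'rV[R]_n]),
       continuous (fun z : R * ('rV[R]_n * 'rV[R]_n) => H z.1 z.2.1 z.2.2)} ->
    {within (`[0%R, 1%R]%classic : set R) `*` [set: 'rV[R]_n],
       continuous (fun z : R * 'rV[R]_n => lam z.1 z.2)} ->
    {within (`[0%R, 1%R]%classic : set R), continuous c} ->
    {within (`[0%R, 1%R]%classic : set R) `*` ([set: 'rV[R]_n] `*` eball n.+1 1),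
       continuous (fun z : R * ('rV[R]_n * 'rV[R]_n.+1) => f z.1 z.2.1 z.2.2)}
    /\
    {within (`[0%R, 1%R]%classic : set R) `*` ([set: 'rV[R]_n] `*` eball n.+1 1),
       continuous (fun z : R * ('rV[R]_n * 'rV[R]_n.+1) => l z.1 z.2.1 z.2.2)}
}.

(** ** The two problems

    An absolutely continuous arc is differentiable almost everywhere, so the
    junk values of [derive1 x] are confined to a null set.  The library
    integral is the integral of the positive part minus that of the negative
    part; under the hypotheses of the theorem the latter is finite for the
    integrands below. *)

Definition Gamma (R : realType) n (phi : 'rV[R]_n * 'rV[R]_n -> \bar R)
    (H : R -> 'rV[R]_n -> 'rV[R]_n -> R) (x : R -> 'rV[R]_n) : \bar R :=
  (phi (x 0%R, x 1%R)
   + integral01 (fun t => lagrangian H t (x t) (derive1 x t)))%E.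

Definition Lambda (R : realType) n (phi : 'rV[R]_n * 'rV[R]_n -> \bar R)
    (l : R -> 'rV[R]_n -> 'rV[R]_n.+1 -> R)
    (xa : (R -> 'rV[R]_n) * (R -> 'rV[R]_n.+1)) : \bar R :=
  (phi (xa.1 0%R, xa.1 1%R)
   + integral01 (fun t => (l t (xa.1 t) (xa.2 t))%:E))%E.

Definition arcs (R : realType) n : set (R -> 'rV[R]_n) :=
  [set x | abs_continuous01 x].
Arguments arcs R n : clear implicits.

Definition control_pairs (R : realType) n
    (f : R -> 'rV[R]_n -> 'rV[R]_n.+1 -> 'rV[R]_n) :
    set ((R -> 'rV[R]_n) * (R -> 'rV[R]_n.+1)) :=
  [set xa : (R -> 'rV[R]_n) * (R -> 'rV[R]_n.+1) |
    [/\ abs_continuous01 xa.1,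
        forall i, integrable01 (fun t => xa.2 t ord0 i) &
        ae01 (fun t => derive1 xa.1 t = f t (xa.1 t) (xa.2 t)
                       /\ eball n.+1 1 (xa.2 t))]].

(* Main.v *)
(** A priori bounds (Gronwall, together with the bound that the domain of
    [phi] puts on one endpoint) confine the arcs of finite cost to one ball,
    where their velocities and running costs are dominated by fixed integrable
    functions.  By Arzela-Ascoli a minimizing sequence [x_j] and the primitives
    [y_j] of its running costs converge uniformly to [x] and [y].  Integrating
    the inequality [<x_j', p> - H(t, x_j, p) <= y_j'] and letting [j] go to
    infinity shows [<x', p> - H(t, x, p) <= y'] a.e. for [p] in a countable
    dense set, that is [L(t, x, x') <= y'] a.e.; hence [x] minimizes [Gamma].
    This compactness argument replaces weak convergence of the derivatives.

    The two problems are linked by [L(t, x, f(t, x, a)) <= l(t, x, a)] in one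
    direction, and by (A3) with a measurable selection of the control in the
    other.  When all costs are infinite, the only thing left is the existence
    of an admissible pair: one solves [x' = f(t, x, 0)] by Picard iteration. *)

From HB Require Import structures.
Require Import Defs.
From mathcomp Require Import all_boot all_order all_algebra.
From mathcomp Require Import all_classical all_reals all_analysis.
From mathcomp Require Import ring lra.
From mathcomp Require Import measurable_realfun lebesgue_measure.

Set Implicit Arguments.
Unset Strict Implicit.
Unset Printing Implicit Defensive.

Import Order.TTheory GRing.Theory Num.Theory.
Import numFieldNormedType.Exports.
Local Open Scope classical_set_scope.
Local Open Scope ring_scope.

(** * Integration over [0, 1] *)

Section ae_integral.
Local Open Scope ereal_scope.
Context d (T : measurableType d) (R : realType) (mu : {measure set T -> \bar R}).

(** Arcs and controls are Lebesgue measurable, whereas differentiation of integrals, Stieltjes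
    measures and Radon-Nikodym derivatives are used on Borel sets. Each measurable function on
    [[0, 1]] is therefore traded for a Borel one that agrees with it almost everywhere. Arcs are
    handled through the primitives of their coordinates rather than through [derive1]: an integrable
    bound on the velocity becomes a bound on increments, and such a bound survives uniform limits.
    The domination of running costs is two-sided. Taking [p = 0] gives [L >= - H(t, x, 0)], and
    [lam] bounds [L] above wherever it is finite. This makes the primitives of the costs
    equi-absolutely continuous, so that their limit is again a primitive and its density can be
    compared with [L] pointwise. Since [L] is a supremum of functions affine in the velocity, each
    inequality to be passed to the limit involves the velocity only through increments of the
    arc. *)

Lemma ae_le_integrable (D : set T) (f g : T -> \bar R) : measurable D ->
  measurable_fun D f -> mu.-integrable D g ->
  {ae mu, forall x, D x -> `|f x| <= `|g x|} -> mu.-integrable D f.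
Proof.
move=> mD mf /integrableP[mg goo] fg; apply/integrableP; split => //.
apply: le_lt_trans goo; apply: ae_ge0_le_integral => //; exact: measurableT_comp.
Qed.

(** Stated without integrability because a running cost may have integral [+oo]: the positive parts
    increase, the negative parts decrease, and extended subtraction is monotone. *)
Lemma ae_le_integral (D : set T) (f g : T -> \bar R) : measurable D ->
  measurable_fun D f -> measurable_fun D g ->
  {ae mu, forall x, D x -> f x <= g x} ->
  \int[mu]_(x in D) f x <= \int[mu]_(x in D) g x.
Proof.
move=> mD mf mg fg; rewrite integralE [leRHS]integralE leeB//.
- apply: ae_ge0_le_integral => //; try exact: measurable_funepos.
  apply: filterS fg => x fg Dx.
  by apply: (@funepos_le _ _ [set x] f g); rewrite ?inE// => y /set_mem ->; exact: fg.
- apply: ae_ge0_le_integral => //; try exact: measurable_funeneg.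
  apply: filterS fg => x fg Dx.
  by apply: (@funeneg_le _ _ [set x] f g); rewrite ?inE// => y /set_mem ->; exact: fg.
Qed.

(** The minorant makes the integral of the negative part finite, so only the positive part could be
    infinite, and then the integral would be [+oo]. *)
Lemma bounded_below_integrable (D : set T) (f : T -> \bar R) (m : T -> R) :
  measurable D -> measurable_fun D f -> mu.-integrable D (EFin \o m) ->
  (forall x, D x -> (- m x)%:E <= f x) -> \int[mu]_(x in D) f x < +oo ->
  mu.-integrable D f.
Proof.
move=> mD mf /integrableP[mm moo] fm foo.
have fneg : \int[mu]_(x in D) f^\- x < +oo.
  apply: le_lt_trans moo; apply: ge0_le_integral => //.
  - exact: measurable_funeneg.
  - exact: measurableT_comp.
  - move=> x Dx; rewrite funenegE ge_max abse_ge0 andbT leeNl.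
    apply: le_trans (fm x Dx).
    by rewrite -EFinN lee_fin lerN2 ler_norm.
have fpos : \int[mu]_(x in D) f^\+ x < +oo.
  move: foo; rewrite integralE.
  set p := \int[mu]_(x in D) f^\+ x; set q := \int[mu]_(x in D) f^\- x in fneg *.
  have q0 : 0 <= q by apply: integral_ge0 => x _; exact: funeneg_ge0.
  have fq : q \is a fin_num by rewrite ge0_fin_numE.
  by rewrite lteBlDr// -(fineK fq) /=; case: p => //= r _; rewrite ltry.
apply/integrableP; split => //.
rewrite -[fun x => _]/(abse \o f) fune_abse ge0_integralD//.
- exact: lte_add_pinfty.
- exact: measurable_funepos.
- exact: measurable_funeneg.
Qed.

Lemma measure_bigsetU_le (I : finType) (F : I -> set T) :
  (forall i, measurable (F i)) ->
  mu (\big[setU/set0]_(i : I) F i) <= \sum_(i : I) mu (F i).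
Proof.
move=> mF; have [_ //] : measurable (\big[setU/set0]_(i : I) F i) /\
    mu (\big[setU/set0]_(i : I) F i) <= \sum_(i : I) mu (F i).
elim/big_ind2 : _ => [|A x B y [mA Ax] [mB By]|i _].
- by rewrite measure0; split.
- split; first exact: measurableU.
  by rewrite (le_trans (measureU2 mu mA mB))// leeD.
- by split.
Qed.

End ae_integral.

(** * Lebesgue measurability compared with Borel measurability, and primitives *)

Section borel_lebesgue.
Context {R : realType}.
Notation mu := (@lebesgue_measure R).

Lemma borel_lebesgueR (A : set R) :
  measurable (A : set (measurableTypeR R)) -> measurable (A : set (lebesgueR R)).
Proof. exact: sub_caratheodory. Qed.

Lemma measurable_itv_lebesgueR (i : interval R) :
  measurable ([set` i] : set (lebesgueR R)).
Proof. by apply: borel_lebesgueR; exact: measurable_itv. Qed.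

Lemma leb_borelE (A : set R) : leb R A = mu A.
Proof. by []. Qed.

Lemma measurable_fun_id_lebesgueR :
  measurable_fun setT (id : lebesgueR R -> measurableTypeR R).
Proof. by move=> _ A mA; rewrite setTI; exact: borel_lebesgueR. Qed.

Lemma measurable_lebesgueRP (A : set R) : measurable (A : set (lebesgueR R)) ->
  exists B N : set R, [/\ measurable (B : set (measurableTypeR R)),
    mu.-negligible N & A = B `|` N].
Proof.
move=> mA.
have : (completed_algebra_gen mu).-sigma.-measurable A.
  by rewrite completed_caratheodory_measurable.
by rewrite g_sigma_completed_algebra_genE => -[B mB [N nN <-]]; exists B, N.
Qed.

(** A Lebesgue null set is a Borel null set together with a subset of another one, hence lies in a
    Borel null set. *)
Lemma negligible_leb (N : set R) :
  (leb R).-negligible (N : set (lebesgueR R)) <-> mu.-negligible N.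
Proof.
split; last first.
  by case=> B [mB B0 NB]; exists B; split => //; exact: borel_lebesgueR.
case=> A [mA A0 NA].
have [B [N' [mB [C [mC C0 N'C]] AE]]] := measurable_lebesgueRP mA.
exists (B `|` C); split; first exact: measurableU.
  apply/eqP; rewrite eq_le measure_ge0 andbT.
  have /le_trans -> // := measureU2 mu mB mC.
  have -> : (mu B + mu C = leb R B)%E by rewrite [mu C]C0 adde0.
  rewrite -A0.
  by apply: le_measure; rewrite ?inE//; [exact: borel_lebesgueR|rewrite AE; exact: subsetUl].
by apply: (subset_trans NA); rewrite AE; exact: setUS.
Qed.

Lemma leb_complete : measure_is_complete (leb R).
Proof. exact: completed_lebesgue_measure_is_complete. Qed.

(* Unfolding the Caratheodory construction makes unification diverge. *)
Opaque leb.

Lemma ae01S (P Q : R -> Prop) : (forall t, I01 t -> P t -> Q t) ->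
  ae01 P -> ae01 Q.
Proof.
move=> PQ; apply: (@filterS _ _ (ae_filter_ringOfSetsType (leb R))) => t Pt tI.
exact: PQ (Pt tI).
Qed.

Lemma ae01S2 (P1 P2 Q : R -> Prop) : (forall t, I01 t -> P1 t -> P2 t -> Q t) ->
  ae01 P1 -> ae01 P2 -> ae01 Q.
Proof.
move=> PQ; apply: (@filterS2 _ _ (ae_filter_ringOfSetsType (leb R))) => t P1t P2t tI.
exact: PQ (P1t tI) (P2t tI).
Qed.

Lemma ae01T (P : R -> Prop) : (forall t, I01 t -> P t) -> ae01 P.
Proof. by move=> ?; exact: aeW. Qed.

(** Derivatives at [t] see a neighbourhood of [t], which must stay inside [[0, 1]]; the endpoints
    are a null set. *)
Lemma ae01_oo (P : R -> Prop) : ae01 (fun t => 0 < t < 1 -> P t) -> ae01 P.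
Proof.
have aoo : ae01 (fun t : R => 0 < t < 1).
  apply/negligible_leb; exists [set 0; 1]; split.
  - by apply: measurableU; exact: measurable_set1.
  - apply: (@measure_negligible _ _ _ mu); first by apply: measurableU; exact: measurable_set1.
    have n1 (r : R) : mu.-negligible [set r].
      exists [set r]; split; [exact: measurable_set1|exact: lebesgue_measure_set1|by []].
    exact: negligibleU.
  - move=> t /= /not_implyP[]; rewrite /I01/= in_itv/= => /andP[t0 t1] /negP.
    rewrite negb_and -!leNgt => /orP[] h; [left|right]; apply/eqP; rewrite eq_le.
      by rewrite h t0.
    by rewrite h t1.
by apply: ae01S2 aoo => t _ t01; exact.
Qed.

Lemma ae_eq01 (T : Type) (g h : R -> T) (D : set R) : D `<=` I01 ->
  ae01 (fun t => g t = h t) -> ae_eq (leb R) (D : set (lebesgueR R)) g h.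
Proof.
move=> DI; apply: (@filterS _ _ (ae_filter_ringOfSetsType (leb R))) => t gh Dt.
exact: gh (DI _ Dt).
Qed.

Lemma measurable01_itv (i : interval R) (g : R -> R) : [set` i] `<=` I01 ->
  measurable01 g -> measurable_fun ([set` i] : set (lebesgueR R)) (fun t : lebesgueR R => (g t)%:E).
Proof.
move=> iI mg; apply/measurable_EFinP; apply: measurable_funS mg => //.
exact: measurable_itv_lebesgueR.
Qed.

Lemma borel_measurable01 (g : R -> R) :
  measurable_fun setT (g : measurableTypeR R -> R) -> measurable01 g.
Proof.
move=> mg mI Y mY; apply: measurableI => //; apply: borel_lebesgueR.
by rewrite -[X in measurable X]setTI; apply: mg.
Qed.

Lemma integrable01_measurable (g : R -> R) : integrable01 g -> measurable01 g.
Proof. by move=> ig; apply/measurable_EFinP; exact: (measurable_int (leb R)). Qed.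

(** Completeness of the measure is used here. It allows an arc's [derive1], known only almost
    everywhere, to be replaced by a measurable representative. *)
Lemma emeasurable01_ae (g h : R -> \bar R) :
  measurable_fun I01 (g : lebesgueR R -> \bar R) ->
  ae01 (fun t => g t = h t) -> measurable_fun I01 (h : lebesgueR R -> \bar R).
Proof.
move=> mg gh; apply: (ae_measurable_fun leb_complete _ mg).
exact: ae_eq01.
Qed.

Lemma measurable01_ae (g h : R -> R) : measurable01 g ->
  ae01 (fun t => g t = h t) -> measurable01 h.
Proof.
move=> mg gh; apply/measurable_EFinP; apply: (emeasurable01_ae (g := fun t => (g t)%:E)).
  exact/measurable_EFinP.
by apply: ae01S gh => t _ ->.
Qed.

Lemma ae01_le_integral (g h : R -> \bar R) :
  measurable_fun I01 (g : lebesgueR R -> \bar R) ->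
  measurable_fun I01 (h : lebesgueR R -> \bar R) ->
  ae01 (fun t => g t <= h t)%E -> (integral01 g <= integral01 h)%E.
Proof.
move=> mg mh gh; apply: ae_le_integral => //; exact: measurable_itv_lebesgueR.
Qed.

Lemma ae01_eq_integral (g h : R -> \bar R) :
  measurable_fun I01 (g : lebesgueR R -> \bar R) ->
  measurable_fun I01 (h : lebesgueR R -> \bar R) ->
  ae01 (fun t => g t = h t) -> integral01 g = integral01 h.
Proof.
move=> mg mh gh; apply/eqP; rewrite eq_le; apply/andP; split.
  by apply: ae01_le_integral => //; apply: ae01S gh => t _ ->.
by apply: ae01_le_integral => //; apply: ae01S gh => t _ ->.
Qed.

Lemma measurable01_cst (k : R) : measurable01 (fun=> k).
Proof. exact: measurable_cst. Qed.

Lemma measurable01D (g h : R -> R) : measurable01 g -> measurable01 h ->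
  measurable01 (fun t => g t + h t).
Proof. exact: measurable_funD. Qed.

Lemma measurable01B (g h : R -> R) : measurable01 g -> measurable01 h ->
  measurable01 (fun t => g t - h t).
Proof. exact: measurable_funB. Qed.

Lemma measurable01M (g h : R -> R) : measurable01 g -> measurable01 h ->
  measurable01 (fun t => g t * h t).
Proof. exact: measurable_funM. Qed.

Lemma measurable01_norm (g : R -> R) : measurable01 g -> measurable01 (fun t => `|g t|).
Proof. by move=> mg; exact: measurableT_comp. Qed.

Lemma measurable01_sum (I : Type) (s : seq I) (g : I -> R -> R) :
  (forall i, measurable01 (g i)) -> measurable01 (fun t => \sum_(i <- s) g i t).
Proof. by move=> mg; exact: measurable_sum. Qed.

Lemma integral01_ae (i : interval R) (g h : R -> R) : [set` i] `<=` I01 ->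
  measurable01 g -> measurable01 h -> ae01 (fun t => g t = h t) ->
  (\int[leb R]_(t in ([set` i] : set (lebesgueR R))) (g t)%:E =
   \int[leb R]_(t in ([set` i] : set (lebesgueR R))) (h t)%:E)%E.
Proof.
move=> iI mg mh gh.
apply: (@ae_eq_integral _ _ _ (leb R) _
  (fun t : lebesgueR R => (h t)%:E) (fun t : lebesgueR R => (g t)%:E)).
- exact: measurable_itv_lebesgueR.
- exact: measurable01_itv.
- exact: measurable01_itv.
- by apply: ae_eq01 => //; apply: ae01S gh => t _ ->.
Qed.

(** The identity from Lebesgue to Borel sets pushes [leb] forward to [mu]; the change of variables
    for nonnegative functions is applied to both parts of [h]. *)
Lemma integral_leb_borel (D : set R) (h : R -> \bar R) :
  measurable (D : set (measurableTypeR R)) ->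
  measurable_fun setT (h : measurableTypeR R -> \bar R) ->
  (\int[leb R]_(t in (D : set (lebesgueR R))) h t = \int[mu]_(t in D) h t)%E.
Proof.
move=> mD mh; rewrite [LHS]integralE [RHS]integralE.
have E (k : R -> \bar R) : measurable_fun setT (k : measurableTypeR R -> \bar R) ->
    (forall x, 0 <= k x)%E ->
  (\int[leb R]_(t in (D : set (lebesgueR R))) k t = \int[mu]_(t in D) k t)%E.
  move=> mk k0.
  rewrite -[LHS](@ge0_integral_pushforward _ _ _ _ R _ (measurable_fun_id_lebesgueR) (leb R) D k) //=.
  exact: measurable_funTS.
congr (_ - _)%E; apply: E => //.
- exact: measurable_funepos.
- exact: measurable_funeneg.
Qed.

(** Each rational sublevel set is Borel up to a null set. Off one Borel null set [C] covering all
    these exceptions, [g < x] means membership in one of the Borel parts with [q <= x]. The value 0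
    outside [[0, 1]] makes the new function integrable on the whole line when [g] is integrable. *)
Lemma borel_version (g : R -> R) : measurable01 g ->
  exists g0 : R -> R,
    [/\ measurable_fun setT (g0 : measurableTypeR R -> R),
        (forall t, ~ I01 t -> g0 t = 0) & ae01 (fun t => g t = g0 t)].
Proof.
move=> mg.
pose A (q : rat) : set R := I01 `&` g @^-1` `]-oo, ratr q[.
have mA q : exists B N : set R, [/\ measurable (B : set (measurableTypeR R)),
    mu.-negligible N & A q = B `|` N].
  apply: measurable_lebesgueRP.
  by apply: mg; [exact: measurable_itv_lebesgueR|exact: measurable_itv].
have /choice [B /choice [N BN]] := mA.
have negN : mu.-negligible (\bigcup_q N q).
  have [h hb] : exists h : nat -> rat, forall q, exists n, h n = q.
    exists (fun n => odflt 0 (unpickle n)) => q; exists (pickle q).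
    by rewrite pickleK.
  have -> : \bigcup_q N q = \bigcup_n N (h n).
    apply/seteqP; split => [t [q _ Nq]|t [n _ Nn]]; last by exists (h n).
    by have [n hn] := hb q; exists n => //; rewrite hn.
  by apply: negligible_bigcup => n; have [] := BN (h n).
have [C [mC C0 NC]] := negN.
pose D : set R := `[0, 1] `\` C.
have mD : measurable (D : set (measurableTypeR R)).
  by apply: measurableD => //; exact: measurable_itv.
exists (g \_ D); split.
- apply/(measurable_restrictT (g : measurableTypeR R -> R) mD).
  apply: (measurability _ (RGenCInfty.measurableE R)) => //.
  move=> _ [_ [x ->] <-].
  have -> : D `&` g @^-1` `[x, +oo[ =
      D `\` \bigcup_q (if ratr q <= x then B q else set0).
    apply/seteqP; split => t [Dt gt]; split => //.
      case=> q _; case: ifPn => // qx Bq.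
      have : A q t by have [_ _ ->] := BN q; left.
      case=> _ /=; rewrite in_itv/= => /lt_le_trans/(_ qx).
      by move: gt; rewrite /= in_itv/= andbT ltNge => ->.
    rewrite /= in_itv/= andbT leNgt; apply/negP => gx.
    have [q] := rat_in_itvoo gx; rewrite in_itv/= => /andP[gq qx].
    apply: gt; exists q => //; rewrite (ltW qx).
    have : A q t by split; [case: Dt|rewrite /= in_itv].
    have [_ _ ->] := BN q; case=> // Nt.
    by case: Dt => _; case; apply: NC; exists q.
  apply: measurableD => //; apply: bigcupT_measurable_rat => q.
  by case: ifPn => // _; have [] := BN q.
- move=> t tI; rewrite patchE; case: ifPn => // /set_mem[tI' _]; exfalso; exact: tI.
- apply/negligible_leb; exists C; split => // t /= /not_implyP[tI].
  rewrite patchE; case: ifPn => // /negP; rewrite inE => tD _.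
  by apply: contrapT => tC; apply: tD; split.
Qed.

Lemma integrable_borel_version (g : R -> R) : integrable01 g ->
  exists g0 : R -> R,
    [/\ mu.-integrable setT (EFin \o g0),
        (forall t, ~ I01 t -> g0 t = 0) & ae01 (fun t => g t = g0 t)].
Proof.
move=> ig; have mg := integrable01_measurable ig.
have [g0 [mg0 z0 aeg]] := borel_version mg.
exists g0; split => //; apply/integrableP; split.
  exact/measurable_EFinP.
have -> : (\int[mu]_x `|(EFin \o g0) x| = \int[mu]_(x in `[0%R, 1%R]) (`|g0 x|)%:E)%E.
  rewrite [RHS]integral_mkcond; apply: eq_integral => t _; rewrite patchE.
  case: ifPn => // /negP; rewrite inE => tI /=; rewrite z0 ?normr0//.
rewrite -integral_leb_borel//; last first.
  by apply/measurable_EFinP; apply: measurableT_comp.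
have /integrableP[_] := ig.
rewrite -(@integral01_ae `[0, 1] (fun t => `|g t|) (fun t => `|g0 t|))//.
- exact: measurableT_comp.
- by apply: borel_measurable01; exact: measurableT_comp.
- by apply: ae01S aeg => t _ ->.
Qed.

(** Meaningful for [t <= 1] only, as nothing is known of [g] beyond 1. For [t < 0] the interval is
    empty, which is why several lemmas below bound [t] on one side only. *)
Definition prim (g : R -> R) (t : R) : R :=
  \int[leb R]_(s in (`[0%R, t]%classic : set R)) (g s).

Lemma sub_itv01 (t : R) : t <= 1 -> (`[0%R, t]%classic : set R) `<=` I01.
Proof. by move=> t1; apply: subset_itvl; rewrite bnd_simp. Qed.

Lemma prim_ae (g h : R -> R) t : measurable01 g -> measurable01 h ->
  ae01 (fun t => g t = h t) -> t <= 1 -> prim g t = prim h t.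
Proof.
move=> mg mh gh t1; rewrite /prim /Rintegral; congr fine.
by apply: integral01_ae => //; exact: sub_itv01.
Qed.

Lemma prim_borel (g g0 : R -> R) t : measurable01 g ->
  measurable_fun setT (g0 : measurableTypeR R -> R) ->
  ae01 (fun t => g t = g0 t) -> t <= 1 ->
  prim g t = \int[mu]_(s in `[0, t]) g0 s.
Proof.
move=> mg mg0 gg0 t1.
rewrite (prim_ae _ _ gg0)//; last exact: borel_measurable01.
by rewrite /prim/Rintegral integral_leb_borel//; exact/measurable_EFinP.
Qed.

(** Lebesgue differentiation of a Borel version [g0]. The primitive of [g0] agrees with [prim g]
    only up to time 1, hence the restriction to a neighbourhood of some [t < 1]. *)
Lemma prim_is_derive (g : R -> R) : integrable01 g ->
  ae01 (fun t => is_derive t (1 : R) (prim g) (g t)).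
Proof.
move=> ig; have [g0 [ig0 z0 gg0]] := integrable_borel_version ig.
have mg := integrable01_measurable ig.
have mg0 : measurable_fun setT (g0 : measurableTypeR R -> R).
  by apply/measurable_EFinP; exact: (measurable_int mu).
have lg0 : locally_integrable setT g0.
  by apply: open_integrable_locally => //; exact: openT.
pose F (x : R) : R := \int[mu]_(t in `[0, x]) g0 t.
have iy y : mu.-integrable `[0, y] (EFin \o g0) by exact: integrableS ig0.
have aeF : ae01 (fun x => 0 < x -> derivable F x 1 /\ derive1 F x = g0 x).
  have /negligible_leb := @FTC1 _ g0 (BLeft 0) iy lg0.
  by apply: negligibleS => t /=; apply: contra_not => + _; exact.
apply: ae01_oo; apply: (ae01S2 _ gg0 aeF) => t tI gt Ft /andP[t0 t1].
have [//|dF F'] := Ft.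
have nF : {near (t : R), prim g =1 F}.
  by apply: filterS (lt_le_nbhsl t1) => s s1; rewrite (prim_borel mg mg0 gg0).
have nF' : {near t, F =1 prim g} by apply: filterS nF => s ->.
apply: DeriveDef; first exact: near_eq_derivable nF' _.
by rewrite gt// -F' derive1E; exact: near_eq_derive.
Qed.

Lemma integrable01_itv (i : interval R) (g : R -> R) : [set` i] `<=` I01 ->
  integrable01 g ->
  (leb R).-integrable ([set` i] : set (lebesgueR R)) (EFin \o (g : lebesgueR R -> R)).
Proof.
move=> iI; apply: integrableS => //; exact: measurable_itv_lebesgueR.
Qed.

Lemma integrable01D (g h : R -> R) : integrable01 g -> integrable01 h ->
  integrable01 (fun t => g t + h t).
Proof.
move=> ig ih; apply: (eq_integrable (measurable_itv_lebesgueR `[0, 1])); last first.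
  exact: (integrableD (measurable_itv_lebesgueR `[0, 1]) ig ih).
by [].
Qed.

Lemma integrable01Z (k : R) (g : R -> R) : integrable01 g ->
  integrable01 (fun t => k * g t).
Proof.
move=> ig; apply: (eq_integrable (measurable_itv_lebesgueR `[0, 1])); last first.
  exact: (integrableZl (measurable_itv_lebesgueR `[0, 1]) k ig).
by [].
Qed.

Lemma integrable01_norm (g : R -> R) : integrable01 g -> integrable01 (fun t => `|g t|).
Proof. exact: integrable_norm. Qed.

Lemma integrable01_cst (k : R) : integrable01 (fun=> k).
Proof.
apply: measurable_bounded_integrable.
- exact: measurable_itv_lebesgueR.
- by rewrite leb_borelE lebesgue_measure_itv/= lte_fin ltr01 -EFinB ltry.
- exact: measurable_cst.
- by exists `|k|; split => // x /ltW kx t _ /=.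
Qed.

Lemma integrable01_dom (g h : R -> R) : measurable01 g -> integrable01 h ->
  ae01 (fun t => `|g t| <= h t) -> integrable01 g.
Proof.
move=> mg ih gh; apply: (ae_le_integrable (measurable_itv_lebesgueR `[0, 1]) _ ih).
  exact/measurable_EFinP.
apply: (@filterS _ _ (ae_filter_ringOfSetsType (leb R))) gh => t gh tI.
by rewrite /= lee_fin (le_trans (gh tI))// ler_norm.
Qed.

Lemma primD (g h : R -> R) t : integrable01 g -> integrable01 h -> t <= 1 ->
  prim (fun t => g t + h t) t = prim g t + prim h t.
Proof.
move=> ig ih t1; apply: RintegralD; first exact: measurable_itv_lebesgueR.
- exact: integrable01_itv (sub_itv01 t1) ig.
- exact: integrable01_itv (sub_itv01 t1) ih.
Qed.

Lemma primZ (k : R) (g : R -> R) t : integrable01 g -> t <= 1 ->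
  prim (fun t => k * g t) t = k * prim g t.
Proof.
move=> ig t1; apply: RintegralZl; first exact: measurable_itv_lebesgueR.
exact: integrable01_itv (sub_itv01 t1) ig.
Qed.

Lemma integrable01B (g h : R -> R) : integrable01 g -> integrable01 h ->
  integrable01 (fun t => g t - h t).
Proof.
move=> ig ih.
apply: (eq_integrable (measurable_itv_lebesgueR `[0, 1])); last first.
  exact: (integrableB (measurable_itv_lebesgueR `[0, 1]) ig ih).
by [].
Qed.

Lemma primB (g h : R -> R) t : integrable01 g -> integrable01 h -> t <= 1 ->
  prim (fun t => g t - h t) t = prim g t - prim h t.
Proof.
move=> ig ih t1; apply: RintegralB; first exact: measurable_itv_lebesgueR.
- exact: integrable01_itv (sub_itv01 t1) ig.
- exact: integrable01_itv (sub_itv01 t1) ih.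
Qed.

Lemma prim0 (g : R -> R) : integrable01 g -> prim g 0 = 0.
Proof.
move=> ig; have [g0 [ig0 z0 gg0]] := integrable_borel_version ig.
rewrite (prim_borel _ _ gg0)// ?set_itv1 ?Rintegral_set1//.
  exact: integrable01_measurable.
by apply/measurable_EFinP; exact: (measurable_int mu).
Qed.

Lemma ge0_prim_nd (k : R -> R) s t : integrable01 k ->
  (forall u, 0 <= k u) -> s <= t -> t <= 1 -> prim k s <= prim k t.
Proof.
move=> ik k0 st t1; rewrite /prim /Rintegral fine_le//.
- apply: integrable_fin_num; first exact: measurable_itv_lebesgueR.
  exact: integrable01_itv (sub_itv01 (le_trans st t1)) ik.
- apply: integrable_fin_num; first exact: measurable_itv_lebesgueR.
  exact: integrable01_itv (sub_itv01 t1) ik.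
- apply: ge0_subset_integral.
  + exact: measurable_itv_lebesgueR.
  + exact: measurable_itv_lebesgueR.
  + exact: measurable01_itv (sub_itv01 t1) (integrable01_measurable ik).
  + by move=> u _; rewrite lee_fin.
  + by apply: subset_itvl; rewrite bnd_simp.
Qed.

Lemma prim_nd (k : R -> R) s t : integrable01 k ->
  ae01 (fun u => 0 <= k u) -> s <= t -> t <= 1 -> prim k s <= prim k t.
Proof.
move=> ik k0 st t1; have mk := integrable01_measurable ik.
have ikn := integrable01_norm ik; have mkn := integrable01_measurable ikn.
have E : ae01 (fun u => k u = `|k u|) by apply: ae01S k0 => u _ /ger0_norm.
rewrite (prim_ae mk mkn E t1) (prim_ae mk mkn E (le_trans st t1)).
exact: ge0_prim_nd.
Qed.

Lemma prim_le (g h : R -> R) s t : integrable01 g -> integrable01 h ->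
  ae01 (fun u => g u <= h u) -> s <= t -> t <= 1 ->
  prim g t - prim g s <= prim h t - prim h s.
Proof.
move=> ig ih gh st t1.
have ihg := integrable01B ih ig; have s1 := le_trans st t1.
have : prim (fun u => h u - g u) s <= prim (fun u => h u - g u) t.
  by apply: prim_nd => //; apply: ae01S gh => u _; rewrite subr_ge0.
rewrite !primB//; lra.
Qed.

Lemma prim_norm_le (g h : R -> R) s t : integrable01 g -> integrable01 h ->
  ae01 (fun u => `|g u| <= h u) -> s <= t -> t <= 1 ->
  `|prim g t - prim g s| <= prim h t - prim h s.
Proof.
move=> ig ih gh st t1; rewrite ler_norml; apply/andP; split; last first.
  by apply: prim_le => //; apply: ae01S gh => u _; exact/le_trans/ler_norm.
have s1 := le_trans st t1.
have := @prim_le (fun u => -1 * h u) g s t (integrable01Z (-1) ih) ig.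
rewrite !primZ//.
move=> /(_ _ st t1) H; apply: le_trans (H _); first lra.
apply: ae01S gh => u _; rewrite ler_norml => /andP[+ _]; lra.
Qed.

Lemma primB_itv (g : R -> R) s t : integrable01 g -> 0 <= s -> s <= t -> t <= 1 ->
  prim g t - prim g s = \int[leb R]_(u in (`]s, t]%classic : set R)) g u.
Proof.
move=> ig s0 st t1; rewrite /prim.
have E : `[0, t]%classic = `[0, s]%classic `|` `]s, t]%classic :> set R.
  by rewrite -itv_bndbnd_setU// bnd_simp.
rewrite E Rintegral_setU.
- by rewrite addrAC subrr add0r.
- exact: measurable_itv_lebesgueR.
- exact: measurable_itv_lebesgueR.
- by rewrite -E; exact: integrable01_itv (sub_itv01 t1) ig.
- apply/disj_setPRL => u /=; rewrite in_itv/= => /andP[su _]; rewrite in_itv/= => /andP[_].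
  by rewrite leNgt su.
Qed.

Lemma ae01_neq (a : R) : ae01 (fun t => t <> a).
Proof.
apply/negligible_leb; exists [set a]; split; [exact: measurable_set1|exact: lebesgue_measure_set1|].
by move=> t /= /not_implyP[_ /contrapT].
Qed.

(** The local form serves Gronwall's estimate, where the bound on the velocity is available only
    between [s] and [t]. *)
Lemma prim_le_local (g h : R -> R) s t : integrable01 g -> integrable01 h ->
  ae01 (fun u => s < u < t -> g u <= h u) -> 0 <= s -> s <= t -> t <= 1 ->
  prim g t - prim g s <= prim h t - prim h s.
Proof.
move=> ig ih gh s0 st t1; rewrite !primB_itv//.
have sI : `]s, t]%classic `<=` (I01 : set R).
  by apply: subset_itv; rewrite bnd_simp.
rewrite /Rintegral fine_le//.
- apply: integrable_fin_num; first exact: measurable_itv_lebesgueR.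
  exact: integrable01_itv sI ig.
- apply: integrable_fin_num; first exact: measurable_itv_lebesgueR.
  exact: integrable01_itv sI ih.
apply: ae_le_integral; first exact: measurable_itv_lebesgueR.
- exact: measurable01_itv sI (integrable01_measurable ig).
- exact: measurable01_itv sI (integrable01_measurable ih).
have := ae01S2 (fun u uI h1 h2 => conj h1 h2) gh (ae01_neq t).
apply: (@filterS _ _ (ae_filter_ringOfSetsType (leb R))) => u H ut.
have [gu /eqP ut'] := H (sI _ ut).
rewrite lee_fin; apply: gu; have /andP[su ut''] : (s : R) < u <= t by move: ut; rewrite /= in_itv.
by rewrite su lt_neqAle ut''; move: ut' => /= ->.
Qed.

Lemma prim_norm_le_local (g h : R -> R) s t : integrable01 g -> integrable01 h ->
  ae01 (fun u => s < u < t -> `|g u| <= h u) -> 0 <= s -> s <= t -> t <= 1 ->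
  `|prim g t - prim g s| <= prim h t - prim h s.
Proof.
move=> ig ih gh s0 st t1; rewrite ler_norml; apply/andP; split; last first.
  apply: prim_le_local => //; apply: ae01S gh => u _ gu /gu; exact/le_trans/ler_norm.
have s1 := le_trans st t1.
have := @prim_le_local (fun u => -1 * h u) g s t (integrable01Z (-1) ih) ig.
rewrite !primZ//.
move=> H; apply: le_trans (H _ s0 st t1); first lra.
apply: ae01S gh => u _ gu /gu; rewrite ler_norml => /andP[+ _]; lra.
Qed.

Lemma prim_sum (I : Type) (r : seq I) (g : I -> R -> R) t :
  (forall i, integrable01 (g i)) -> t <= 1 ->
  integrable01 (fun s => \sum_(i <- r) g i s) /\
  prim (fun s => \sum_(i <- r) g i s) t = \sum_(i <- r) prim (g i) t.
Proof.
move=> ig t1; elim: r => [|i r [IH1 IH2]].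
  have E : (fun s : R => \sum_(i <- [::]) g i s) = (fun=> 0).
    by apply/funext => s; rewrite big_nil.
  rewrite E big_nil; split; first exact: integrable01_cst.
  have := primZ 0 (integrable01_cst 0) t1.
  by rewrite mul0r => ->; rewrite mul0r.
have E : (fun s => \sum_(j <- i :: r) g j s) = (fun s => g i s + \sum_(j <- r) g j s).
  by apply/funext => s; rewrite big_cons.
by rewrite E big_cons primD// IH2; split => //; exact: integrable01D.
Qed.

Lemma prim1 (g : R -> R) : integrable01 g ->
  integral01 (fun t => (g t)%:E) = (prim g 1)%:E.
Proof.
move=> ig; rewrite /prim /Rintegral fineK//; apply: integrable_fin_num => //.
exact: measurable_itv_lebesgueR.
Qed.

(** * Absolute continuity of primitives *)

Definition ac01 (F : R -> R) : Prop :=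
  forall e : R, 0 < e -> exists2 d : R, 0 < d &
    forall (m : nat) (a b : 'I_m -> R),
      (forall i, 0 <= a i /\ a i <= b i /\ b i <= 1) ->
      trivIset setT (fun i => `]a i, b i[%classic) ->
      \sum_(i < m) (b i - a i) < d ->
      \sum_(i < m) `|F (b i) - F (a i)| < e.

Lemma prim_itv_le (g g0 : R -> R) s t : integrable01 g ->
  mu.-integrable setT (EFin \o g0) -> ae01 (fun t => g t = g0 t) ->
  0 <= s -> s <= t -> t <= 1 ->
  `|prim g t - prim g s| <= \int[mu]_(u in `]s, t[) `|g0 u|.
Proof.
move=> ig ig0 gg0 s0 st t1; have mg := integrable01_measurable ig.
have mg0 : measurable_fun setT (g0 : measurableTypeR R -> R).
  by apply/measurable_EFinP; exact: (measurable_int mu).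
rewrite !(prim_borel mg mg0 gg0)// ?(le_trans st)//.
rewrite Rintegral_itvB ?bnd_simp//; last exact: integrableS ig0.
rewrite -Rintegral_itv_bndo_bndc; last exact: integrableS ig0.
apply: le_normr_Rintegral; first exact: measurable_itv.
exact: integrableS ig0.
Qed.

(** Absolute continuity of the integral, applied to the union of the intervals: its measure is at
    most the sum of their lengths, and disjointness turns the integral over it into a sum. *)
Lemma ac01_prim (g : R -> R) : integrable01 g -> ac01 (prim g).
Proof.
move=> ig e e0; have [g0 [ig0 z0 gg0]] := integrable_borel_version ig.
have mg0 : measurable_fun setT (g0 : measurableTypeR R -> R).
  by apply/measurable_EFinP; exact: (measurable_int mu).
have [d [d0 dP]] := integral_normr_continuous ig0 e0.
exists d => // m a b ab tab sd.
pose U : set (measurableTypeR R) := \big[setU/set0]_(i < m) `]a i, b i[%classic.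
have mab i : measurable (`]a i, b i[%classic : set (measurableTypeR R)).
  exact: measurable_itv.
have mU : measurable U by exact: bigsetU_measurable.
have muU : (mu U < d%:E)%E.
  apply: le_lt_trans (measure_bigsetU_le mu mab) _.
  rewrite -lte_fin in sd; apply: le_lt_trans sd; rewrite -sumEFin lee_sum// => i _.
  have [? [? ?]] := ab i.
  apply: (@le_trans _ _ (mu `]a i, b i[%classic)); first by [].
  rewrite lebesgue_measure_itv/= lte_fin; case: ifPn => //.
  by rewrite lee_fin subr_ge0.
apply: le_lt_trans (dP _ mU muU).
have -> : \int[mu]_(x in U) `|g0 x| = \sum_(i < m) \int[mu]_(x in `]a i, b i[) `|g0 x|.
  rewrite /Rintegral /U integral_bigsetU_EFin//.
  - rewrite -[RHS]/(fine (\sum_(i < m) \int[mu]_(x in `]a i, b i[) `|g0 x|)%:E).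
    congr fine; rewrite -sumEFin; apply: eq_bigr => i _.
    rewrite /Rintegral fineK//; apply: integrable_fin_num => //.
    by apply: (@integrable_norm _ _ _ mu _ g0); exact: integrableS ig0.
  - exact: index_enum_uniq.
  - exact: sub_trivIset tab.
  - by apply/measurable_EFinP; apply: measurableT_comp => //; exact: measurable_funTS.
apply: ler_sum => i _; have [? [? ?]] := ab i.
exact: prim_itv_le.
Qed.

Lemma prim_unif (g : R -> R) (e : R) : integrable01 g -> 0 < e -> exists2 d : R, 0 < d &
  forall s t, 0 <= s -> s <= t -> t <= 1 -> t - s < d -> `|prim g t - prim g s| < e.
Proof.
move=> ig e0; have [d d0 dP] := ac01_prim ig e0; exists d => // s t s0 st t1 std.
have := dP 1%N (fun=> s) (fun=> t).
by rewrite !big_ord1; apply => // i j _ _ _; rewrite !ord1.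
Qed.

Lemma ac01_le (F G : R -> R) : (forall s t, 0 <= s -> s <= t -> t <= 1 ->
    `|F t - F s| <= `|G t - G s|) -> ac01 G -> ac01 F.
Proof.
move=> FG acG e e0; have [d d0 dP] := acG e e0.
exists d => // m a b ab tab sd; apply: le_lt_trans (dP m a b ab tab sd).
by apply: ler_sum => i _; have [? [? ?]] := ab i; exact: FG.
Qed.

End borel_lebesgue.

(** * Absolutely continuous functions are primitives *)

Section ac_ftc.
Context {R : realType}.
Notation mu := (@lebesgue_measure R).

Lemma borel_integrable01 (g : R -> R) : mu.-integrable setT (EFin \o g) -> integrable01 g.
Proof.
move=> ig.
have mg : measurable_fun setT (g : measurableTypeR R -> R).
  by apply/measurable_EFinP; exact: (measurable_int mu).
apply/integrableP; split; first exact/measurable_EFinP/borel_measurable01.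
have := @integral_leb_borel R `[0, 1] (fun t => `|(g t)%:E|%E) (measurable_itv _).
move=> ->//; last by apply: measurableT_comp => //; exact/measurable_EFinP.
by have /integrableP[_] : mu.-integrable `[0, 1] (EFin \o g) by exact: integrableS ig.
Qed.

Lemma ac01_fin (F : R -> R) (e d : R) : (forall (m : nat) (a b : 'I_m -> R),
      (forall i, 0 <= a i /\ a i <= b i /\ b i <= 1) ->
      trivIset setT (fun i => `]a i, b i[%classic) ->
      \sum_(i < m) (b i - a i) < d ->
      \sum_(i < m) `|F (b i) - F (a i)| < e) ->
  forall (I : finType) (a b : I -> R),
      (forall i, 0 <= a i /\ a i <= b i /\ b i <= 1) ->
      trivIset setT (fun i => `]a i, b i[%classic) ->
      \sum_(i : I) (b i - a i) < d ->
      \sum_(i : I) `|F (b i) - F (a i)| < e.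
Proof.
move=> H I a b ab tab sd.
have re (G : I -> R) : \sum_(i : I) G i = \sum_(j < #|I|) G (enum_val j).
  rewrite -(@big_enum_val _ _ _ _ I G).
  exact: eq_bigl.
rewrite re; apply: H => //.
  move=> i j _ _ ij; apply: enum_val_inj; exact: tab.
by rewrite -(re (fun i => b i - a i)).
Qed.

Lemma itv_partition_nth_lt (a b : R) (s : seq R) (i j : nat) :
  itv_partition a b s -> (i < j)%N -> (j <= size s)%N ->
  nth b (a :: s) i < nth b (a :: s) j.
Proof.
case=> ps _ ij js; have := @sorted_ltn_nth _ <%R lt_trans b (a :: s) ps.
by move=> /(_ i j) ->//; rewrite inE/= ltnS// ltnW// (leq_trans ij).
Qed.

(** The pieces of all the partitions, indexed by dependent pairs, form one finite disjoint family
    with the same total length as the original intervals. *)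
Lemma ac01_variation (F : R -> R) (e d : R) : (forall (m : nat) (a b : 'I_m -> R),
      (forall i, 0 <= a i /\ a i <= b i /\ b i <= 1) ->
      trivIset setT (fun i => `]a i, b i[%classic) ->
      \sum_(i < m) (b i - a i) < d ->
      \sum_(i < m) `|F (b i) - F (a i)| < e) ->
  forall (m : nat) (a b : 'I_m -> R) (s : 'I_m -> seq R),
      (forall i, 0 <= a i /\ a i <= b i /\ b i <= 1) ->
      trivIset setT (fun i => `]a i, b i[%classic) ->
      \sum_(i < m) (b i - a i) < d ->
      (forall i, itv_partition (a i) (b i) (s i)) ->
      \sum_(i < m) variation (a i) (b i) F (s i) < e.
Proof.
move=> H m a b s ab tab sd ps.
pose I := {i : 'I_m & 'I_(size (s i))}.
pose A (u : I) := nth (b (tag u)) (a (tag u) :: s (tag u)) (tagged u).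
pose B (u : I) := nth (b (tag u)) (a (tag u) :: s (tag u)) (tagged u).+1.
have sumI (G : forall i : 'I_m, nat -> R) :
   \sum_(u : I) G (tag u) (tagged u) = \sum_(i < m) \sum_(0 <= j < size (s i)) G i j.
  under [RHS]eq_bigr do rewrite big_mkord.
  by rewrite sig_big_dep.
have AB u : a (tag u) <= A u /\ B u <= b (tag u).
  split; first by apply: itv_partition_nth_ge => //; rewrite ltnS ltnW.
  by apply: itv_partition_nth_le => //; rewrite ltnS.
have := @ac01_fin F e d H I A B.
rewrite (sumI (fun i j => `|F (nth (b i) (a i :: s i) j.+1) - F (nth (b i) (a i :: s i) j)|)).
apply.
- move=> u; have [au bu] := AB u; have [a0 [_ b1]] := ab (tag u).
  by rewrite (le_trans a0)// (le_trans _ b1)// ltW// itv_partition_nth_lt.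
- move=> [i j] [i' j'] _ _ [x []]; rewrite /A /B /= !in_itv/= => /andP[x1 x2] /andP[x3 x4].
  have ii' : i = i'.
    apply: tab => //; exists x; split; rewrite /= in_itv/=; apply/andP; split.
    + by apply: le_lt_trans x1; have [] := AB (existT _ i j).
    + by apply: lt_le_trans x2 _; have [] := AB (existT _ i j).
    + by apply: le_lt_trans x3; have [] := AB (existT _ i' j').
    + by apply: lt_le_trans x4 _; have [] := AB (existT _ i' j').
  subst i'; congr existT; apply/val_inj => /=.
  have le (k l : nat) : (k <= l)%N -> (l <= size (s i))%N ->
      nth (b i) (a i :: s i) k <= nth (b i) (a i :: s i) l.
    rewrite leq_eqVlt => /orP[/eqP-> //|kl] ls.
    by apply: ltW; exact: itv_partition_nth_lt.
  case: (ltngtP j j') => // jj'.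
    by have /= := le j.+1 j' jj' (ltnW (ltn_ord j')); rewrite leNgt (lt_trans x3 x2).
  by have /= := le j'.+1 j jj' (ltnW (ltn_ord j)); rewrite leNgt (lt_trans x1 x4).
- rewrite (sumI (fun i j => nth (b i) (a i :: s i) j.+1 - nth (b i) (a i :: s i) j)).
  rewrite (eq_bigr (fun i => b i - a i))// => i _.
  rewrite telescope_sumr//=.
  by congr (_ - _); exact: itv_partition_nth_size.
Qed.

(** On an interval shorter than [d] the variation is at most 1, and variation is additive. Steps of
    length [d / 2] meet the strict requirement [< d], and at most [2 / d] rounded up of them cover
    [[0, 1]]. *)
Lemma ac01_TV_fin_num (F : R -> R) : ac01 F -> forall s t, 0 <= s -> s <= t -> t <= 1 ->
  total_variation s t F \is a fin_num.
Proof.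
move=> acF; have [d d0 /ac01_variation dP] := acF 1 ltr01.
have short s t : 0 <= s -> s <= t -> t <= 1 -> t - s < d ->
    total_variation s t F \is a fin_num.
  move=> s0 st t1 std; rewrite ge0_fin_numE ?total_variation_ge0//.
  apply: (@le_lt_trans _ _ 1%:E); last exact: ltry.
  apply: ge_ereal_sup => _ [_ [l pl <-] <-]; rewrite lee_fin ltW//.
  have := dP 1%N (fun=> s) (fun=> t) (fun=> l).
  rewrite !big_ord1; apply => // i j _ _ _; by rewrite !ord1.
have H (k : nat) : forall s t, 0 <= s -> s <= t -> t <= 1 -> t - s <= k%:R * (d / 2) ->
    total_variation s t F \is a fin_num.
  elim: k => [|k IH] s t s0 st t1 std.
    by apply: short => //; apply: le_lt_trans std _; rewrite mul0r.
  have [sdt|sdt] := leP (t - s) (d / 2); first by apply: short => //; lra.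
  rewrite (@total_variationD _ s t (s + d / 2)) ?fin_numD; [|lra|lra].
  rewrite short; [|lra|lra|lra|lra].
  by rewrite IH//; move: std; rewrite -natr1; lra.
move=> s t s0 st t1; apply: (H (Num.bound (2 / d))) => //.
have h : 2 / d < (Num.bound (2 / d))%:R by apply: archi_boundP; rewrite divr_ge0// ltW.
apply: (@le_trans _ _ (2 / d * (d / 2))); last by rewrite ler_pM2r ?divr_gt0// ltW.
have -> : 2 / d * (d / 2) = 1 by field; rewrite gt_eqF.
lra.
Qed.

Lemma ac01_TV (F : R -> R) : ac01 F ->
  ac01 (fun t => fine (total_variation 0 t F)).
Proof.
move=> acF e e0; have e20 : 0 < e / 2 by rewrite divr_gt0.
have [d d0 /ac01_variation dP] := acF _ e20; exists d => // m a b ab tab sd.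
apply: (@le_lt_trans _ _ (e / 2)); last lra.
apply/ler_addgt0Pr => eta eta0.
have TVab i : total_variation (a i) (b i) F \is a fin_num.
  by have [? [? ?]] := ab i; exact: ac01_TV_fin_num.
(* Each of the [m] variations is approximated within [eta'], so the errors total less than [eta];
   [m.+1] keeps the divisor nonzero. *)
pose eta' := eta / m.+1%:R.
have eta'0 : 0 < eta' by rewrite divr_gt0.
have /choice[s sP] : forall i, exists s, itv_partition (a i) (b i) s /\
    fine (total_variation (a i) (b i) F) <= variation (a i) (b i) F s + eta'.
  move=> i; have /ub_ereal_sup_adherent := TVab i => /(_ _ eta'0).
  move=> [_ [_ [s ps <-] <-]] h; exists s; split => //.
  rewrite -lerBlDr -lee_fin EFinB fineK//; exact: ltW.
have /ltW := dP m a b s ab tab sd (fun i => (sP i).1).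
move=> sv; rewrite -(subrK eta' (e / 2 + eta)).
apply: (@le_trans _ _ (\sum_(i < m) (variation (a i) (b i) F (s i) + eta'))).
  apply: ler_sum => i _; apply: le_trans (sP i).2.
  have [a0 [aib b1]] := ab i.
  rewrite (@total_variationD _ 0 (b i) (a i))// fineD//; last first.
    by apply: ac01_TV_fin_num => //; exact: le_trans b1.
  by rewrite addrC addKr ger0_norm// fine_ge0// total_variation_ge0.
rewrite big_split/= sumr_const card_ord -mulr_natr.
have : eta' * m%:R + eta' = eta.
  by rewrite /eta' -[X in _ + X]mulr1 -mulrDr natr1 mulfVK// pnatr_eq0.
lra.
Qed.

(** Composition with [clamp] extends a function on [[0, 1]] to the line by constants, so that it can
    define a Stieltjes measure. *)
Definition clamp (t : R) : R := Num.max 0 (Num.min t 1).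

Lemma clampB x y : x <= y -> 0 <= clamp y - clamp x <= y - x.
Proof.
rewrite /clamp /Order.max /Order.min => xy.
by repeat case: ifPn; rewrite -?leNgt; lra.
Qed.

Lemma clamp01 x : 0 <= clamp x <= 1.
Proof. by rewrite /clamp /Order.max /Order.min; repeat case: ifPn; rewrite -?leNgt; lra. Qed.

Lemma clamp_id x : 0 <= x <= 1 -> clamp x = x.
Proof. by rewrite /clamp /Order.max /Order.min; repeat case: ifPn; rewrite -?leNgt; lra. Qed.

(* Absolute continuity of the Lebesgue-Stieltjes measure of [G] on open sets:
   their components, cut to [0, 1], are disjoint intervals. *)
Lemma nd_ac01_open (G : R -> R) (e : R) : ac01 G ->
  (forall s t, 0 <= s -> s <= t -> t <= 1 -> G s <= G t) -> 0 < e ->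
  exists2 d : R, 0 < d & forall (nu : {measure set (measurableTypeR R) -> \bar R}) (U : set R),
  (forall s t, 0 <= s -> s <= t -> t <= 1 -> nu `]s, t]%classic = (G t - G s)%:E) ->
  open U -> (mu U < d%:E)%E -> (nu (U `&` `]0%R, 1%R]) <= e%:E)%E.
Proof.
move=> acG ndG e0; have [d d0 dP] := acG e e0; exists d => // nu U nuE oU mUd.
(* Components of [U] may be unbounded. Within a bounded interval around [[0, 1]], each component is
   the open interval from its [inf] to its [sup]. *)
pose U' := U `&` `]-1, 2[%classic.
have oU' : open U' by apply: openI => //; exact: interval_open.
pose I := open_disjoint_itv oU'.
have UI : U' = \bigcup_q I q := open_disjoint_itv_bigcup oU'.
have IU q : I q `<=` U' by rewrite UI; exact: bigcup_sup.
have tI : trivIset setT I by exact: open_disjoint_itv_trivIset.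
have IE q : I q = `]inf (I q), sup (I q)[%classic.
  rewrite -[LHS](interior_id _).1; last exact: open_disjoint_itv_open.
  rewrite interval_bounded_interior; last 3 first.
  - exact: open_disjoint_itv_is_interval.
  - by exists (-1) => x /IU[_]; rewrite /= in_itv/= => /andP[/ltW].
  - by exists 2 => x /IU[_]; rewrite /= in_itv/= => /andP[_ /ltW].
  by apply/seteqP; split => x; rewrite /= in_itv.
pose a q := clamp (inf (I q)); pose b q := clamp (sup (I q)).
have infsup q : inf (I q) <= sup (I q).
  have [->|/set0P[x Ix]] := eqVneq (I q) set0; first by rewrite inf0 sup0.
  have : `]inf (I q), sup (I q)[%classic x by rewrite -IE.
  by rewrite /= in_itv/= => /andP[h1 h2]; apply: ltW; exact: lt_trans h2.
have ab q : 0 <= a q /\ a q <= b q /\ b q <= 1.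
  rewrite /a /b /clamp; have := infsup q.
  by rewrite !le_max !ge_max !le_min !ge_min !lexx; lra.
have mI q : measurable (I q : set (measurableTypeR R)).
  by rewrite IE; exact: measurable_itv.
have mJ q : measurable (I q `&` `]0, 1] : set (measurableTypeR R)).
  by apply: measurableI => //; exact: measurable_itv.
have JE : U `&` `]0, 1] = \bigcup_q (I q `&` `]0, 1]).
  rewrite -setI_bigcupl -UI /U' -setIA; congr (_ `&` _); apply/seteqP; split => x.
    by rewrite /= !in_itv/= => /andP[x0 x1]; split => //; lra.
  by case.
have JE' : U `&` `]0, 1] `<=` \bigcup_q (I q `&` `]0, 1]) by rewrite JE.
have mU : measurable (U `&` `]0, 1] : set (measurableTypeR R)).
  by rewrite JE; exact: bigcupT_measurable.
apply: le_trans (measure_sigma_subadditive nu mJ mU JE') _.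
apply: lime_le; first exact: is_cvg_nneseries.
near=> m.
have abI (q : nat) x : a q < x < b q -> I q x.
  rewrite IE /= in_itv/= /a /b /clamp gt_max lt_max lt_min.
  by move=> /andP[/andP[x0 x1] x2]; move: x1 x2; rewrite gt_min; lra.
apply: (@le_trans _ _ (\sum_(q < m) `|G (b q) - G (a q)|)%:E); last first.
  rewrite lee_fin ltW//; apply: (dP m (fun q => a q) (fun q => b q)) => //.
    move=> i j _ _ [x [/abI xi /abI xj]]; apply/val_inj; apply: tI => //.
    by exists x.
  rewrite -lte_fin; apply: le_lt_trans mUd.
  apply: (@le_trans _ _ (mu U')).
    rewrite UI measure_bigcup//.
    apply: (@le_trans _ _ (\sum_(0 <= q < m | q \in [set: nat]) mu (I q))%E); last exact: nneseries_lim_ge.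
    rewrite [in leRHS]big_mkord [in leRHS](eq_bigl xpredT); last by move=> q /=; rewrite mem_set.
    rewrite -sumEFin; apply: lee_sum => q _.
    rewrite [in leRHS]IE.
    apply: (@le_trans _ _ (mu `]inf (I q), sup (I q)[%classic)); last by [].
    rewrite lebesgue_measure_itv/= lte_fin.
    have := infsup q; rewrite le_eqVlt => /orP[/eqP E|->].
      by rewrite /a /b E ltxx subrr.
    by rewrite -EFinB lee_fin; have /andP[] := clampB (infsup q).
  by apply: le_measure; rewrite ?inE//; [exact: open_measurable|exact: open_measurable|exact: subIsetl].
rewrite big_mkord -sumEFin; apply: lee_sum => q _; have [a0 [aqb b1]] := ab q.
rewrite ger0_norm ?subr_ge0 ?ndG// -nuE//; apply: le_measure; rewrite ?inE//.
move=> x [Ix]; move: (Ix); rewrite IE /= !in_itv/= /a /b /clamp => /andP[x1 x2] /andP[x3 x4].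
rewrite gt_max x3/= le_max le_min x4 (ltW x2) gt_min x1 /= orbT//.
Unshelve. all: by end_near.
Qed.

Lemma ac01_continuous (G : R -> R) : ac01 G -> continuous (G \o clamp).
Proof.
move=> acG.
  move=> x; apply/cvgrPdist_lt => e e0; have [d d0 dP] := acG e e0.
  near=> y.
  have {dP} dP s t : 0 <= s -> s <= t -> t <= 1 -> t - s < d -> `|G t - G s| < e.
    move=> s0 st t1 std; have := dP 1%N (fun=> s) (fun=> t).
    by rewrite !big_ord1; apply => // i j _ _ _; rewrite !ord1.
  have xyd : `|x - y| < d by near: y; apply: cvgr_dist_lt.
  have /andP[? ?] := clamp01 x; have /andP[? ?] := clamp01 y.
  rewrite /=; case: (leP x y) => xy.
    rewrite distrC; have /andP[? ?] := clampB xy.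
    have xyd' : y - x < d by move: xyd; rewrite distrC ger0_norm// subr_ge0.
    by apply: (dP (clamp x) (clamp y)); lra.
  have /andP[? ?] := clampB (ltW xy).
  have xyd' : x - y < d by move: xyd; rewrite ger0_norm// subr_ge0 ltW.
  by apply: (dP (clamp y) (clamp x)); lra.
Unshelve. all: by end_near. Qed.

Lemma ac01_measurable (G : R -> R) : ac01 G -> measurable01 G.
Proof.
move=> /ac01_continuous cG.
have mG : measurable01 (G \o clamp).
  by apply: borel_measurable01; exact: continuous_measurable_fun.
apply: eq_measurable_fun mG => t /set_mem; rewrite /I01 /= in_itv => t01.
by rewrite clamp_id.
Qed.

(** A Lebesgue null set lies in an open set of arbitrarily small measure, so [nd_ac01_open] makes
    the Stieltjes measure of the clamped [G] absolutely continuous. Its Radon-Nikodym derivative,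
    taken after restriction to []0, 1]] where the measure is finite, is the density. *)
Lemma nd_ac01_ftc (G : R -> R) : ac01 G ->
  (forall s t, 0 <= s -> s <= t -> t <= 1 -> G s <= G t) ->
  exists2 g, integrable01 g & forall t, 0 <= t <= 1 -> G t = G 0 + prim g t.
Proof.
move=> acG ndG; pose Gc : R -> R := G \o clamp.
have ndGc : {homo Gc : x y / x <= y}.
  move=> x y xy; have /andP[? ?] := clampB xy.
  have /andP[? ?] := clamp01 x; have /andP[? ?] := clamp01 y.
  by apply: ndG => //; lra.
have cGc : continuous Gc := ac01_continuous acG.
pose build := isCumulative.Build R _ R Gc ndGc (right_continuousW cGc).
pose Gcum : cumulative R R := HB.pack Gc build.
pose nu := lebesgue_stieltjes_measure Gcum.
have nuE s t : s <= t -> nu `]s, t]%classic = (Gc t - Gc s)%:E.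
  move=> st; rewrite /nu /lebesgue_stieltjes_measure /measure_extension.
  by rewrite measurable_mu_extE/= ?wlength_itv_bnd//; exact: is_ocitv.
have Gc0 : Gc 0 = G 0 by rewrite /Gc/= clamp_id// lexx ler01.
have m01 : measurable (`]0, 1]%classic : set (measurableTypeR R)) by exact: measurable_itv.
have nu01 : (nu `]0%R, 1%R]%classic < +oo)%E by rewrite nuE// ltry.
pose nu1 := charge_of_finite_measure (mfrestr m01 nu01).
have nu1mu : nu1 `<< mu.
  apply/null_content_dominatesP => A mA A0; apply/eqP; rewrite eq_le measure_ge0 andbT.
  apply/lee_addgt0Pr => e e0; rewrite add0e.
  have [d d0 dP] := nd_ac01_open acG ndG e0.
  have A_oo : (mu A < +oo)%E by rewrite A0.
  have [U [oU AU muU]] := lebesgue_regularity_outer mA A_oo d0.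
  have mU : measurable (U : set (measurableTypeR R)) by exact: open_measurable.
  apply: (@le_trans _ _ (nu (U `&` `]0, 1]))).
    apply: (@le_measure _ _ _ nu); rewrite ?inE.
    - exact: measurableI.
    - exact: measurableI.
    - exact: setSI.
  apply: dP => //.
    move=> s t s0 st t1; rewrite -[LHS]/(nu `]s, t]%classic) nuE// /Gc/= !clamp_id//; lra.
  apply: le_lt_trans muU; have UA : U = (U `\` A) `|` A by rewrite setUC setDUK.
  rewrite [in leLHS]UA; have := measureU2 mu (measurableD mU mA) mA.
  by move=> /le_trans; apply; rewrite A0 adde0.
pose g := fine \o (Radon_Nikodym nu1 mu).
have ig : mu.-integrable setT (EFin \o g).
  apply: (@eq_integrable _ _ _ mu setT measurableT (Radon_Nikodym nu1 mu)).
    by move=> x _; rewrite /= fineK// Radon_Nikodym_fin_num.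
  exact: Radon_Nikodym_integrable.
exists g; first exact: borel_integrable01.
move=> t /andP[t0 t1].
have mg : measurable_fun setT (g : measurableTypeR R -> R).
  by apply/measurable_EFinP; exact: (measurable_int mu).
rewrite (prim_borel (borel_measurable01 mg) mg)//; last exact: ae01T.
rewrite -Rintegral_itv_obnd_cbnd; last exact: integrableS ig.
have : nu1 `]0, t]%classic = (G t - G 0)%:E.
  rewrite /nu1 /charge_of_finite_measure /mfrestr /mrestr.
  transitivity (nu `]0, t]%classic).
    by congr (nu _); apply: setIidl; apply: subset_itvl; rewrite bnd_simp.
  by rewrite nuE// Gc0 /Gc /= clamp_id// t0.
have RNE : nu1 `]0, t]%classic = (\int[mu]_(x in `]0%R, t]) Radon_Nikodym nu1 mu x)%E.
  by apply: (Radon_Nikodym_integral nu1mu); exact: measurable_itv.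
rewrite RNE /Rintegral => H.
have -> : (\int[mu]_(x in `]0%R, t]) (g x)%:E = \int[mu]_(x in `]0%R, t]) ((Radon_Nikodym nu1 mu)) x)%E.
  by apply: eq_integral => x _; rewrite /= fineK// Radon_Nikodym_fin_num.
by rewrite H /= addrC subrK.
Qed.

(** Jordan decomposition: with [V] the variation of [F] from 0, both [V] and [V - F] are
    nondecreasing and absolutely continuous, the latter because its increments are at most twice
    those of [V]. *)
Lemma ac01_ftc (F : R -> R) : ac01 F ->
  exists2 g, integrable01 g & forall t, 0 <= t <= 1 -> F t = F 0 + prim g t.
Proof.
move=> acF; pose V t := fine (total_variation 0 t F).
have acV := ac01_TV acF; rewrite -/V in acV.
have VB s t : 0 <= s -> s <= t -> t <= 1 -> `|F t - F s| <= V t - V s.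
  move=> s0 st t1; rewrite /V (@total_variationD _ 0 t s)// fineD; last 2 first.
  - by apply: ac01_TV_fin_num => //; exact: le_trans t1.
  - exact: ac01_TV_fin_num.
  rewrite addrAC subrr add0r -lee_fin fineK; last exact: ac01_TV_fin_num.
  exact: total_variation_ge.
have ndV s t : 0 <= s -> s <= t -> t <= 1 -> V s <= V t.
  by move=> s0 st t1; rewrite -subr_ge0; apply: le_trans (VB _ _ s0 st t1).
have [g1 ig1 g1P] := nd_ac01_ftc acV ndV.
have acW : ac01 (fun t => V t - F t).
  have : ac01 (fun t => 2 * V t).
    move=> e e0; have [d d0 dP] := acV _ (divr_gt0 e0 (ltr0n _ 2)).
    exists d => // m a b ab tab sd; have := dP m a b ab tab sd.
    rewrite ltr_pdivlMr// mulrC mulr_sumr; apply: le_lt_trans; apply: ler_sum => i _.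
    by rewrite -mulrBr normrM ger0_norm.
  apply: ac01_le => s t s0 st t1; have := VB _ _ s0 st t1; have := ndV _ _ s0 st t1.
  by rewrite !ler_norml; move=> h1 /andP[h2 h3]; rewrite ger0_norm; lra.
have [|g2 ig2 g2P] := nd_ac01_ftc acW _.
  move=> s t s0 st t1; have := VB _ _ s0 st t1.
  by rewrite ler_norml => /andP[h2 h3]; lra.
exists (fun t => g1 t - g2 t); first exact: integrable01B.
move=> t t01; have /andP[t0 t1] := t01; rewrite primB//.
have := g1P _ t01; have := g2P _ t01; lra.
Qed.

End ac_ftc.

Lemma cvg_for (T : Type) (U V : topologicalType) (F : set_system T) {FF : Filter F}
    (h : U -> V) (g : T -> U) (a : U) :
  {for a, continuous h} -> g x @[x --> F] --> a -> h (g x) @[x --> F] --> h a.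
Proof. exact: continuous_cvg. Qed.

Lemma cvg_for2 (T : Type) (U V W : topologicalType) (F : set_system T) {FF : Filter F}
    (h : U -> V -> W) (g : T -> U) (k : T -> V) (a : U) (b : V) :
  {for (a, b), continuous (fun z : U * V => h z.1 z.2)} ->
  g x @[x --> F] --> a -> k x @[x --> F] --> b -> h (g x) (k x) @[x --> F] --> h a b.
Proof. by move=> ch ga kb; exact: (cvg_comp _ _ (cvg_pair ga kb) ch). Qed.

(** * Compactness *)

Section arzela_ascoli.
Context {R : realType}.

Lemma ultra_cvg_compact (T : Type) (V : topologicalType) (F : set_system T)
  (FF : UltraFilter F) (K : set V) (f : T -> V) : compact K ->
  F (f @^-1` K) -> exists2 y, K y & f x @[x --> F] --> y.
Proof.
move=> cK FK; have [y [Ky yc]] := cK (f @ F) _ FK.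
exists y => // B nB; have [//|FnB] := in_ultra_setVsetC (f @^-1` B) FF.
have [z [/= nz Bz]] := yc (~` B) B FnB nB.
by case: nz.
Qed.

Lemma grid_near (d : R) : 0 < d -> exists N : nat, forall t, 0 <= t <= 1 ->
  exists i : 'I_N.+1, 0 <= (i%:R / N%:R : R) <= 1 /\ `|t - i%:R / N%:R| < d.
Proof.
move=> d0; exists (Num.bound d^-1).+1; set N := (Num.bound d^-1).+1 => t /andP[t0 t1].
have N0 : 0 < N%:R :> R by rewrite ltr0n.
have Nd : N%:R^-1 < d.
  rewrite invf_plt// ?posrE//; apply: lt_le_trans (archi_boundP _) _; first by rewrite invr_ge0 ltW.
  by rewrite ler_nat.
have tN : 0 <= t * N%:R by rewrite mulr_ge0// ltW.
have /andP[h1 h2] := truncn_itv tN.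
have tr : (Num.truncn (t * N%:R) < N.+1)%N.
  rewrite ltnS -(@ler_nat R) (le_trans h1)// ler_piMl// ltW//.
exists (Ordinal tr) => /=; split.
  rewrite divr_ge0//= ler_pdivrMr// mul1r (le_trans h1)// ler_piMl// ltW//.
have -> : t - (Num.truncn (t * N%:R))%:R / N%:R = (t * N%:R - (Num.truncn (t * N%:R))%:R) / N%:R.
  by rewrite mulrBl mulfK// gt_eqF.
rewrite normrM ger0_norm ?subr_ge0// gtr0_norm ?invr_gt0//.
apply: lt_trans Nd; rewrite -[ltRHS]mul1r ltr_pM2r ?invr_gt0//.
rewrite ltrBlDr; apply: lt_le_trans h2 _; rewrite -natr1; lra.
Qed.

(** An ultrafilter finer than [\oo] replaces the diagonal extraction: along it [x j t] converges for
    every [t] at once, and equicontinuity upgrades this to uniform convergence through a finite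
    grid. Indices are then picked in the ultrafilter sets, so [sigma] dominates the identity without
    being monotone, which is enough to transfer limits. *)
Lemma arzela_ascoli (V : normedModType R) (K : set V) (x : nat -> R -> V) :
  compact K ->
  (forall j t, 0 <= t <= 1 -> K (x j t)) ->
  (forall e, 0 < e -> exists2 d, 0 < d & forall j s t, 0 <= s <= 1 -> 0 <= t <= 1 ->
     `|s - t| < d -> `|x j s - x j t| < e) ->
  exists (sigma : nat -> nat) (y : R -> V), [/\ forall m, (m <= sigma m)%N,
    forall t, 0 <= t <= 1 -> K (y t) &
    forall e, 0 < e -> exists N, forall m, (N <= m)%N -> forall t, 0 <= t <= 1 ->
      `|x (sigma m) t - y t| < e].
Proof.
move=> cK xK ec.
have [F [FF ooF]] := @ultraFilterLemma nat \oo _.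
have ex_y t : exists y : V, 0 <= t <= 1 -> K y /\ x j t @[j --> F] --> y.
  have [t01|] := pselect (0 <= t <= 1); last by exists 0.
  have [|y Ky yc] := @ultra_cvg_compact _ _ _ FF K (x ^~ t) cK; last by exists y.
  by apply: filterE => j; exact: xK.
have [y yP] := choice ex_y; have yK t t01 := (yP t t01).1; have {}yP t t01 := (yP t t01).2.
have yec e : 0 < e -> exists2 d, 0 < d & forall s t, 0 <= s <= 1 -> 0 <= t <= 1 ->
     `|s - t| < d -> `|y s - y t| <= e.
  move=> e0; have [d d0 dP] := ec _ e0; exists d => // s t s01 t01 std.
  have h : (fun j => `|x j s - x j t|) @ F --> `|y s - y t|.
    by apply: cvg_norm; apply: cvgB; exact: yP.
  apply: (closed_cvg (fun z => z <= e) _ _ _ h); first exact: closed_le.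
  by apply: filterE => j; apply: ltW; exact: dP.
have unif e : 0 < e -> F [set j | forall t, 0 <= t <= 1 -> `|x j t - y t| < e].
  move=> e0; have e30 : 0 < e / 3 by rewrite divr_gt0.
  have [d d0 dP] := ec _ e30; have [d' d'0 dP'] := yec _ e30.
  have [|N NP] := @grid_near (Num.min d d'); first by rewrite lt_min d0.
  have := @filter_forall nat 'I_N.+1 (fun i j => 0 <= (i%:R / N%:R : R) <= 1 ->
     `|x j (i%:R / N%:R) - y (i%:R / N%:R)| < e / 3) F _.
  move=> H; have {}H : F [set j | forall i : 'I_N.+1, 0 <= (i%:R / N%:R : R) <= 1 ->
     `|x j (i%:R / N%:R) - y (i%:R / N%:R)| < e / 3].
    apply: H => i; have [i01|ni] := pselect (0 <= (i%:R / N%:R : R) <= 1); last by apply: filterE.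
    have /cvgrPdist_lt/(_ _ e30) := yP _ i01.
    by apply: filterS => j h _; rewrite distrC.
  apply: filterS H => j jP t t01; have [i [i01]] := NP t t01.
  rewrite lt_min => /andP[id id'].
  have h1 := dP j _ _ t01 i01 id; have h2 := dP' _ _ t01 i01 id'; have h3 := jP i i01.
  have h4 := ler_distD (x j (i%:R / N%:R)) (x j t) (y t).
  have h5 := ler_distD (y (i%:R / N%:R)) (x j (i%:R / N%:R)) (y t).
  move: h2; rewrite distrC; lra.
have /choice[sigma sP] : forall m : nat, exists j, (m <= j)%N /\
    forall t, 0 <= t <= 1 -> `|x j t - y t| < m.+1%:R^-1.
  move=> m; have m0 : 0 < m.+1%:R^-1 :> R by rewrite invr_gt0.
  have : F [set j | (m <= j)%N] by apply: ooF; exists m.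
  by move/(filterI (unif _ m0))/filter_ex => [j [h1 h2]]; exists j.
exists sigma, y; split => [m|//|e e0]; first by have [] := sP m.
have [N NP] : exists N : nat, N.+1%:R^-1 < e.
  exists (Num.bound e^-1); rewrite invf_plt// ?posrE//.
  apply: lt_trans (archi_boundP _) _; first by rewrite invr_ge0 ltW.
  by rewrite ltr_nat.
exists N => m Nm t t01; apply: lt_trans ((sP m).2 t t01) _.
by apply: le_lt_trans NP; rewrite lef_pV2 ?posrE// ler_nat.
Qed.

End arzela_ascoli.

(** * Measurability of compositions and measurable selection *)

Section caratheodory_functions.
Context {R : realType}.

Lemma measurable01_countable (C : countType) (q : R -> C) (g : R -> C -> R) :
  (forall c, measurable (I01 `&` q @^-1` [set c] : set (lebesgueR R))) ->
  (forall c, measurable01 (g ^~ c)) -> measurable01 (fun t => g t (q t)).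
Proof.
move=> mq mg mI Y mY.
rewrite [X in measurable X](_ : _ =
    \bigcup_c ((I01 `&` q @^-1` [set c]) `&` (I01 `&` (g ^~ c) @^-1` Y))).
  apply: countable_bigcupT_measurable; first exact: countableP.
  by move=> c; apply: measurableI; [exact: mq|exact: mg].
apply/seteqP; split => t.
  by move=> [It Yt]; exists (q t) => //.
by move=> [c _ [[It /= <-] [_ Yt]]].
Qed.

Lemma measurable01_lim (g : nat -> R -> R) (h : R -> R) :
  (forall m, measurable01 (g m)) -> (forall t, I01 t -> g m t @[m --> \oo] --> h t) ->
  measurable01 h.
Proof. exact: measurable_fun_cvg. Qed.

(** With [rV_unfloor], rounding to the grid of mesh [1 / m.+1]. Integer codes give both
    approximation by functions with countably many values and a countable dense set. *)
Definition rV_floor n (m : nat) (u : 'rV[R]_n) : 'rV[int]_n :=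
  \row_i Num.floor (m.+1%:R * u ord0 i).

Definition rV_unfloor n (m : nat) (q : 'rV[int]_n) : 'rV[R]_n :=
  \row_i ((q ord0 i)%:~R / m.+1%:R).

Lemma mx_norm_leP n (u : 'rV[R]_n) (e : R) : 0 <= e -> (forall i, `|u ord0 i| <= e) -> `|u| <= e.
Proof.
move=> e0 ue; rewrite /Num.Def.normr/= mx_normrE; apply: bigmax_le => // -[i j] _ /=.
by rewrite (ord1 i).
Qed.

Lemma coord_le_norm n (u : 'rV[R]_n) i : `|u ord0 i| <= `|u|.
Proof.
rewrite [leRHS]/Num.Def.normr/= mx_normrE.
exact: (le_bigmax _ (fun ij => `|u ij.1 ij.2|) (ord0, i)).
Qed.

Lemma rV_unfloor_near n (m : nat) (u : 'rV[R]_n) :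
  `|rV_unfloor m (rV_floor m u) - u| <= m.+1%:R^-1.
Proof.
apply: mx_norm_leP => [|i]; first by rewrite invr_ge0.
rewrite !mxE.
have m0 : 0 < m.+1%:R :> R by rewrite ltr0n.
have /andP[h1 h2] := floor_itv (m.+1%:R * u ord0 i).
rewrite -(ler_pM2r m0) mulVf ?gt_eqF// -[X in _ * X](gtr0_norm m0) -normrM mulrBl divfK ?gt_eqF//.
rewrite ler_norml; move: h2; rewrite intrD1 mulrC => h2; rewrite mulrC in h1.
by apply/andP; split; lra.
Qed.

Lemma rV_unfloor_cvg n (u : 'rV[R]_n) :
  rV_unfloor m (rV_floor m u) @[m --> \oo] --> u.
Proof.
apply/cvgrPdist_lt => e e0; near=> m; rewrite distrC.
apply: le_lt_trans (rV_unfloor_near m u) _.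
by near: m; exact: near_infty_natSinv_lt (PosNum e0).
Unshelve. all: by end_near. Qed.

Lemma measurable_rV_floor n (m : nat) (u : R -> 'rV[R]_n) :
  (forall i, measurable01 (fun t => u t ord0 i)) -> forall c : 'rV[int]_n,
  measurable (I01 `&` (fun t => rV_floor m (u t)) @^-1` [set c] : set (lebesgueR R)).
Proof.
move=> mu c.
have mI : measurable (I01 : set (lebesgueR R)) by exact: measurable_itv_lebesgueR.
have m0 : 0 < m.+1%:R :> R by rewrite ltr0n.
rewrite [X in measurable X](_ : _ = I01 `&` \bigcap_(i in [set: 'I_n])
   (I01 `&` (fun t => u t ord0 i) @^-1` `[(c ord0 i)%:~R / m.+1%:R, (c ord0 i + 1)%:~R / m.+1%:R[)).
  apply: measurableI => //; apply: fin_bigcap_measurable; first exact: finite_finset.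
  by move=> i _; apply: mu => //; exact: measurable_itv.
apply/seteqP; split => t [It h]; split => //.
  move=> i _; split => //; rewrite /= in_itv/= ler_pdivrMr// ltr_pdivlMr// mulrC.
  by rewrite -floor_eq -h mxE.
apply/rowP => i; rewrite mxE; have [_] := h i I.
rewrite /= in_itv/= ler_pdivrMr// ltr_pdivlMr// mulrC -floor_eq => /eqP //.
Qed.

(** Rounding [u] to a grid leaves countably many values, on each of which [g] is measurable in [t];
    continuity in the second variable gives the limit. *)
Lemma measurable01_caratheodory n (g : R -> 'rV[R]_n -> R) (u : R -> 'rV[R]_n) :
  (forall z, measurable01 (g ^~ z)) -> (forall t, I01 t -> {for u t, continuous (g t)}) ->
  (forall i, measurable01 (fun t => u t ord0 i)) ->
  measurable01 (fun t => g t (u t)).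
Proof.
move=> mg cg mu.
apply: (@measurable01_lim (fun m t => g t (rV_unfloor m (rV_floor m (u t))))).
  move=> m; apply: (@measurable01_countable _ (fun t => rV_floor m (u t))
    (fun t c => g t (rV_unfloor m c))); first exact: measurable_rV_floor.
  by move=> c; exact: mg.
move=> t It; apply: (@cvg_for _ _ _ _ _ (g t) (fun m => rV_unfloor m (rV_floor m (u t)))); first exact: cg.
exact: rV_unfloor_cvg.
Qed.

Lemma measurable01_caratheodory2 n k (g : R -> 'rV[R]_n -> 'rV[R]_k -> R)
    (u : R -> 'rV[R]_n) (v : R -> 'rV[R]_k) :
  (forall z w, measurable01 (fun t => g t z w)) ->
  (forall t, I01 t -> {for (u t, v t), continuous (fun z : 'rV[R]_n * 'rV[R]_k => g t z.1 z.2)}) ->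
  (forall i, measurable01 (fun t => u t ord0 i)) ->
  (forall i, measurable01 (fun t => v t ord0 i)) ->
  measurable01 (fun t => g t (u t) (v t)).
Proof.
move=> mg cg mu mv.
apply: (@measurable01_lim (fun m t => g t (rV_unfloor m (rV_floor m (u t)))
                                          (rV_unfloor m (rV_floor m (v t))))).
  move=> m; apply: (@measurable01_countable _ (fun t => rV_floor m (u t))
    (fun t c => g t (rV_unfloor m c) (rV_unfloor m (rV_floor m (v t))))).
    exact: measurable_rV_floor.
  move=> c; apply: (@measurable01_countable _ (fun t => rV_floor m (v t))
    (fun t d => g t (rV_unfloor m c) (rV_unfloor m d))).
    exact: measurable_rV_floor.
  by move=> d; exact: mg.
move=> t It; apply: (cvg_comp _ _ (cvg_pair _ _) (cg t It)); exact: rV_unfloor_cvg.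
Qed.

End caratheodory_functions.

(** * Euclidean norm against max norm, and the retraction onto the unit ball *)

Section euclidean_norm.
Context {R : realType}.

Lemma dotvv_ge0 n (u : 'rV[R]_n) : 0 <= dotv u u.
Proof. by apply: sumr_ge0 => i _; rewrite -expr2 sqr_ge0. Qed.

Lemma enorm_ge0 n (u : 'rV[R]_n) : 0 <= enorm u.
Proof. exact: sqrtr_ge0. Qed.

Lemma enorm0 n : enorm (0 : 'rV[R]_n) = 0.
Proof. by rewrite /enorm /dotv big1 ?sqrtr0// => i _; rewrite !mxE mul0r. Qed.

Lemma coord_le_enorm n (u : 'rV[R]_n) i : `|u ord0 i| <= enorm u.
Proof.
rewrite -sqrtr_sqr ler_sqrt; last exact: dotvv_ge0.
rewrite /dotv (bigD1 i)//= -expr2 lerDl.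
by apply: sumr_ge0 => j _; rewrite -expr2 sqr_ge0.
Qed.

Lemma norm_le_enorm n (u : 'rV[R]_n) : `|u| <= enorm u.
Proof. by apply: mx_norm_leP => [|i]; [exact: enorm_ge0|exact: coord_le_enorm]. Qed.

(** Cruder than the optimal factor [sqrt n]; it is the origin of the factors [n%:R] in the later
    estimates. *)
Lemma enorm_le_norm n (u : 'rV[R]_n) : enorm u <= n%:R * `|u|.
Proof.
rewrite -[leRHS]ger0_norm ?mulr_ge0// -sqrtr_sqr ler_wsqrtr//.
apply: (@le_trans _ _ (\sum_(i < n) `|u| ^+ 2)).
  apply: ler_sum => i _; rewrite -expr2 -real_normK ?num_real// lerXn2r ?nnegrE//.
  exact: coord_le_norm.
rewrite big_const_ord iter_addr_0 -[`|u| ^+ 2 *+ n]mulr_natl exprMn; apply: ler_wpM2r; first exact: sqr_ge0.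
by rewrite -natrX ler_nat; case: n {u} => // n; rewrite expnS expn1 leq_pmulr.
Qed.

Lemma dotvZ n (k : R) (u v : 'rV[R]_n) : dotv (k *: u) v = k * dotv u v.
Proof. by rewrite /dotv mulr_sumr; apply: eq_bigr => i _; rewrite mxE mulrA. Qed.

Lemma dotvC n (u v : 'rV[R]_n) : dotv u v = dotv v u.
Proof. by apply: eq_bigr => i _; rewrite mulrC. Qed.

Lemma dotvB n (u v w : 'rV[R]_n) : dotv (u - v) w = dotv u w - dotv v w.
Proof. by rewrite /dotv -sumrB; apply: eq_bigr => i _; rewrite !mxE mulrBl. Qed.

Lemma enormZ n (k : R) (u : 'rV[R]_n) : enorm (k *: u) = `|k| * enorm u.
Proof.
by rewrite /enorm dotvZ dotvC dotvZ mulrA -expr2 sqrtrM ?sqr_ge0// sqrtr_sqr.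
Qed.

Lemma cvg_coord n (T : Type) (F : set_system T) {FF : Filter F} (u : T -> 'rV[R]_n) (a : 'rV[R]_n) i :
  u x @[x --> F] --> a -> u x ord0 i @[x --> F] --> a ord0 i.
Proof. by move=> ua; apply: (cvg_for (@coord_continuous _ _ _ ord0 i a) ua). Qed.

Lemma cvg_dotv n (T : Type) (F : set_system T) {FF : Filter F} (u v : T -> 'rV[R]_n) a b :
  u x @[x --> F] --> a -> v x @[x --> F] --> b -> dotv (u x) (v x) @[x --> F] --> dotv a b.
Proof.
move=> ua vb; apply: cvg_big => [|i _]; first exact: add_continuous.
by apply: cvgM; exact: cvg_coord.
Qed.

Lemma cvg_enorm n (T : Type) (F : set_system T) {FF : Filter F} (u : T -> 'rV[R]_n) a :
  u x @[x --> F] --> a -> enorm (u x) @[x --> F] --> enorm a.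
Proof.
move=> ua; apply: (@cvg_for _ _ _ _ _ Num.sqrt (fun x => dotv (u x) (u x))).
  exact: sqrt_continuous.
exact: cvg_dotv.
Qed.

Lemma enorm_continuous n : continuous (@enorm R n).
Proof. by move=> u; exact: (cvg_enorm (@cvg_id _ (nbhs u))). Qed.

Lemma eball_compact n (r : R) : compact (eball n r : set 'rV[R]_n).
Proof.
apply: bounded_closed_compact.
  exists r; split; first exact: num_real.
  move=> M rM u ur; apply: le_trans (ltW rM); exact: le_trans (norm_le_enorm u) ur.
apply: (@closed_comp _ _ (@enorm R n) [set x | x <= r]); last exact: closed_le.
by move=> u _; exact: enorm_continuous.
Qed.

(** Radial projection onto the closed unit ball. [f] and [l] are controlled only for controls in the
    ball; composed with it they become Caratheodory on the whole space and keep their values on the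
    ball. *)
Definition retract n (a : 'rV[R]_n) : 'rV[R]_n := (Num.max 1 (enorm a))^-1 *: a.

Lemma retract_eball n (a : 'rV[R]_n) : eball n 1 (retract a).
Proof.
rewrite /eball /= enormZ ger0_norm ?invr_ge0 ?le_max ?ler01// mulrC.
by rewrite ler_pdivrMr ?lt_max ?ltr01// mul1r le_max lexx orbT.
Qed.

Lemma retract_id n (a : 'rV[R]_n) : eball n 1 a -> retract a = a.
Proof. by rewrite /eball /= /retract => /max_idPl ->; rewrite invr1 scale1r. Qed.

Lemma cvg_retract n (T : Type) (F : set_system T) {FF : Filter F} (u : T -> 'rV[R]_n) a :
  u x @[x --> F] --> a -> retract (u x) @[x --> F] --> retract a.
Proof.
move=> ua; apply: cvgZ; last exact: ua.
apply: cvgV; first by rewrite gt_eqF// lt_max ltr01.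
apply: (@cvg_for _ _ _ _ _ (fun z : R => Num.max 1 z) (fun x => enorm (u x))).
  by apply: continuous_max; [exact: cst_continuous|exact: cvg_id].
exact: cvg_enorm.
Qed.

End euclidean_norm.

Section measurable_selection.
Context {R : realType}.

(** [a] is a limit along an ultrafilter, chosen before [h]: the same point serves for several
    continuous functions, here a coordinate and [psi t]. *)
Lemma compact_seq_le (V : topologicalType) (K : set V) (z : nat -> V) : compact K ->
  (forall m, K (z m)) -> exists2 a, K a &
  forall (h : V -> R) r, {for a, continuous h} -> (forall m, h (z m) <= r + m.+1%:R^-1) -> h a <= r.
Proof.
move=> cK zK; have [F [FF ooF]] := @ultraFilterLemma nat \oo _.
have [a Ka za] := @ultra_cvg_compact _ _ F FF K z cK (@filterE _ F _ _ zK).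
exists a => // h r ch hz.
have hza : (h (z m) @[m --> F] --> h a) by exact: cvg_for.
have rr : ((r + m.+1%:R^-1) @[m --> F] --> r).
  have : ((r + m.+1%:R^-1) @[m --> \oo] --> r + 0).
    by apply: cvgD; [exact: cvg_cst|exact: cvg_harmonic].
  by rewrite addr0; apply: cvg_trans; exact: cvg_app.
exact: (ler_cvg_to hza rr (@filterE _ F _ _ hz)).
Qed.

Lemma ball_dense n (a : 'rV[R]_n) (e : R) : eball n 1 a -> 0 < e ->
  exists m (q : 'rV[int]_n), `|retract (rV_unfloor m q) - a| < e.
Proof.
move=> Ba e0.
have : retract (rV_unfloor m (rV_floor m a)) @[m --> \oo] --> retract a.
  by apply: cvg_retract; exact: rV_unfloor_cvg.
rewrite (retract_id Ba) => /cvgrPdist_lt/(_ _ e0) [m _ /(_ m (leqnn m)) /= h].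
by exists m, (rV_floor m a); rewrite distrC.
Qed.

Definition caratheodory n (psi : R -> 'rV[R]_n -> R) :=
  (forall z, measurable01 (psi ^~ z)) /\ (forall t, I01 t -> continuous (psi t)).

(* The least [i]-th coordinate of a zero of [psi t] is measurable in [t], as it
   is at most [r] iff near-zeros with coordinate nearly at most [r] can be found
   in a countable dense set, by compactness. *)
Lemma caratheodory_argmin n (psi : R -> 'rV[R]_n -> R) (i : 'I_n) :
  caratheodory psi -> (forall t z, 0 <= psi t z) ->
  (forall t, I01 t -> exists2 a, eball n 1 a & psi t a = 0) ->
  exists M : R -> R, measurable01 M /\ forall t, I01 t ->
    exists a, [/\ eball n 1 a, psi t a = 0 & a ord0 i = M t].
Proof.
move=> [mpsi cpsi] psi0 zpsi.
have ex_min t : exists a : 'rV[R]_n, I01 t -> [/\ eball n 1 a, psi t a = 0 &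
    forall b, eball n 1 b -> psi t b = 0 -> a ord0 i <= b ord0 i].
  have [It|] := pselect (I01 t); last by exists 0.
  pose Z : set 'rV[R]_n := eball n 1 `&` psi t @^-1` [set 0].
  have Z0 : Z !=set0 by have [a Ba za] := zpsi t It; exists a.
  have cZ : compact Z.
    apply: compact_closedI; first exact: eball_compact.
    by apply: closed_comp; [move=> z _; exact: cpsi|exact: closed_eq].
  have [|a /set_mem[Ba za] amin] := @EVT_min_rV R n (fun a => a ord0 i) Z Z0 cZ.
    by apply: continuous_subspaceT; exact: coord_continuous.
  by exists a => _; split => // b Bb zb; apply: amin; rewrite inE.
have [alpha alphaP] := choice ex_min.
exists (fun t => alpha t ord0 i); split; last first.
  by move=> t It; exists (alpha t); have [? ? _] := alphaP t It.
have mI : measurable (I01 : set (lebesgueR R)) by exact: measurable_itv_lebesgueR.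
move=> _; apply: (measurability _ (RGenOInfty.measurableE R)) => // _ [_ [r ->] <-].
pose C := (nat * 'rV[int]_n)%type.
pose d (c : C) := retract (rV_unfloor (R := R) c.1 c.2).
rewrite [X in measurable X](_ : _ = I01 `\` \bigcap_m \bigcup_c
   (if d c ord0 i < r + m.+1%:R^-1 then
    I01 `&` (psi ^~ (d c)) @^-1` `]-oo, m.+1%:R^-1[ else set0)).
  apply: measurableD => //; apply: bigcapT_measurable => m.
  apply: countable_bigcupT_measurable; first exact: countableP.
  by move=> c; case: ifPn => // _; apply: mpsi => //; exact: measurable_itv.
apply/seteqP; split => t [It]; rewrite /= in_itv/= andbT => h; split => //.
  move=> H.
  have /choice[c cP] : forall m, exists c : C, d c ord0 i <= r + m.+1%:R^-1 /\ psi t (d c) <= 0 + m.+1%:R^-1.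
    move=> m; have [c _] := H m I; case: ifPn => // dc [_]; rewrite /= in_itv/= => hp.
    by exists c; rewrite add0r !ltW.
  have [a Ba aP] := @compact_seq_le _ _ (fun m => d (c m)) (@eball_compact R n 1) (fun=> retract_eball _).
  have ar : a ord0 i <= r.
    by apply: (aP (fun z => z ord0 i)) => [|m]; [exact: coord_continuous|have [] := cP m].
  have pa : psi t a <= 0 by apply: (aP (psi t)) => [|m]; [exact: cpsi|have [] := cP m].
  have [_ _ /(_ a Ba)] := alphaP t It.
  have -> : psi t a = 0 by apply/eqP; rewrite eq_le pa psi0.
  by move=> /(_ erefl); rewrite leNgt (le_lt_trans ar).
rewrite ltNge; apply/negP => ra; apply: h => m _.
have [Ba za _] := alphaP t It.
have m0 : 0 < m.+1%:R^-1 :> R by rewrite invr_gt0.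
have c1 : \forall z \near alpha t, (z : 'rV[R]_n) ord0 i < r + m.+1%:R^-1.
  have /cvgrPdist_lt/(_ _ m0) := @coord_continuous _ _ _ ord0 i (alpha t).
  have key (x y e s : R) : `|x - y| < e -> x <= s -> y < s + e by rewrite ltr_norml; lra.
  by apply: filterS => z /key; apply.
have c2 : \forall z \near alpha t, psi t z < m.+1%:R^-1.
  have /cvgrPdist_lt/(_ _ m0) := cpsi t It (alpha t).
  by apply: filterS => z; rewrite za sub0r normrN ger0_norm.
have cc : nbhs (alpha t) (fun z : 'rV[R]_n => z ord0 i < r + m.+1%:R^-1 /\ psi t z < m.+1%:R^-1).
  exact: filterI c1 c2.
move/nbhs_ballP: cc => [e /= e0 he].
have [m' [q hq]] := ball_dense Ba e0.
exists (m', q) => //.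
have [|dr dp] := he (d (m', q)); first by rewrite -ball_normE /ball_/= distrC.
by rewrite dr; split => //; rewrite /= in_itv.
Qed.

(* Selects the lexicographically least zero: adding [`|a_i - M_i(t)|] to [psi]
   freezes one coordinate at a time. *)
Lemma measurable_selection n (psi : R -> 'rV[R]_n -> R) :
  caratheodory psi -> (forall t z, 0 <= psi t z) ->
  (forall t, I01 t -> exists2 a, eball n 1 a & psi t a = 0) ->
  exists alpha : R -> 'rV[R]_n, (forall i, measurable01 (fun t => alpha t ord0 i)) /\
    forall t, I01 t -> eball n 1 (alpha t) /\ psi t (alpha t) = 0.
Proof.
move=> cpsi psi0 zpsi.
(* Invariant: zeros of [psi'] are zeros of [psi] whose treated coordinates are those of [alpha].
   When all coordinates are treated, a zero of [psi'] coincides with [alpha t]. *)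
suff [psi' [alpha [_ zpsi' malpha H]]] : exists (psi' : R -> 'rV[R]_n -> R) (alpha : R -> 'rV[R]_n),
    [/\ caratheodory psi' /\ (forall t z, 0 <= psi' t z),
        (forall t, I01 t -> exists2 a, eball n 1 a & psi' t a = 0),
        (forall i, measurable01 (fun t => alpha t ord0 i)) &
        forall t a, I01 t -> psi' t a = 0 ->
          psi t a = 0 /\ forall i, i \in enum 'I_n -> a ord0 i = alpha t ord0 i].
  exists alpha; split => // t It; have [a Ba za] := zpsi' t It.
  have [pa aa] := H t a It za.
  suff -> : alpha t = a by [].
  by apply/rowP => i; rewrite aa// mem_enum.
elim: (enum 'I_n) => [|i s [psi' [alpha [[cpsi' psi'0] zpsi' malpha H]]]].
  exists psi, (fun=> 0); split => //.
  by move=> i; under eq_fun do rewrite mxE; exact: measurable_cst.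
have [M [mM MP]] := caratheodory_argmin i cpsi' psi'0 zpsi'.
exists (fun t a => psi' t a + `|a ord0 i - M t|).
exists (fun t => \row_j if j == i then M t else alpha t ord0 j); split.
- split; last by move=> t z; rewrite addr_ge0.
  split.
    move=> z; apply: measurable01D; first exact: cpsi'.1.
    by apply: measurable01_norm; apply: measurable01B => //; exact: measurable01_cst.
  move=> t It a; apply: (@continuousD _ _ _ (psi' t)); first exact: (cpsi'.2 t It a).
  apply: (@cvg_norm _ _ _ (nbhs a) _ (fun z : 'rV[R]_n => z ord0 i - M t)).
  by apply: cvgB; [exact: coord_continuous|exact: cvg_cst].
- move=> t It; have [a [Ba za ai]] := MP t It.
  by exists a => //; rewrite za ai subrr normr0 addr0.
- move=> j; under eq_fun do rewrite mxE.
  by case: (j == i); [exact: mM|exact: malpha].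
- move=> t a It /eqP; rewrite paddr_eq0// normr_eq0 subr_eq0 => /andP[/eqP pa /eqP ai].
  have [qa aP] := H t a It pa; split => // j; rewrite inE mxE.
  by case: eqP => [->|] //= _; exact: aP.
Qed.

End measurable_selection.

(** * Arcs *)

Section arcs.
Context {R : realType}.

Lemma abs_continuous01_coord n (x : R -> 'rV[R]_n) i : abs_continuous01 x ->
  ac01 (fun t => x t ord0 i).
Proof.
move=> acx e e0; have [d d0 dP] := acx e e0; exists d => // m a b ab tab sd.
apply: le_lt_trans (dP m a b ab tab sd); apply: ler_sum => j _.
by have := coord_le_enorm (x (b j) - x (a j)) i; rewrite !mxE.
Qed.

Lemma abs_continuous01_prim n (x : R -> 'rV[R]_n) (m : R -> R) : integrable01 m ->
  (forall s t, 0 <= s -> s <= t -> t <= 1 -> `|x t - x s| <= prim m t - prim m s) ->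
  abs_continuous01 x.
Proof.
move=> im xm e e0; have n0 : 0 < n.+1%:R :> R by rewrite ltr0n.
have [d d0 dP] := ac01_prim im (divr_gt0 e0 n0).
exists d => // p a b ab tab sd; have := dP p a b ab tab sd.
rewrite ltr_pdivlMr// mulr_suml; apply: le_lt_trans; apply: ler_sum => i _.
have [a0 [aibi b1]] := ab i; apply: le_trans (enorm_le_norm _) _.
rewrite mulrC ler_pM ?ler_nat//; apply: le_trans (xm _ _ a0 aibi b1) _.
exact: ler_norm.
Qed.

Lemma ac01_is_derive (F g : R -> R) : integrable01 g ->
  (forall t, 0 <= t <= 1 -> F t = F 0 + prim g t) ->
  ae01 (fun t => is_derive t (1 : R) F (g t)).
Proof.
move=> ig FE; apply: ae01_oo; apply: ae01S (prim_is_derive ig) => t _ dg t01.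
have nF : {near (t : R), (fun s => F 0 + prim g s) =1 F}.
  have : \forall s \near (t : R), 0 < s < 1.
    near=> s; apply/andP; split; near: s; [apply: lt_nbhsr|apply: lt_nbhsl]; by case/andP: t01.
  by apply: filterS => s /andP[s0 s1]; rewrite -FE// !ltW.
have dFg : is_derive (t : R) 1 (fun s => F 0 + prim g s) (g t).
  by rewrite -[g t]add0r; apply: is_deriveD.
apply: DeriveDef.
  by apply: near_eq_derivable nF _; apply: ex_derive.
rewrite -[RHS](@derive_val _ _ _ _ _ _ _ dFg).
by apply: near_eq_derive; apply: filterS nF => s ->.
Unshelve. all: by end_near. Qed.

Lemma ae01_forall (I : finType) (P : I -> R -> Prop) : (forall i, ae01 (P i)) ->
  ae01 (fun t => forall i, P i t).
Proof.
move=> aP.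
have := @filter_forall _ _ (fun i t => I01 t -> P i t) _ (ae_filter_ringOfSetsType (leb R)) aP.
apply: (@filterS _ _ (ae_filter_ringOfSetsType (leb R))) => t H tI i.
exact: H.
Qed.

Lemma ae01_countable (C : countType) (P : C -> R -> Prop) : (forall i, ae01 (P i)) ->
  ae01 (fun t => forall i, P i t).
Proof.
move=> aP; pose Q (n : nat) t := forall i, unpickle n = Some i -> P i t.
have aQ n : ae01 (Q n).
  rewrite /Q; case: (unpickle n) => [i|]; last by apply: ae01T.
  by apply: ae01S (aP i) => t _ Pt j [<-].
have : ae01 (fun t => forall n, Q n t).
  have : (leb R).-negligible (\bigcup_n ~` [set t : lebesgueR R | I01 t -> Q n t]).
    by apply: negligible_bigcup => n; exact: aQ.
  apply: negligibleS => t /= h; apply: contrapT => nb; apply: h => tI n.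
  by apply: contrapT => nQ; apply: nb; exists n => //= /(_ tI).
by apply: ae01S => t _ Qt i; apply: (Qt (pickle i)); rewrite pickleK.
Qed.

Lemma arc_derive1 n (x g : R -> 'rV[R]_n) :
  (forall i, integrable01 (fun t => g t ord0 i)) ->
  (forall t i, 0 <= t <= 1 -> x t ord0 i = x 0 ord0 i + prim (fun s => g s ord0 i) t) ->
  ae01 (fun t => derive1 x t = g t).
Proof.
move=> ig gE.
have : ae01 (fun t => forall i, is_derive t (1 : R) (fun t => x t ord0 i) (g t ord0 i)).
  by apply: ae01_forall => i; apply: ac01_is_derive => // t t01; exact: gE.
apply: ae01S => t _ dx; rewrite derive1E derive_mx; last first.
  apply/derivable_mxP => i j; rewrite (ord1 i).
  by have [] := dx j.
by apply/rowP => i; rewrite !mxE; have [] := dx i.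
Qed.

(** Supplies a measurable, integrable velocity [g] whose primitive is exactly the arc; every later
    estimate works with [g] and returns to [derive1 x] almost everywhere. *)
Lemma arc_ftc n (x : R -> 'rV[R]_n) : abs_continuous01 x ->
  exists g : R -> 'rV[R]_n, [/\ forall i, integrable01 (fun t => g t ord0 i),
    forall t i, 0 <= t <= 1 -> x t ord0 i = x 0 ord0 i + prim (fun s => g s ord0 i) t &
    ae01 (fun t => derive1 x t = g t)].
Proof.
move=> acx.
have /choice[g gP] : forall i, exists g : R -> R, integrable01 g /\
    forall t, 0 <= t <= 1 -> x t ord0 i = x 0 ord0 i + prim g t.
  by move=> i; have [g ig gE] := ac01_ftc (abs_continuous01_coord i acx); exists g.
exists (fun t => \row_i g i t).
have gE i : (fun t => (\row_i g i t) ord0 i) = g i by apply/funext => t; rewrite mxE.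
have ig i : integrable01 (fun t => (\row_i g i t) ord0 i) by rewrite gE; have [] := gP i.
have xE t i : 0 <= t <= 1 -> x t ord0 i = x 0 ord0 i + prim (fun t => (\row_i g i t) ord0 i) t.
  by rewrite gE; have [_] := gP i; exact.
by split => //; exact: arc_derive1.
Qed.

Lemma arc_measurable n (x : R -> 'rV[R]_n) i : abs_continuous01 x ->
  measurable01 (fun t => x t ord0 i).
Proof. by move=> acx; apply: ac01_measurable; exact: abs_continuous01_coord. Qed.

End arcs.

(** * Gronwall's inequality in both time directions *)

Section gronwall.
Context {R : realType}.

(* On an interval where the integral of [C] is at most [1/2], the sup of [u] is
   at most twice its value at either end; [K] is [2] to the number of such steps. *)
Lemma gronwall (C : R -> R) : integrable01 C -> (forall t, I01 t -> 0 <= C t) ->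
  exists2 K : R, 0 < K & forall u : R -> R, (forall t, 0 <= t <= 1 -> 0 <= u t) ->
    (exists B, forall t, 0 <= t <= 1 -> u t <= B) ->
    (forall s t U, 0 <= s -> s <= t -> t <= 1 -> (forall v, s <= v <= t -> u v <= U) ->
       `|u t - u s| <= U * (prim C t - prim C s)) ->
    forall s t, 0 <= s <= 1 -> 0 <= t <= 1 -> u t <= K * u s.
Proof.
move=> iC C0; have [d d0 dP] := prim_unif iC (divr_gt0 ltr01 (ltr0n R 2)).
pose N := Num.bound (2 / d).
exists (2 ^+ N) => [|u u0 [B uB] Hu]; first by rewrite exprn_gt0.
have doubling s t : 0 <= s -> s <= t -> t <= 1 -> t - s < d -> u t <= 2 * u s /\ u s <= 2 * u t.
  move=> s0 st t1 std.
  have small v w : s <= v -> v <= w -> w <= t -> 0 <= prim C w - prim C v <= 1 / 2.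
    move=> sv vw wt; rewrite subr_ge0 prim_nd//=; [|exact: ae01T|lra].
    by apply: le_trans (ler_norm _) _; apply/ltW/dP; lra.
  pose A := [set u v | v in [set v | s <= v <= t]].
  have supA : has_sup A.
    split; first by exists (u s), s => //; rewrite /= lexx.
    by exists B => _ [v /andP[sv vt] <-]; apply: uB; lra.
  have uU v : s <= v <= t -> u v <= sup A.
    by move=> vst; apply: ub_le_sup; [case: supA|exists v].
  have U0 : 0 <= sup A by apply: le_trans (uU s _); [apply: u0; lra|rewrite lexx].
  have bnd v w : s <= v -> v <= w -> w <= t -> `|u w - u v| <= sup A / 2.
    move=> sv vw wt; apply: le_trans (Hu v w (sup A) _ vw _ _) _; [lra|lra| |].
      by move=> z /andP[vz zw]; apply: uU; lra.
    by apply: ler_wpM2l => //; have /andP[_] := small v w sv vw wt; rewrite mul1r.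
  have Us : sup A <= 2 * u s.
    suff : sup A <= u s + sup A / 2 by lra.
    apply: sup_le_ub; first by case: supA.
    move=> _ [v /andP[sv vt] <-]; have := bnd s v (lexx s) sv vt.
    by rewrite ler_norml; lra.
  have Ut : sup A <= 2 * u t.
    suff : sup A <= u t + sup A / 2 by lra.
    apply: sup_le_ub; first by case: supA.
    move=> _ [v /andP[sv vt] <-]; have := bnd v t sv vt (lexx t).
    by rewrite ler_norml; lra.
  by split; [apply: le_trans (uU t _) Us|apply: le_trans (uU s _) Ut]; rewrite lexx ?st.
have step (k : nat) : forall s t, 0 <= s <= 1 -> 0 <= t <= 1 -> `|t - s| <= k%:R * (d / 2) ->
    u t <= 2 ^+ k * u s.
  elim: k => [|k IH] s t s01 t01.
    by rewrite mul0r normr_le0 subr_eq0 => /eqP ->; rewrite expr0 mul1r.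
  move=> h; have k0 : 0 < k.+1%:R :> R by rewrite ltr0n.
  (* First of [k.+1] equal steps from [s] to [t]. The point [t] may lie on either side of [s], since
     [doubling] bounds each end by the other. *)
  pose v := s + (t - s) / k.+1%:R.
  have vs : v - s = (t - s) / k.+1%:R by rewrite /v addrC addKr.
  have tv : t - v = (t - s) / k.+1%:R * k%:R.
    have E : (t - s) / k.+1%:R * k.+1%:R = t - s by rewrite divfK// gt_eqF.
    set q := (t - s) / k.+1%:R in vs E *.
    have : q * k.+1%:R = q * k%:R + q by rewrite -natr1 mulrDr mulr1.
    by lra.
  have nvs : `|v - s| <= d / 2.
    by rewrite vs normrM normfV (gtr0_norm k0) ler_pdivrMr// mulrC.
  have ntv : `|t - v| <= k%:R * (d / 2).
    by rewrite tv -vs normrM normr_nat mulrC ler_wpM2l.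
  have v01 : 0 <= v <= 1.
    have q1 : k.+1%:R^-1 <= 1 :> R by rewrite invf_le1// ler1n.
    have q0 : 0 <= k.+1%:R^-1 :> R by rewrite invr_ge0.
    have E : v = s * (1 - k.+1%:R^-1) + t * k.+1%:R^-1 by rewrite /v; ring.
    case/andP: s01 => s0 s1; case/andP: t01 => t0 t1; rewrite E; apply/andP; split.
      by rewrite addr_ge0// mulr_ge0// subr_ge0.
    apply: (@le_trans _ _ ((1 - k.+1%:R^-1) + k.+1%:R^-1)); last by rewrite subrK.
    by apply: lerD; apply: ler_piMl => //; rewrite subr_ge0.
  apply: le_trans (IH v t v01 t01 ntv) _.
  rewrite exprSr -mulrA ler_wpM2l// ?exprn_ge0//.
  have d2 : d / 2 < d by rewrite ltr_pdivrMr// ltr_pMr// ltr1n.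
  case/andP: s01 => s0 s1; case/andP: v01 => v0 v1.
  have [sv|vs'] := leP s v.
    have [] // := doubling s v s0 sv v1.
    by apply: le_lt_trans (le_trans (ler_norm _) nvs) d2.
  have [] // := doubling v s v0 (ltW vs') s1.
  by apply: le_lt_trans d2; apply: le_trans nvs; rewrite distrC ler_norm.
move=> s t s01 t01; apply: step => //.
apply: (@le_trans _ _ 1).
  by rewrite ler_norml; lra.
have h : 2 / d < N%:R by apply: archi_boundP; rewrite divr_ge0// ltW.
have E : 2 / d * (d / 2) = 1 by field; rewrite gt_eqF.
by rewrite -[leLHS]E ler_pM2r ?divr_gt0// ltW.
Qed.

(** At almost every [t], [k t] is the limit of difference quotients of a nondecreasing function.
    This turns an inequality between increments into an inequality almost everywhere. *)
Lemma prim_nondecreasing_ge0 (k : R -> R) : integrable01 k ->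
  (forall s t, 0 <= s -> s <= t -> t <= 1 -> prim k s <= prim k t) -> ae01 (fun t => 0 <= k t).
Proof.
move=> ik nd; apply: ae01_oo; apply: ae01S (prim_is_derive ik) => t _ dk /andP[t0 t1].
have [dk1 <-] := dk; rewrite /derive; apply: limr_ge => //.
have t01 : 0 < Num.min t (1 - t) by rewrite lt_min t0 subr_gt0 t1.
near=> h.
have hn0 : h != 0 by near: h; exact: nbhs_dnbhs_neq.
have : `|h| < Num.min t (1 - t).
  by near: h; apply: dnbhs0_lt.
rewrite lt_min ltr_norml => /andP[/andP[h1 h2]]; rewrite ltr_norml => /andP[h3 h4].
rewrite /= /GRing.scale/= mulr1.
have [h0|h0] := ltP 0 h.
  by rewrite mulr_ge0 ?invr_ge0 ?(ltW h0)// subr_ge0; apply: nd; lra.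
rewrite mulr_le0// ?invr_le0// subr_le0; apply: nd; lra.
Unshelve. all: by end_near.
Qed.
End gronwall.

(** * Increment bounds for arcs and their uniform limits *)

Section arc_estimates.
Context {R : realType}.

Lemma ler_eps (C a b : R) : 0 <= C -> (forall e, 0 < e -> a <= b + e * C) -> a <= b.
Proof.
move=> C0 h; apply/ler_addgt0Pr => e e0.
have C1 : 0 < C + 1 by rewrite ltr_wpDl.
apply: le_trans (h (e / (C + 1)) _) _; first exact: divr_gt0.
by rewrite lerD2l mulrAC ler_pdivrMr// ler_wpM2l ?(ltW e0)// lerDl.
Qed.

Lemma dotv_le_norm n (u p : 'rV[R]_n) : `|dotv u p| <= `|u| * \sum_(i < n) `|p ord0 i|.
Proof.
rewrite /dotv mulr_sumr; apply: le_trans (ler_norm_sum _ _ _) _.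
by apply: ler_sum => i _; rewrite normrM ler_wpM2r// coord_le_norm.
Qed.

Lemma norm_arc_le n (x g : R -> 'rV[R]_n) (m : R -> R) s t : (0 < n)%N ->
  (forall i, integrable01 (fun t => g t ord0 i)) -> integrable01 m ->
  (forall t i, 0 <= t <= 1 -> x t ord0 i = x 0 ord0 i + prim (fun s => g s ord0 i) t) ->
  ae01 (fun u => s < u < t -> forall i, `|g u ord0 i| <= m u) ->
  0 <= s -> s <= t -> t <= 1 -> `|x t - x s| <= prim m t - prim m s.
Proof.
move=> n0 ig im xE gm s0 st t1.
have s1 := le_trans st t1; have t0 := le_trans s0 st.
have pos i : `|(x t - x s) ord0 i| <= prim m t - prim m s.
  rewrite !mxE (xE t) ?(xE s) ?t0 ?s0//.
  rewrite opprD addrACA subrr add0r; apply: prim_norm_le_local => //.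
  by apply: ae01S gm => u _ h su; exact: h.
(* Some coordinate exists because [n] is positive, and its bound shows that the right-hand side is
   nonnegative. *)
apply: mx_norm_leP => //; apply: le_trans (pos (Ordinal n0)); exact: normr_ge0.
Qed.

Lemma arc_dotv n (x g : R -> 'rV[R]_n) (p : 'rV[R]_n) t :
  (forall i, integrable01 (fun t => g t ord0 i)) ->
  (forall t i, 0 <= t <= 1 -> x t ord0 i = x 0 ord0 i + prim (fun s => g s ord0 i) t) ->
  0 <= t <= 1 ->
  integrable01 (fun s => dotv (g s) p) /\ prim (fun s => dotv (g s) p) t = dotv (x t) p - dotv (x 0) p.
Proof.
move=> ig xE /[dup] t01 /andP[t0 t1].
have igp i : integrable01 (fun s => g s ord0 i * p ord0 i).
  by under eq_fun do rewrite mulrC; exact: integrable01Z.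
have [h1 h2] := prim_sum (index_enum 'I_n) igp t1; split => //.
rewrite [LHS]h2 -dotvB; apply: eq_bigr => i _; rewrite !mxE xE// addrAC subrr add0r.
by under eq_fun do rewrite mulrC; rewrite primZ// mulrC.
Qed.

(** A common integrable [m] gives equicontinuity by absolute continuity of [prim m]. The increment
    bound also passes to the limit, which makes the limit absolutely continuous. *)
Lemma arzela_prim (V : normedModType R) (K : set V) (x : nat -> R -> V) (m : R -> R) :
  compact K -> integrable01 m ->
  (forall j t, 0 <= t <= 1 -> K (x j t)) ->
  (forall j s t, 0 <= s -> s <= t -> t <= 1 -> `|x j t - x j s| <= prim m t - prim m s) ->
  exists (sigma : nat -> nat) (y : R -> V), [/\ forall j, (j <= sigma j)%N,
    forall t, 0 <= t <= 1 -> K (y t),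
    forall e, 0 < e -> exists N, forall j, (N <= j)%N -> forall t, 0 <= t <= 1 ->
      `|x (sigma j) t - y t| < e &
    forall s t, 0 <= s -> s <= t -> t <= 1 -> `|y t - y s| <= prim m t - prim m s].
Proof.
move=> cK im xK xm; have [e e0|sigma [y [sm yK yP]]] := arzela_ascoli cK xK.
  have [d d0 dP] := prim_unif im e0; exists d => // j s t /andP[s0 s1] /andP[t0 t1].
  have [st|ts] := leP s t => std.
    rewrite distrC; apply: le_lt_trans (xm _ _ _ s0 st t1) _.
    apply: le_lt_trans (ler_norm _) (dP _ _ s0 st t1 _).
    by apply: le_lt_trans std; rewrite distrC ler_norm.
  apply: le_lt_trans (xm _ _ _ t0 (ltW ts) s1) _.
  apply: le_lt_trans (ler_norm _) (dP _ _ t0 (ltW ts) s1 _).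
  by apply: le_lt_trans std; rewrite ler_norm.
exists sigma, y; split => // s t s0 st t1.
apply: (@ler_eps 2) => // e e0; have [N NP] := yP e e0.
have h1 := NP N (leqnn N) t _; have h2 := NP N (leqnn N) s _.
have h3 := xm (sigma N) s t s0 st t1.
have h4 := ler_distD (x (sigma N) t) (y t) (y s).
have h5 := ler_distD (x (sigma N) s) (x (sigma N) t) (y s).
have := h1 _; rewrite distrC => {}h1.
have {}h1 : `|y t - x (sigma N) t| < e by apply: h1; lra.
have {}h2 : `|x (sigma N) s - y s| < e by apply: h2; lra.
lra.
Qed.

End arc_estimates.

(** * A Caratheodory differential equation *)

Section caratheodory_ode.
Context {R : realType}.

Lemma prim_ge0 (k : R -> R) t : integrable01 k -> (forall s, I01 s -> 0 <= k s) ->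
  0 <= t <= 1 -> 0 <= prim k t.
Proof.
move=> ik k0 /andP[t0 t1]; rewrite -(prim0 ik); apply: prim_nd => //; exact: ae01T.
Qed.

Lemma expR_ge1 (x : R) : 0 <= x -> 1 <= expR x.
Proof. by move=> x0; rewrite -[leLHS]expR0 ler_expR. Qed.

Lemma expR_lip (a b B : R) : a <= b -> b <= B -> expR b - expR a <= expR B * (b - a).
Proof.
move=> ab bB; have -> : expR a = expR b * expR (a - b) by rewrite -expRD addrC subrK.
rewrite -[X in X - _]mulr1 -mulrBr; have h := expR_ge1Dx (a - b).
have h1 : expR b * (1 - expR (a - b)) <= expR b * (b - a).
  by rewrite ler_pM2l ?expR_gt0//; lra.
by apply: le_trans h1 _; rewrite ler_wpM2r ?subr_ge0// ler_expR.
Qed.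

(** The exponential is Lipschitz on the range of [prim C], so the composite is absolutely
    continuous. It is thus the primitive of its derivative, which the chain rule gives almost
    everywhere. *)
Lemma prim_expR (C : R -> R) : integrable01 C -> (forall t, I01 t -> 0 <= C t) ->
  integrable01 (fun t => C t * expR (prim C t)) /\
  forall t, 0 <= t <= 1 -> prim (fun t => C t * expR (prim C t)) t = expR (prim C t) - 1.
Proof.
move=> iC C0; pose F t := expR (prim C t).
have nd s t : s <= t -> t <= 1 -> prim C s <= prim C t.
  by move=> st t1; apply: prim_nd => //; exact: ae01T.
have acF : ac01 F.
  apply: (ac01_le (G := prim (fun t => expR (prim C 1) * C t))); last first.
    by apply: ac01_prim; exact: integrable01Z.
  move=> s t s0 st t1; rewrite !primZ ?(le_trans st)// -mulrBr.
  rewrite normrM (gtr0_norm (expR_gt0 _)) !ger0_norm ?subr_ge0 ?ler_expR ?nd//.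
  by apply: expR_lip; exact: nd.
have [g ig Fg] := ac01_ftc acF.
have gE : ae01 (fun t => g t = C t * F t).
  apply: ae01S2 (ac01_is_derive ig Fg) (prim_is_derive iC) => t _ dF dC.
  have dF' : is_derive t (1 : R) F (C t * F t).
    by rewrite mulrC; exact: (is_derive1_comp (is_derive_expR _) dC).
  by rewrite -(@derive_val _ _ _ _ _ _ _ dF) -(@derive_val _ _ _ _ _ _ _ dF').
have mCF : measurable01 (fun t => C t * F t).
  by apply: measurable01M; [exact: integrable01_measurable|exact: ac01_measurable].
have iCF : integrable01 (fun t => C t * F t).
  apply: (integrable01_dom mCF (integrable01_norm ig)).
  by apply: ae01S gE => t _ ->.
split => // t /andP[t0 t1]; rewrite -/(F _).
have -> : prim (fun t => C t * F t) t = prim g t.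
  apply: prim_ae => //; first exact: integrable01_measurable.
  by apply: ae01S gE => s _ ->.
by rewrite -/(F t) (Fg t) ?t0// /F prim0// expR0 addrC addKr.
Qed.

Context (n : nat) (n_gt0 : (0 < n)%N) (F : R -> 'rV[R]_n -> 'rV[R]_n) (C : R -> R)
  (K : R -> R -> R)
  (mF : forall x : R -> 'rV[R]_n, (forall i, measurable01 (fun t => x t ord0 i)) ->
     forall i, measurable01 (fun t => F t (x t) ord0 i))
  (iC : integrable01 C) (C0 : forall t, I01 t -> 0 <= C t)
  (FC : forall (t : R) x, I01 t -> `|F t x| <= C t * (1 + `|x|))
  (iK : forall r : R, 0 < r -> integrable01 (K r))
  (K0 : forall r t : R, 0 < r -> I01 t -> 0 <= K r t)
  (FK : forall (r t : R) x y, 0 < r -> I01 t -> `|x| <= r -> `|y| <= r ->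
     `|F t x - F t y| <= K r t * `|x - y|).

Let picard k := iter k
  (fun (x : R -> 'rV[R]_n) t => \row_i prim (fun s => F s (x s) ord0 i) t) (fun=> 0).

(** Solution of [E' = C E] with [E 0 = 1]: the comparison function that bounds [1 + |x|] along every
    iterate. *)
Let E t := expR (prim C t).

Let E1 t : 0 <= t <= 1 -> E t <= E 1.
Proof. by move=> /andP[t0 t1]; rewrite ler_expR prim_nd//; exact: ae01T. Qed.

Let I01P (t : R) : I01 t -> 0 <= t <= 1. Proof. by rewrite /I01/= in_itv. Qed.

(** The bound [1 + |x| <= E] gives [|F t x| <= C E], whose primitive is [E - 1]; hence the next
    iterate obeys the same bound. *)
Let picard_arc (x : R -> 'rV[R]_n) (y := fun t => \row_i prim (fun s => F s (x s) ord0 i) t) :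
  (forall i, measurable01 (fun t => x t ord0 i)) ->
  (forall t, 0 <= t <= 1 -> 1 + `|x t| <= E t) ->
  [/\ forall i, integrable01 (fun t => F t (x t) ord0 i),
      forall t i, 0 <= t <= 1 -> y t ord0 i = y 0 ord0 i + prim (fun s => F s (x s) ord0 i) t,
      y 0 = 0 &
      forall s t, 0 <= s -> s <= t -> t <= 1 ->
        `|y t - y s| <= prim (fun t => C t * E t) t - prim (fun t => C t * E t) s].
Proof.
move=> mx xE; have [iCE _] := prim_expR iC C0.
have bnd t i : I01 t -> `|F t (x t) ord0 i| <= C t * E t.
  move=> tI; apply: le_trans (coord_le_norm _ _) _; apply: le_trans (FC _ tI) _.
  by apply: ler_wpM2l; [exact: C0|apply: xE; exact: I01P].
have iF i : integrable01 (fun t => F t (x t) ord0 i).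
  by apply: (integrable01_dom (mF mx i) iCE); apply: ae01T => t tI; exact: bnd.
have y0 : y 0 = 0 by apply/rowP => i; rewrite !mxE prim0.
have yE t i : 0 <= t <= 1 -> y t ord0 i = y 0 ord0 i + prim (fun s => F s (x s) ord0 i) t.
  by move=> t01; rewrite y0 !mxE add0r.
split => // s t s0 st t1; apply: (norm_arc_le n_gt0 iF) => //.
by apply: ae01T => u uI _ i; exact: bnd.
Qed.

Let picardP k : (forall i, measurable01 (fun t => picard k t ord0 i)) /\
  (forall t, 0 <= t <= 1 -> 1 + `|picard k t| <= E t).
Proof.
elim: k => [|k [mx xE]].
  split=> [i|t /andP[t0 t1]]; first by under eq_fun do rewrite /= mxE; exact: measurable01_cst.
  by rewrite /= normr0 addr0; apply: expR_ge1; apply: prim_ge0; rewrite ?t0.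
have [iF yE y0 yn] := picard_arc mx xE.
split=> [i|t /andP[t0 t1]].
  by under eq_fun do rewrite /= mxE; apply: ac01_measurable; exact: ac01_prim.
have [iCE pE] := prim_expR iC C0.
have := yn 0 t (lexx 0) t0 t1.
rewrite y0 subr0 (prim0 iCE) subr0 pE ?t0// -/(E t) => h.
by rewrite -lerBrDl.
Qed.

(** One radius for all iterates, so that a single Lipschitz function [K r] is used throughout. *)
Let r := E 1.
Let r0 : 0 < r := expR_gt0 _.

Let picard_r k t : 0 <= t <= 1 -> `|picard k t| <= r.
Proof.
move=> t01; apply: le_trans (E1 t01); apply: le_trans ((picardP k).2 t t01).
by rewrite lerDr.
Qed.

(* The weight [expR (prim (2 K_r))] turns the Picard map into a contraction of
   factor [1/2]. *)
Let picard_step k t : 0 <= t <= 1 ->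
  `|picard k.+1 t - picard k t| <= (1 / 2) ^+ k * r * expR (prim (fun s => 2 * K r s) t).
Proof.
have iK2 : integrable01 (fun s => 2 * K r s) by apply: integrable01Z; exact: iK.
have K20 (s : R) : I01 s -> 0 <= 2 * K r s by move=> sI; rewrite mulr_ge0// K0.
have [iKE pE] := prim_expR iK2 K20.
elim: k t => [|k IH] t /[dup] t01 /andP[t0 t1].
  rewrite /= subr0 expr0 mul1r.
  apply: (@le_trans _ _ (r * 1)); first by rewrite mulr1; exact: (picard_r 1).
  by rewrite (ler_pM2l r0); apply: expR_ge1; exact: prim_ge0.
have [iF xE x0 _] := picard_arc (picardP k).1 (picardP k).2.
have [iF' xE' x0' _] := picard_arc (picardP k.+1).1 (picardP k.+1).2.
have iH : integrable01 (fun s => ((1 / 2) ^+ k.+1 * r) * (2 * K r s * expR (prim (fun s => 2 * K r s) s))).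
  exact: integrable01Z.
have h := @norm_arc_le _ _ (fun t => picard k.+2 t - picard k.+1 t)
  (fun t => F t (picard k.+1 t) - F t (picard k t)) _ 0 t n_gt0 _ iH.
have := h _ _ _ (lexx 0) t0 t1.
rewrite /= x0 x0' !subr0 !(primZ _ iKE) ?ler01// (prim0 iKE) mulr0 subr0 pE// => {}h.
apply: (@le_trans _ _ ((1 / 2) ^+ k.+1 * r * (expR (prim (fun s : R => 2 * K r s) t) - 1))); last first.
  by rewrite ler_wpM2l ?lerBlDr ?lerDl// mulr_ge0// ?exprn_ge0// ltW.
apply: h => [i|u i u01|].
- by under eq_fun do rewrite !mxE; exact: integrable01B.
- have -> : (fun s => (F s (picard k.+1 s) - F s (picard k s)) ord0 i) =
      (fun s => F s (picard k.+1 s) ord0 i - F s (picard k s) ord0 i).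
    by apply/funext => s; rewrite !mxE.
  have u1 : u <= 1 by case/andP: u01.
  by rewrite primB// !mxE add0r.
apply: ae01T => u uI _ i; apply: le_trans (coord_le_norm _ _) _.
have u01 := I01P uI.
apply: le_trans (FK r0 uI (picard_r k.+1 u01) (picard_r k u01)) _.
have -> : (1 / 2) ^+ k.+1 * r * (2 * K r u * expR (prim (fun s => 2 * K r s) u)) =
  K r u * ((1 / 2) ^+ k * r * expR (prim (fun s => 2 * K r s) u)).
  by rewrite exprS; field.
by rewrite ler_wpM2l ?K0//; exact: IH.
Qed.

(** The contraction is used only to show that consecutive iterates merge uniformly. The
    Arzela-Ascoli limit of the iterates of index [(sg m).+1] is then also the limit of those of
    index [sg m], and the integral equation passes to the limit. *)
Lemma caratheodory_ode : exists x : R -> 'rV[R]_n,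
  abs_continuous01 x /\ ae01 (fun t => derive1 x t = F t (x t)).
Proof.
have [iCE _] := prim_expR iC C0.
have [|j t t01|j s t s0 st t1|sg [x [sgj xr xcv xm]]] :=
  @arzela_prim R _ (eball n (n%:R * r)) (fun k => picard k.+1) _ _ iCE.
- exact: eball_compact.
- apply: le_trans (enorm_le_norm _) _; rewrite ler_wpM2l//; exact: picard_r.
- by have [_ _ _] := picard_arc (picardP j).1 (picardP j).2; exact.
have acx := abs_continuous01_prim iCE xm.
have mx i : measurable01 (fun t => x t ord0 i) by exact: arc_measurable.
have xr' t : 0 <= t <= 1 -> `|x t| <= r.
  move=> t01; apply: (@ler_eps _ 1) => // e e0; have [N NP] := xcv e e0.
  have := NP N (leqnn N) t t01; have := picard_r (sg N).+1 t01.
  have := ler_distD (picard (sg N).+1 t) (x t) 0; rewrite !subr0 distrC; lra.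
have iF i : integrable01 (fun t => F t (x t) ord0 i).
  have iD : integrable01 (fun t => (1 + r) * C t) by exact: integrable01Z.
  apply: (integrable01_dom (mF mx i) iD); apply: ae01T => t tI.
  apply: le_trans (coord_le_norm _ _) _; apply: le_trans (FC _ tI) _.
  by rewrite mulrC ler_wpM2r ?C0// lerD2l; exact/xr'/I01P.
have pK0 t : 0 <= t <= 1 -> 0 <= prim (K r) t.
  by apply: prim_ge0 => [|u uI]; [exact: iK|exact: K0].
exists x; split => //; apply: (arc_derive1 iF) => t i /[dup] t01 /andP[t0 t1].
suff xE s j : 0 <= s <= 1 -> x s ord0 j = prim (fun s => F s (x s) ord0 j) s.
  by rewrite xE// (xE 0) ?lexx ?ler01// prim0// add0r.
move=> /[dup] s01 /andP[s0 s1].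
apply/eqP; rewrite -subr_eq0 -normr_eq0 eq_le normr_ge0 andbT.
have cv : ((1 / 2) ^+ k * r * expR (prim (fun s => 2 * K r s) 1)) @[k --> \oo] --> (0 : R).
  have -> : 0 = 0 * r * expR (prim (fun s => 2 * K r s) 1) by rewrite !mul0r.
  apply: cvgMl; apply: cvgMl; apply: cvg_expr; rewrite ger0_norm//; lra.
(* [e] is the distance from [picard k.+1] to [x]. The distance from [picard k] to [x] is at most
   [2 * e], and [K r] transmits it to the integrals of [F]. *)
apply: (@ler_eps _ (1 + 2 * prim (K r) s)) => [|e e0].
  by rewrite addr_ge0// mulr_ge0// pK0.
have [N1 N1P] := xcv e e0.
have [N2 _ N2P] := (cvgrPdist_lt _ _).1 cv e e0.
pose k := sg (maxn N1 N2).
have h1 u : 0 <= u <= 1 -> `|picard k.+1 u - x u| < e.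
  by apply: N1P; exact: leq_maxl.
have h2 u : 0 <= u <= 1 -> `|picard k.+1 u - picard k u| < e.
  move=> u01; apply: le_lt_trans (picard_step k u01) _.
  have : (N2 <= k)%N by apply: leq_trans (sgj _); exact: leq_maxr.
  move=> /N2P /=; rewrite sub0r normrN; apply: le_lt_trans.
  apply: le_trans (ler_norm _); apply: ler_wpM2l.
    by rewrite mulr_ge0 ?exprn_ge0// ltW.
  rewrite ler_expR; case/andP: u01 => u0 u1.
  have iK2 : integrable01 (fun s => 2 * K r s) by apply: integrable01Z; exact: iK.
  by apply: prim_nd => //; apply: ae01T => v vI; rewrite mulr_ge0// K0.
have h3 u : 0 <= u <= 1 -> `|picard k u - x u| <= 2 * e.
  move=> u01; have := h1 u u01; have := h2 u u01.
  have := ler_distD (picard k.+1 u) (picard k u) (x u); rewrite (distrC (picard k u) (picard k.+1 u)); lra.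
have [iFk _ _ _] := picard_arc (picardP k).1 (picardP k).2.
have : `|prim (fun u => F u (picard k u) ord0 j - F u (x u) ord0 j) s -
   prim (fun u => F u (picard k u) ord0 j - F u (x u) ord0 j) 0| <=
   prim (fun u => (2 * e) * K r u) s - prim (fun u => (2 * e) * K r u) 0.
  apply: prim_norm_le => //; first exact: integrable01B.
    by apply: integrable01Z; exact: iK.
  apply: ae01T => u uI; have u01 := I01P uI.
  have -> : F u (picard k u) ord0 j - F u (x u) ord0 j = (F u (picard k u) - F u (x u)) ord0 j.
    by rewrite !mxE.
  apply: le_trans (coord_le_norm _ _) _.
  apply: le_trans (FK r0 uI (picard_r k u01) (xr' u u01)) _.
  by rewrite mulrC ler_wpM2r ?K0// h3.
have iKr := iK r0.
rewrite !(primZ _ iKr)// !primB// !prim0// mulr0 !subr0.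
have cn : `|picard k.+1 s ord0 j - x s ord0 j| <= `|picard k.+1 s - x s|.
  by have := coord_le_norm (picard k.+1 s - x s) j; rewrite !mxE.
have pk : picard k.+1 s ord0 j = prim (fun u => F u (picard k u) ord0 j) s by rewrite !mxE.
have := le_lt_trans cn (h1 s s01); rewrite pk.
rewrite !ler_norml ltr_norml; lra.
Qed.

End caratheodory_ode.

(** * The two problems *)

Section lagrangian_problem.
Context (R : realType) (n : nat)
    (H : R -> 'rV[R]_n -> 'rV[R]_n -> R)
    (c : R -> R) (k : R -> R -> R) (lam : R -> 'rV[R]_n -> R)
    (H_meas : forall x p, measurable01 (fun t => H t x p))
    (H_cont : forall (t : R), I01 t ->
       continuous (fun z : 'rV[R]_n * 'rV[R]_n => H t z.1 z.2))
    (c_ge0 : forall (t : R), I01 t -> 0 <= c t)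
    (c_int : integrable01 c)
    (H_lip_p : forall (t : R) x p q, I01 t ->
       `|H t x p - H t x q| <= c t * (1 + enorm x) * enorm (p - q))
    (k_ge0 : forall (r t : R), 0 < r -> I01 t -> 0 <= k r t)
    (k_int : forall r : R, 0 < r -> integrable01 (k r))
    (H_lip_x : forall (r t : R) x y p, 0 < r -> I01 t -> eball n r x -> eball n r y ->
       `|H t x p - H t y p| <= k r t * (1 + enorm p) * enorm (x - y))
    (L_le_lam : forall (t : R) x v, I01 t -> edom (lagrangian H t x) v ->
       (lagrangian H t x v <= (lam t x)%:E)%E)
    (lam_lip : forall (r t : R) x y, 0 < r -> I01 t -> eball n r x -> eball n r y ->
       `|lam t x - lam t y| <= k r t * enorm (x - y))
    (H00_int : integrable01 (fun t => H t 0 0))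
    (lam0_int : integrable01 (fun t => lam t 0))
    (f : R -> 'rV[R]_n -> 'rV[R]_n.+1 -> 'rV[R]_n)
    (l : R -> 'rV[R]_n -> 'rV[R]_n.+1 -> R)
    (fl_repr : faithful_representation H c k lam f l).

Let mI : measurable (I01 : set (lebesgueR R)) := measurable_itv_lebesgueR _.

(** * Bounds and measurability of the Lagrangian *)

Lemma lagrangian_ge t x v p : ((dotv v p - H t x p)%:E <= lagrangian H t x v)%E.
Proof. by apply: ereal_sup_ubound; exists p. Qed.

(** A finite value puts [v] in the image [f t x] of the unit ball, where (A2) applies. *)
Lemma lagrangian_speed t x v : I01 t -> edom (lagrangian H t x) v ->
  enorm v <= c t * (1 + enorm x).
Proof.
move=> tI; rewrite -(repr_dom fl_repr x tI) => -[a Ba <-].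
exact: (repr_A2 fl_repr).
Qed.

(* Dominates the running cost of finite-cost arcs staying in the ball of radius [r]. *)
Definition mass (r t : R) : R := `|H t 0 0| + `|lam t 0| + k r t * r.

Lemma mass_integrable r : 0 < r -> integrable01 (mass r).
Proof.
move=> r0; apply: integrable01D.
  by apply: integrable01D; exact: integrable01_norm.
rewrite (_ : (fun t => _) = (fun t => r * k r t)); last by apply/funext => t; rewrite mulrC.
by apply: integrable01Z; exact: k_int.
Qed.

Lemma eball0 r : 0 < r -> eball n r (0 : 'rV[R]_n).
Proof. by move=> r0; rewrite /eball/= enorm0 ltW. Qed.

(** Take [p = 0] in the supremum. Contrary to the upper bound by [lam], this holds for every
    velocity, including those of infinite cost. *)
Lemma lagrangian_lower r t x v : 0 < r -> I01 t -> eball n r x ->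
  ((- mass r t)%:E <= lagrangian H t x v)%E.
Proof.
move=> r0 tI xr; apply: le_trans (lagrangian_ge t x v 0); rewrite lee_fin.
have -> : dotv v 0 = 0 by rewrite /dotv big1// => i _; rewrite mxE mulr0.
have := H_lip_x 0 r0 tI xr (eball0 r0).
rewrite enorm0 addr0 mulr1 subr0 => h.
have h2 : k r t * enorm x <= k r t * r by apply: ler_wpM2l => //; exact: k_ge0.
have := ler_norm (H t x 0 - H t 0 0); have := ler_norm (H t 0 0).
have := normr_ge0 (lam t 0); rewrite /mass; lra.
Qed.

Lemma lagrangian_bound r t x v : 0 < r -> I01 t -> eball n r x ->
  edom (lagrangian H t x) v -> `|fine (lagrangian H t x v)| <= mass r t.
Proof.
move=> r0 tI xr vd; have fv : lagrangian H t x v \is a fin_num by [].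
rewrite ler_norml -!lee_fin fineK// lagrangian_lower//=.
apply: le_trans (L_le_lam tI vd) _; rewrite lee_fin.
have h := lam_lip r0 tI xr (eball0 r0); rewrite subr0 in h.
have h2 : k r t * enorm x <= k r t * r by apply: ler_wpM2l => //; exact: k_ge0.
have := ler_norm (lam t x - lam t 0); have := ler_norm (lam t 0).
have := normr_ge0 (H t 0 0); rewrite /mass; lra.
Qed.

Lemma H_comp_measurable (u : R -> 'rV[R]_n) p :
  (forall i, measurable01 (fun t => u t ord0 i)) -> measurable01 (fun t => H t (u t) p).
Proof.
move=> mu; apply: (measurable01_caratheodory (g := fun t z => H t z p)) => // t tI.
exact: (@cvg_for2 _ _ _ _ (nbhs (u t)) _ (H t) id (fun=> p) _ _ (@H_cont t tI (u t, p))
  (@cvg_id _ _) (cvg_cst _)).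
Qed.

(** By continuity in [p] the supremum may be taken over a countable dense set. This yields
    measurability along arcs, and exchanges [for each p, almost every t] with
    [almost every t, all p]. *)
Lemma lagrangian_gt_dense t x v (r : R) : I01 t -> (r%:E < lagrangian H t x v)%E <->
  exists q : nat * 'rV[int]_n, r < dotv v (rV_unfloor q.1 q.2) - H t x (rV_unfloor q.1 q.2).
Proof.
move=> tI; split; last first.
  by move=> [q rq]; apply: lt_le_trans (lagrangian_ge t x v (rV_unfloor q.1 q.2)); rewrite lte_fin.
move=> /ereal_sup_gt[_ [p _ <-]]; rewrite lte_fin => rp.
have cv : (dotv v (rV_unfloor m (rV_floor m p)) - H t x (rV_unfloor m (rV_floor m p))
    @[m --> \oo] --> dotv v p - H t x p).
  apply: cvgB.
    by apply: cvg_dotv; [exact: cvg_cst|exact: rV_unfloor_cvg].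
  apply: (cvg_for2 (@H_cont t tI (x, p))); first exact: cvg_cst.
  exact: rV_unfloor_cvg.
have [m _ /(_ m (leqnn m)) /= h] := cvgr_gt _ cv _ rp.
by exists (m, rV_floor m p).
Qed.

Lemma measurable01_dotv (u : R -> 'rV[R]_n) p :
  (forall i, measurable01 (fun t => u t ord0 i)) -> measurable01 (fun t => dotv (u t) p).
Proof.
move=> mu; apply: measurable01_sum => i; apply: measurable01M => //.
exact: measurable01_cst.
Qed.

Lemma lagrangian_measurable (u v : R -> 'rV[R]_n) :
  (forall i, measurable01 (fun t => u t ord0 i)) ->
  (forall i, measurable01 (fun t => v t ord0 i)) ->
  measurable_fun I01 (fun t : lebesgueR R => lagrangian H t (u t) (v t)).
Proof.
move=> mu mv _; apply: (measurability _ (ErealGenOInfty.measurableE R)) => // _ [_ [r ->] <-].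
pose P (q : nat * 'rV[int]_n) : 'rV[R]_n := rV_unfloor q.1 q.2.
rewrite [X in measurable X](_ : _ = \bigcup_q
   (I01 `&` (fun t => dotv (v t) (P q) - H t (u t) (P q)) @^-1` `]r, +oo[)).
  apply: countable_bigcupT_measurable; first exact: countableP.
  move=> q.
  have mq : measurable01 (fun t => dotv (v t) (P q) - H t (u t) (P q)).
    by apply: measurable01B; [exact: measurable01_dotv|exact: H_comp_measurable].
  exact: mq mI _ (measurable_itv _).
apply/seteqP; split => t.
  move=> [tI]; rewrite /= in_itv/= andbT => /(lagrangian_gt_dense _ _ _ tI)[q rq].
  by exists q => //; split => //=; rewrite in_itv/= rq.
move=> [q _ [tI]]; rewrite /= in_itv/= andbT => rq; split => //=.
by rewrite in_itv/= andbT; apply/(lagrangian_gt_dense _ _ _ tI); exists q.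
Qed.

(** * Passage between controls and arcs *)

Lemma lagrangian_le_cost t x a : I01 t -> eball n.+1 1 a ->
  (lagrangian H t x (f t x a) <= (l t x a)%:E)%E.
Proof.
move=> tI Ba; apply: ge_ereal_sup => _ [p _ <-].
have : ((dotv p (f t x a) - l t x a)%:E <= (H t x p)%:E)%E.
  by rewrite (repr_sup fl_repr x p tI); apply: ereal_sup_ubound; exists a.
by rewrite !lee_fin dotvC; lra.
Qed.

Lemma within_retract (F : 'rV[R]_n * 'rV[R]_n.+1 -> R) :
  {within [set: 'rV[R]_n] `*` eball n.+1 1, continuous F} ->
  continuous (fun z : 'rV[R]_n * 'rV[R]_n.+1 => F (z.1, retract z.2)).
Proof.
move=> /subspace_continuousP cF [z w].
apply: cvg_trans (cF (z, retract w) _); last by split => //; exact: retract_eball.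
move=> B /=; rewrite /within/= => nB.
have cr : ((fun z : 'rV[R]_n * 'rV[R]_n.+1 => (z.1, retract z.2)) @ nbhs (z, w) --> (z, retract w)).
  have h1 : (fst @ nbhs (z, w) --> z) by exact: cvg_fst.
  have h2 : (retract v.2 @[v --> nbhs (z, w)] --> retract w).
    by apply: cvg_retract; exact: cvg_snd.
  exact: (cvg_pair h1 h2).
have {}nB : nbhs (z, retract w) (fun x => ([set: 'rV[R]_n] `*` eball n.+1 1) x -> B (F x)).
  exact: nB.
have := cr _ nB; rewrite /nbhs/=; apply: filterS => y; apply.
by split => //; exact: retract_eball.
Qed.

Let f_retract_continuous t i : I01 t ->
  continuous (fun z : 'rV[R]_n * 'rV[R]_n.+1 => f t z.1 (retract z.2) ord0 i).
Proof.
move=> tI; apply: (@within_retract (fun z => f t z.1 z.2 ord0 i)).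
have /subspace_continuousP cf := repr_f_continuous fl_repr tI.
apply/subspace_continuousP => z Az; apply: cvg_coord; exact: cf.
Qed.

Let l_retract_continuous t : I01 t ->
  continuous (fun z : 'rV[R]_n * 'rV[R]_n.+1 => l t z.1 (retract z.2)).
Proof.
by move=> tI; apply: (@within_retract (fun z => l t z.1 z.2)); exact: (repr_l_continuous fl_repr).
Qed.

Lemma f_comp_measurable (x : R -> 'rV[R]_n) (a : R -> 'rV[R]_n.+1) i :
  (forall i, measurable01 (fun t => x t ord0 i)) ->
  (forall i, measurable01 (fun t => a t ord0 i)) ->
  measurable01 (fun t => f t (x t) (retract (a t)) ord0 i).
Proof.
move=> mx ma; apply: (measurable01_caratheodory2 (g := fun t z w => f t z (retract w) ord0 i)) => //.
  by move=> z w; apply: (repr_f_measurable fl_repr); exact: retract_eball.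
by move=> t tI; exact: (@f_retract_continuous t i tI (x t, a t)).
Qed.

Lemma l_comp_measurable (x : R -> 'rV[R]_n) (a : R -> 'rV[R]_n.+1) :
  (forall i, measurable01 (fun t => x t ord0 i)) ->
  (forall i, measurable01 (fun t => a t ord0 i)) ->
  measurable01 (fun t => l t (x t) (retract (a t))).
Proof.
move=> mx ma; apply: (measurable01_caratheodory2 (g := fun t z w => l t z (retract w))) => //.
  by move=> z w; apply: (repr_l_measurable fl_repr); exact: retract_eball.
by move=> t tI; exact: (@l_retract_continuous t tI (x t, a t)).
Qed.

Lemma arc_lagrangian_measurable (x : R -> 'rV[R]_n) : abs_continuous01 x ->
  measurable_fun I01 (fun t : lebesgueR R => lagrangian H t (x t) (derive1 x t)).
Proof.
move=> acx; have [g [ig _ xg]] := arc_ftc acx.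
apply: (emeasurable01_ae (g := fun t => lagrangian H t (x t) (g t))).
  apply: lagrangian_measurable => i; first exact: arc_measurable.
  exact: integrable01_measurable.
by apply: ae01S xg => t _ ->.
Qed.

Lemma Gamma_le_Lambda (phi : 'rV[R]_n * 'rV[R]_n -> \bar R) xa :
  control_pairs f xa -> (Gamma phi H xa.1 <= Lambda phi l xa)%E.
Proof.
case: xa => x a [/= acx ia dx]; apply: leeD2l => /=.
have ma i : measurable01 (fun t => a t ord0 i) by exact: integrable01_measurable.
have mx i : measurable01 (fun t => x t ord0 i) by exact: arc_measurable.
apply: ae01_le_integral; first exact: arc_lagrangian_measurable.
  apply/measurable_EFinP; apply: (measurable01_ae (l_comp_measurable mx ma)).
  by apply: ae01S dx => t _ [_ /retract_id ->].
by apply: ae01S dx => t tI [-> Ba]; exact: lagrangian_le_cost.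
Qed.

(* By (A3) the zeros of [psi] below are the controls realizing [g] and its
   Lagrangian; the indicator makes [psi] vanish where the Lagrangian is not finite. *)
Lemma filippov (x g : R -> 'rV[R]_n) :
  (forall i, measurable01 (fun t => x t ord0 i)) ->
  (forall i, measurable01 (fun t => g t ord0 i)) ->
  exists a : R -> 'rV[R]_n.+1, [/\ forall i, measurable01 (fun t => a t ord0 i),
    forall t, I01 t -> eball n.+1 1 (a t) &
    forall t, I01 t -> edom (lagrangian H t (x t)) (g t) ->
      f t (x t) (a t) = g t /\ (l t (x t) (a t))%:E = lagrangian H t (x t) (g t)].
Proof.
move=> mx mg; have mL := lagrangian_measurable mx mg.
pose L t := lagrangian H t (x t) (g t).
pose T0 : set R := I01 `&` [set t | L t \is a fin_num].
have mT0 : measurable (T0 : set (lebesgueR R)) by exact: emeasurable_fin_num.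
have mfL : measurable01 (fine \o L) by exact: measurableT_comp.
pose psi t (a : 'rV[R]_n.+1) := \1_T0 t *
  (\sum_(i < n) `|f t (x t) (retract a) ord0 i - g t ord0 i| +
   `|l t (x t) (retract a) - fine (L t)|).
have [|||a [ma aP]] := @measurable_selection R n.+1 psi.
- split.
    move=> z; apply: measurable01M; first exact: measurable_indic.
    apply: measurable01D.
      apply: measurable01_sum => i; apply: measurable01_norm; apply: measurable01B => //.
      by apply: (f_comp_measurable i mx (a := fun=> z)) => j; exact: measurable01_cst.
    apply: measurable01_norm; apply: measurable01B => //.
    by apply: (l_comp_measurable mx (a := fun=> z)) => j; exact: measurable01_cst.
  move=> t tI a.
  apply: (@cvgM _ _ (nbhs a)); first exact: cvg_cst.
  apply: (@cvgD _ _ _ (nbhs a)).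
    apply: cvg_big => [|i _]; first exact: add_continuous.
    apply: (@cvg_norm _ _ _ (nbhs a)); apply: (@cvgB _ _ _ (nbhs a)); last exact: cvg_cst.
    exact: (@cvg_for2 _ _ _ _ (nbhs a) _ (fun z w => f t z (retract w) ord0 i) (fun=> x t) id
      _ _ (@f_retract_continuous t i tI (x t, a)) (cvg_cst _) (@cvg_id _ _)).
  apply: (@cvg_norm _ _ _ (nbhs a)); apply: (@cvgB _ _ _ (nbhs a)); last exact: cvg_cst.
  exact: (@cvg_for2 _ _ _ _ (nbhs a) _ (fun z w => l t z (retract w)) (fun=> x t) id
      _ _ (@l_retract_continuous t tI (x t, a)) (cvg_cst _) (@cvg_id _ _)).
- move=> t z; apply: mulr_ge0; first by rewrite indicE.
  by apply: addr_ge0 => //; apply: sumr_ge0.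
- move=> t tI; have [T0t|T0t] := pselect (T0 t); last first.
    exists 0; first by rewrite /eball/= enorm0.
    by rewrite /psi indicE memNset// mul0r.
  have : egph (lagrangian H t (x t)) (g t, fine (L t)).
    by rewrite /egph/= fineK//; case: T0t.
  move=> /(repr_A3 fl_repr tI)[a Ba [fa la]]; exists a => //.
  rewrite /psi retract_id// fa la subrr normr0 addr0 big1 ?mulr0// => i _.
  by rewrite subrr normr0.
exists a; split => // [t tI|t tI gd]; have [Ba] := aP t tI => //.
rewrite /psi retract_id// indicE mem_set; last by split.
rewrite mul1r => /eqP; rewrite paddr_eq0//; last exact: sumr_ge0.
rewrite psumr_eq0//= normr_eq0 subr_eq0 => /andP[/allP fa /eqP la]; split.
  apply/rowP => i; have := fa i (mem_index_enum _).
  by rewrite normr_eq0 subr_eq0 => /eqP.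
by rewrite la fineK.
Qed.

Lemma control_of_arc (phi : 'rV[R]_n * 'rV[R]_n -> \bar R) (x : R -> 'rV[R]_n) :
  abs_continuous01 x -> ae01 (fun t => edom (lagrangian H t (x t)) (derive1 x t)) ->
  exists2 a, control_pairs f (x, a) & Lambda phi l (x, a) = Gamma phi H x.
Proof.
move=> acx dx; have [g [ig _ xg]] := arc_ftc acx.
have mx i : measurable01 (fun t => x t ord0 i) by exact: arc_measurable.
have mg i : measurable01 (fun t => g t ord0 i) by exact: integrable01_measurable.
have [a [ma Ba aP]] := filippov mx mg.
exists a.
  split => //=.
    move=> i; apply: (integrable01_dom (ma i) (integrable01_cst 1)).
    apply: ae01T => t tI; apply: le_trans (coord_le_enorm _ _) _; exact: Ba.
  apply: ae01S2 dx xg => t tI dt xt; split; last exact: Ba.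
  by rewrite xt in dt *; have [-> _] := aP t tI dt.
congr (_ + _)%E; apply: ae01_eq_integral.
- apply/measurable_EFinP; apply: (measurable01_ae (l_comp_measurable mx ma)).
  by apply: ae01T => t tI; rewrite retract_id//; exact: Ba.
- exact: arc_lagrangian_measurable.
- apply: ae01S2 dx xg => t tI dt xt; rewrite xt in dt *.
  by have [_ ->] := aP t tI dt.
Qed.

(** * A priori bounds on arcs *)

Lemma arc_bounded (x : R -> 'rV[R]_n) : abs_continuous01 x ->
  exists2 r, 0 < r & forall t, I01 t -> eball n r (x t).
Proof.
move=> acx; have [g [ig gE _]] := arc_ftc acx.
pose B := \sum_(i < n) (`|x 0 ord0 i| + prim (fun s => `|g s ord0 i|) 1).
have pn i : 0 <= prim (fun s => `|g s ord0 i|) 1.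
  rewrite -(prim0 (integrable01_norm (ig i))); apply: ge0_prim_nd => //.
  exact: integrable01_norm.
have B0 : 0 <= B by apply: sumr_ge0 => i _; rewrite addr_ge0.
exists (n%:R * B + 1); first by rewrite ltr_wpDl// mulr_ge0.
move=> t; rewrite /I01/= in_itv/= => /andP[t0 t1].
rewrite /eball/=; apply: le_trans (enorm_le_norm _) _.
apply: le_trans (_ : n%:R * B <= _); last by rewrite lerDl.
apply: ler_wpM2l => //; apply: mx_norm_leP => // i.
rewrite gE ?t0// /B (bigD1 i)//= -[leLHS]addr0 lerD//; last first.
  by apply: sumr_ge0 => j _; rewrite addr_ge0.
apply: le_trans (ler_normD _ _) _; rewrite lerD2l.
have h : `|prim (fun s => g s ord0 i) t - prim (fun s => g s ord0 i) 0| <=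
   prim (fun s => `|g s ord0 i|) t - prim (fun s => `|g s ord0 i|) 0.
  apply: prim_norm_le => //; [exact: integrable01_norm|exact: ae01T].
rewrite (prim0 (ig i)) (prim0 (integrable01_norm (ig i))) !subr0 in h.
by apply: le_trans h _; apply: ge0_prim_nd => //; exact: integrable01_norm.
Qed.

(** On a ball containing the arc the Lagrangian is at least [- mass r], so an integral below [+oo]
    makes it integrable, hence finite almost everywhere. *)
Lemma arc_finite (x : R -> 'rV[R]_n) : abs_continuous01 x ->
  (integral01 (fun t => lagrangian H t (x t) (derive1 x t)) < +oo)%E ->
  ae01 (fun t => edom (lagrangian H t (x t)) (derive1 x t)).
Proof.
move=> acx Loo; have [r r0 xr] := arc_bounded acx.
have mL := arc_lagrangian_measurable acx.
set L := fun t : lebesgueR R => lagrangian H t (x t) (derive1 x t) in Loo mL.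
have iL : (leb R).-integrable I01 L.
  apply: (bounded_below_integrable mI mL (mass_integrable r0)) => // t tI.
  exact: (lagrangian_lower (derive1 x t) r0 tI (xr t tI)).
exact: (integrable_ae mI iL).
Qed.

Context (n_ge1 : (1 <= n)%N).

(** [K] depends only on [n] and [c], so one constant serves all arcs. Both orders of [s] and [t] are
    covered because [phi] may bound either endpoint. *)
Lemma admissible_gronwall : exists2 K : R, 0 < K & forall x : R -> 'rV[R]_n,
  abs_continuous01 x -> ae01 (fun t => edom (lagrangian H t (x t)) (derive1 x t)) ->
  forall s t, 0 <= s <= 1 -> 0 <= t <= 1 -> 1 + `|x t| <= K * (1 + `|x s|).
Proof.
have iC : integrable01 (fun t => n%:R * c t) by exact: integrable01Z.
have n1 : 1 <= n%:R :> R by rewrite ler1n.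
have [t tI|K K0 KP] := gronwall iC; first by rewrite mulr_ge0// c_ge0.
exists K => // x acx Lx; apply: (KP (fun t => 1 + `|x t|)).
- by move=> t _; rewrite addr_ge0.
- have [r r0 xr] := arc_bounded acx; exists (1 + r) => t t01.
  rewrite lerD2l; apply: le_trans (norm_le_enorm _) _; apply: xr.
  by rewrite /I01/= in_itv.
move=> s t U s0 st t1 xU; have [g [ig xE xg]] := arc_ftc acx.
have -> : 1 + `|x t| - (1 + `|x s|) = `|x t| - `|x s| by ring.
apply: le_trans (ler_dist_dist _ _) _.
have iCU := integrable01Z U iC.
rewrite mulrBr -!primZ// ?(le_trans st)//.
apply: (norm_arc_le n_ge1 ig) => //.
apply: ae01S2 Lx xg => u uI Lu xgu /andP[su ut] i.
have xu : 1 + `|x u| <= U by apply: xU; rewrite (ltW su) (ltW ut).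
rewrite xgu in Lu; apply: le_trans (coord_le_enorm _ _) _.
apply: le_trans (lagrangian_speed uI Lu) _.
rewrite mulrA mulrC; apply: ler_wpM2r; first exact: c_ge0.
apply: (@le_trans _ _ ((1 + `|x u|) * n%:R)); last by rewrite ler_wpM2r.
have := enorm_le_norm (x u); rewrite mulrDl mul1r (mulrC `|_|); lra.
Qed.

(** * Compactness and existence of an optimal arc *)

Lemma H_integrable (x : R -> 'rV[R]_n) r p : 0 < r ->
  (forall i, measurable01 (fun t => x t ord0 i)) ->
  (forall t, I01 t -> eball n r (x t)) -> integrable01 (fun t => H t (x t) p).
Proof.
move=> r0 mx xr; have mH := H_comp_measurable p mx.
apply: (integrable01_dom mH (h := fun t => `|H t 0 0| + (r * (1 + enorm p)) * k r t + enorm p * c t)).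
  apply: integrable01D; last exact: integrable01Z.
  apply: integrable01D; first exact: integrable01_norm.
  by apply: integrable01Z; exact: k_int.
apply: ae01T => t tI.
have h1 := H_lip_x p r0 tI (xr t tI) (eball0 r0).
have h2 := H_lip_p 0 p 0 tI.
rewrite subr0 in h1; rewrite subr0 enorm0 addr0 mulr1 in h2.
have h3 : k r t * (1 + enorm p) * enorm (x t) <= k r t * (1 + enorm p) * r.
  by apply: ler_wpM2l; [rewrite mulr_ge0 ?k_ge0// addr_ge0 ?enorm_ge0|exact: xr].
have h4 := ler_distD (H t 0 p) (H t (x t) p) 0.
have h5 := ler_distD (H t 0 0) (H t 0 p) 0.
rewrite !subr0 in h4 h5.
lra.
Qed.

Lemma arc_cost (x : R -> 'rV[R]_n) r : 0 < r -> abs_continuous01 x ->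
  (forall t, I01 t -> eball n r (x t)) ->
  ae01 (fun t => edom (lagrangian H t (x t)) (derive1 x t)) ->
  let L t := fine (lagrangian H t (x t) (derive1 x t)) in
  [/\ integrable01 L, ae01 (fun t => `|L t| <= mass r t) &
    integral01 (fun t => lagrangian H t (x t) (derive1 x t)) = (prim L 1)%:E].
Proof.
move=> r0 acx xr Lx L; have mL := arc_lagrangian_measurable acx.
have mfL : measurable01 L by apply: measurableT_comp mL; exact: fine_measurable.
have Lm : ae01 (fun t => `|L t| <= mass r t).
  by apply: ae01S Lx => t tI Lt; apply: lagrangian_bound => //; exact: xr.
have iL : integrable01 L := integrable01_dom mfL (mass_integrable r0) Lm.
split; [exact: iL|exact: Lm|]; rewrite -(prim1 iL); apply: ae01_eq_integral.
- exact: mL.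
- exact/measurable_EFinP.
by apply: ae01S Lx => t _ Lt; rewrite fineK.
Qed.

(** Lower semicontinuity along a subsequence: [y1] is the limit of the costs, and the limit arc may
    cost strictly less when velocities oscillate. *)
Lemma lagrangian_closure (x : nat -> R -> 'rV[R]_n) r : 0 < r ->
  (forall j, abs_continuous01 (x j)) ->
  (forall j t, I01 t -> eball n r (x j t)) ->
  (forall j, ae01 (fun t => edom (lagrangian H t (x j t)) (derive1 (x j) t))) ->
  exists (sigma : nat -> nat) (z : R -> 'rV[R]_n) (y1 : R),
    [/\ forall j, (j <= sigma j)%N, abs_continuous01 z,
    forall e, 0 < e -> exists N, forall j, (N <= j)%N ->
      (forall t, 0 <= t <= 1 -> `|x (sigma j) t - z t| < e) /\
      `|fine (integral01 (fun t => lagrangian H t (x (sigma j) t) (derive1 (x (sigma j)) t))) - y1| < e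
    & (integral01 (fun t => lagrangian H t (z t) (derive1 z t)) <= y1%:E)%E].
Proof.
move=> r0 acx xr Lx.
have I01P (t : R) : 0 <= t <= 1 -> I01 t by move=> t01; rewrite /I01/= in_itv.
pose L j t := fine (lagrangian H t (x j t) (derive1 (x j) t)).
have Lp j := arc_cost r0 (acx j) (xr j) (Lx j).
have iL j : integrable01 (L j) by have [] := Lp j.
have im := mass_integrable r0.
have im1 : integrable01 (fun t => (1 + r) * c t) by exact: integrable01Z.
have xm j s t : 0 <= s -> s <= t -> t <= 1 ->
    `|x j t - x j s| <= prim (fun t => (1 + r) * c t) t - prim (fun t => (1 + r) * c t) s.
  move=> s0 st t1; have [g [ig xE xg]] := arc_ftc (acx j).
  apply: (norm_arc_le n_ge1 ig) => //.
  apply: ae01S2 (Lx j) xg => u uI Lu xgu _ i; rewrite xgu in Lu.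
  apply: le_trans (coord_le_enorm _ _) _.
  apply: le_trans (lagrangian_speed uI Lu) _.
  by rewrite mulrC ler_wpM2r ?c_ge0// lerD2l; exact: xr.
have [sx [z [sxj zr xz zm]]] :=
  arzela_prim (eball_compact (r := r)) im1 (fun j t t01 => xr j t (I01P t t01)) xm.
have Lm j s t : 0 <= s -> s <= t -> t <= 1 ->
    `|prim (L j) t - prim (L j) s| <= prim (mass r) t - prim (mass r) s.
  by move=> s0 st t1; apply: prim_norm_le => //; have [] := Lp j.
have LB j t : 0 <= t <= 1 -> `[- prim (mass r) 1, prim (mass r) 1]%classic (prim (L j) t).
  move=> /andP[t0 t1]; have := Lm j 0 t (lexx 0) t0 t1.
  rewrite !prim0// !subr0 => h; rewrite /= in_itv/= -ler_norml; apply: le_trans h _.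
  by apply: prim_nd => //; have [_ h _] := Lp 0%N; apply: ae01S h => u _; apply: le_trans.
(* The second extraction runs along the first, so that arcs and cost primitives converge along the
   common subsequence [sx \o sy]. *)
have [sy [y [syj yK Ly ym]]] := arzela_prim (V := R) (x := fun j => prim (L (sx j)))
  (@segment_compact R _ _) im (fun j => LB (sx j)) (fun j => Lm (sx j)).
pose sg := sx \o sy.
have acz : abs_continuous01 z := abs_continuous01_prim im1 zm.
exists sg, z, (y 1); split => //.
- by move=> j; exact: leq_trans (syj j) (sxj _).
- move=> e e0; have [N1 h1] := xz e e0; have [N2 h2] := Ly e e0.
  exists (maxn N1 N2) => j; rewrite geq_max => /andP[j1 j2]; split.
    by apply: h1; exact: leq_trans j1 (syj j).
  by have [_ _ ->] := Lp (sg j); apply: h2 => //; rewrite ler01 lexx.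
have y0 : y 0 = 0.
  apply/eqP; rewrite -normr_eq0 eq_le normr_ge0 andbT.
  apply: (@ler_eps _ 1) => // e e0; have [N NP] := Ly e e0.
  have := NP N (leqnn N) 0; rewrite prim0// sub0r normrN lexx ler01 add0r mulr1 => h.
  by apply: ltW; exact: h.
have acy : ac01 y.
  apply: (ac01_le (G := prim (mass r))) (ac01_prim im) => s t s0 st t1.
  by apply: le_trans (ym s t s0 st t1) _; exact: ler_norm.
have [h ih yh] := ac01_ftc acy; have [g [ig zE zg]] := arc_ftc acz.
have mz i : measurable01 (fun t => z t ord0 i) by exact: arc_measurable.
have zr' t : I01 t -> eball n r (z t).
  by rewrite /I01/= in_itv; exact: zr.
have iHz p := H_integrable p r0 mz zr'.
have key p s t : 0 <= s -> s <= t -> t <= 1 -> dotv (z t) p - dotv (z s) p -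
    (prim (fun u => H u (z u) p) t - prim (fun u => H u (z u) p) s) <= y t - y s.
  move=> s0 st t1; have s1 := le_trans st t1; have t0 := le_trans s0 st.
  have s01 : 0 <= s <= 1 by rewrite s0.
  have t01 : 0 <= t <= 1 by rewrite t0.
  set S := \sum_(i < n) `|p ord0 i|.
  have S0 : 0 <= S by apply: sumr_ge0.
  set Q := prim (k r) t - prim (k r) s.
  have Q0 : 0 <= Q.
    rewrite subr_ge0; apply: prim_nd => //; first exact: k_int.
    by apply: ae01T => u uI; exact: k_ge0.
  have C1 : 0 <= n%:R * (1 + enorm p) by rewrite mulr_ge0// addr_ge0 ?enorm_ge0.
  (* Errors at scale [e]: [S] for the scalar product at each end, [n (1 + |p|) Q] for replacing
     [x J] by [z] inside [H], and 1 for [y] at each end. *)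
  apply: (@ler_eps _ (2 * S + n%:R * (1 + enorm p) * Q + 2)).
    by rewrite addr_ge0// addr_ge0// mulr_ge0.
  move=> e e0; have [N1 h1] := xz e e0; have [N2 h2] := Ly e e0.
  pose j := maxn N1 N2; pose J := sg j.
  have {}h1 u : 0 <= u <= 1 -> `|x J u - z u| < e.
    by apply: h1; exact: leq_trans (leq_maxl _ _) (syj _).
  have {}h2 u : 0 <= u <= 1 -> `|prim (L J) u - y u| < e.
    by apply: h2; exact: leq_maxr.
  have [gj [igj xEj xgj]] := arc_ftc (acx J).
  have mxj i : measurable01 (fun t => x J t ord0 i) by exact: arc_measurable.
  have iHj := H_integrable p r0 mxj (xr J).
  have [idj dt] := arc_dotv p igj xEj t01; have [_ ds] := arc_dotv p igj xEj s01.
  have A : prim (fun u => dotv (gj u) p - H u (x J u) p) t -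
      prim (fun u => dotv (gj u) p - H u (x J u) p) s <= prim (L J) t - prim (L J) s.
    apply: prim_le => //; first exact: integrable01B.
    apply: ae01S2 (Lx J) xgj => u uI Lu xgu; rewrite -xgu -lee_fin fineK//.
    exact: lagrangian_ge.
  rewrite !primB// dt ds in A.
  have B : `|prim (fun u => H u (x J u) p - H u (z u) p) t -
      prim (fun u => H u (x J u) p - H u (z u) p) s| <=
      prim (fun u => (n%:R * e * (1 + enorm p)) * k r u) t -
      prim (fun u => (n%:R * e * (1 + enorm p)) * k r u) s.
    apply: prim_norm_le => //; first exact: integrable01B.
      by apply: integrable01Z; exact: k_int.
    apply: ae01T => u uI; apply: le_trans (H_lip_x p r0 uI (xr J u uI) (zr' u uI)) _.
    rewrite [leRHS]mulrC -mulrA ler_wpM2l ?k_ge0// mulrC ler_wpM2r ?addr_ge0 ?enorm_ge0//.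
    apply: le_trans (enorm_le_norm _) _; rewrite ler_wpM2l// ltW// h1//.
  rewrite !primB// in B. rewrite !(primZ _ (k_int r0))// in B.
  rewrite -mulrBr -/Q in B.
  have D u : 0 <= u <= 1 -> `|dotv (x J u) p - dotv (z u) p| <= e * S.
    move=> u01; rewrite -dotvB; apply: le_trans (dotv_le_norm _ _) _.
    by rewrite ler_wpM2r// ltW// h1.
  have Ds := D s s01; have Dt := D t t01; have Es := h2 s s01; have Et := h2 t t01.
  have -> : e * (2 * S + n%:R * (1 + enorm p) * Q + 2) =
    2 * (e * S) + n%:R * e * (1 + enorm p) * Q + 2 * e by ring.
  move: A B Ds Dt Es Et; rewrite !ler_norml !ltr_norml.
  lra.
have pos p : ae01 (fun t => 0 <= h t - (dotv (g t) p - H t (z t) p)).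
  have [idz _] := arc_dotv p ig zE (t := 0) (introT andP (conj (lexx 0) ler01)).
  have id1 : integrable01 (fun t => dotv (g t) p - H t (z t) p) by exact: integrable01B.
  apply: prim_nondecreasing_ge0; first exact: integrable01B.
  move=> s t s0 st t1; have s1 := le_trans st t1; have t0 := le_trans s0 st.
  have s01 : 0 <= s <= 1 by rewrite s0.
  have t01 : 0 <= t <= 1 by rewrite t0.
  have [_ dt] := arc_dotv p ig zE t01; have [_ ds] := arc_dotv p ig zE s01.
  rewrite !primB// dt ds.
  have := key p s t s0 st t1; rewrite (yh s)// (yh t)//; lra.
have Lh : ae01 (fun t => lagrangian H t (z t) (derive1 z t) <= (h t)%:E)%E.
  have posq : ae01 (fun t => forall q : nat * 'rV[int]_n,
      0 <= h t - (dotv (g t) (rV_unfloor q.1 q.2) - H t (z t) (rV_unfloor q.1 q.2))).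
    by apply: ae01_countable => q; exact: pos.
  apply: ae01S2 posq zg => t tI pq ->; rewrite leNgt; apply/negP.
  move=> /(lagrangian_gt_dense _ _ _ tI)[q]; have := pq q; lra.
rewrite (_ : y 1 = prim h 1); last by rewrite yh ?ler01 ?lexx// y0 add0r.
rewrite -prim1//; apply: ae01_le_integral.
- exact: arc_lagrangian_measurable.
- by apply/measurable_EFinP; exact: integrable01_measurable.
- exact: Lh.
Qed.

Lemma Gamma_finite (phi : 'rV[R]_n * 'rV[R]_n -> \bar R) (x : R -> 'rV[R]_n) :
  (forall z, phi z <> -oo%E) -> abs_continuous01 x -> (Gamma phi H x < +oo)%E ->
  phi (x 0, x 1) \is a fin_num /\
  ae01 (fun t => edom (lagrangian H t (x t)) (derive1 x t)).
Proof.
move=> phiN acx Goo; have [r r0 xr] := arc_bounded acx.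
have Lx : ae01 (fun t => edom (lagrangian H t (x t)) (derive1 x t)).
  apply: arc_finite => //; rewrite ltey; apply/eqP => E; move: Goo.
  (* The sum of [-oo] and [+oo] is [-oo]: a value [-oo] of [phi] would hide an infinite integral. *)
  rewrite /Gamma E addey ?ltxx//; exact/eqP/phiN.
split => //; have [_ _ E] := arc_cost r0 acx xr Lx.
move: Goo; rewrite /Gamma E fin_numE; case: (phi _) (phiN (x 0, x 1)) => //.
Qed.

Lemma Gamma_minimizer (phi : 'rV[R]_n * 'rV[R]_n -> \bar R) (M : R) :
  (forall z, phi z <> -oo%E) -> lower_semicontinuous phi -> 0 <= M ->
  (forall z x, edom phi (z, x) -> Num.min (enorm z) (enorm x) <= M) ->
  exists x, minimizer (arcs R n) (Gamma phi H) x.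
Proof.
move=> phiN phi_lsc M0 phi_dom; pose S := Gamma phi H @` arcs R n.
have Sinf y : abs_continuous01 y -> (ereal_inf S <= Gamma phi H y)%E.
  by move=> acy; apply: ereal_inf_lbound; exists y.
have ac0 : abs_continuous01 (fun=> 0 : 'rV[R]_n).
  move=> e e0; exists 1 => // m a b _ _ _; rewrite big1// => i _.
  by rewrite subrr enorm0.
(* If every arc costs [+oo], any arc is a minimizer, for instance the constant one. *)
have [Soo|] := eqVneq (ereal_inf S) +oo%E.
  exists (fun=> 0); split; first exact: ac0.
  move=> y acy.
  by have := Sinf y acy; rewrite Soo leye_eq => /eqP ->; exact: leey.
rewrite -ltey => Soo.
have S0 : S != set0 by apply/set0P; exists (Gamma phi H (fun=> 0)); exists (fun=> 0).
have [u uS ucv] := ereal_inf_seq S0.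
have [N0 _ N0P] : \forall j \near \oo, (u j < +oo)%E.
  by apply: (ucv [set y | (y < +oo)%E]); apply: open_nbhs_nbhs; split => //; exact: open_ereal_lt_ereal.
(* The first [N0] terms are dropped so that every arc of the sequence has finite cost. *)
have /choice[x xP] : forall j, exists x : R -> 'rV[R]_n, abs_continuous01 x /\ Gamma phi H x = u (j + N0)%N.
  by move=> j; have [x xj <-] := uS (j + N0)%N; exists x.
have acx j : abs_continuous01 (x j) by have [] := xP j.
have Goo j : (Gamma phi H (x j) < +oo)%E.
  by have [_ ->] := xP j; apply: N0P; rewrite /= leq_addl.
have fin j := Gamma_finite phiN (acx j) (Goo j).
have [K K0 KP] := admissible_gronwall.
(* Gronwall from an endpoint of norm at most [M] gives [K * (1 + M)]; [n] converts to the Euclidean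
   norm and the added 1 keeps the radius positive. *)
pose r := n%:R * (K * (1 + M)) + 1.
have r0 : 0 < r by rewrite ltr_wpDl// mulr_ge0// mulr_ge0 ?(ltW K0)// addr_ge0.
have xr j t : I01 t -> eball n r (x j t).
  rewrite /I01/= in_itv/= => t01.
  (* Which endpoint is bounded depends on [j], and [KP] can start from either. *)
  have [s s01 sM] : exists2 s, 0 <= s <= 1 & `|x j s| <= M.
    have := phi_dom _ _ (fin j).1; rewrite ge_min => /orP[h|h]; [exists 0|exists 1];
      rewrite ?lexx ?ler01//; exact: le_trans (norm_le_enorm _) h.
  have := KP _ (acx j) (fin j).2 s t s01 t01.
  have : K * (1 + `|x j s|) <= K * (1 + M) by rewrite ler_pM2l// lerD2l.
  have := enorm_le_norm (x j t).
  move=> h1 h2 h3; rewrite /eball/= /r; apply: le_trans h1 _.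
  apply: (@le_trans _ _ (n%:R * (K * (1 + M)))); last by rewrite lerDl.
  by rewrite ler_wpM2l//; lra.
have [sg [z [y1 [sgj acz zP Lz]]]] := lagrangian_closure r0 acx xr (fun j => (fin j).2).
pose l_ j := fine (integral01 (fun t => lagrangian H t (x (sg j) t) (derive1 (x (sg j)) t))).
have lE j : integral01 (fun t => lagrangian H t (x (sg j) t) (derive1 (x (sg j)) t)) = (l_ j)%:E.
  by rewrite /l_; have [_ _ ->] := arc_cost r0 (acx (sg j)) (xr (sg j)) (fin (sg j)).2.
have lcv : l_ j @[j --> \oo] --> y1.
  apply/cvgrPdist_lt => e e0; have [N NP] := zP e e0.
  by exists N => // j Nj; rewrite distrC; have [] := NP j Nj.
have xcv t : 0 <= t <= 1 -> x (sg j) t @[j --> \oo] --> z t.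
  move=> t01; apply/cvgrPdist_lt => e e0; have [N NP] := zP e e0.
  by exists N => // j Nj; rewrite distrC; have [h _] := NP j Nj; exact: h.
have wcv : u (sg j + N0)%N @[j --> \oo] --> ereal_inf S.
  apply: cvg_trans ucv => A [N _ NA]; exists N => // j Nj; apply: NA => /=.
  by apply: leq_trans Nj _; apply: leq_trans (sgj j) _; exact: leq_addr.
(* [phi] could be [+oo] at the endpoints of [z], so lower semicontinuity is used through the reals
   [a] below its value. *)
have key a : (a%:E < phi (z 0%R, z 1%R))%E -> ((a + y1)%:E <= ereal_inf S)%E.
  move=> /phi_lsc[V nV VP].
  have acv : (a + l_ j)%:E @[j --> \oo] --> (a + y1)%:E.
    by apply: cvg_EFin; [exact: nearW|apply: cvgD => //; exact: cvg_cst].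
  rewrite -(cvg_lim _ acv)// -(cvg_lim _ wcv)//; apply: lee_lim.
  - by apply/cvg_ex; exists (a + y1)%:E.
  - by apply/cvg_ex; exists (ereal_inf S).
  have : \forall j \near \oo, V (x (sg j) 0, x (sg j) 1).
    case: nV => -[A B] /= [nA nB] AB.
    have h0 : \forall j \near \oo, A (x (sg j) 0) := xcv 0 (introT andP (conj (lexx 0) ler01)) _ nA.
    have h1 : \forall j \near \oo, B (x (sg j) 1) := xcv 1 (introT andP (conj ler01 (lexx 1))) _ nB.
    by near=> j; apply: AB; split; near: j.
  apply: filterS => j /VP aV; have [_ <-] := xP (sg j).
  by rewrite /Gamma lE EFinD leeD2r// ltW.
exists z; split; first exact: acz.
move=> y acy; apply: le_trans (Sinf y acy).
apply: (@le_trans _ _ (phi (z 0%R, z 1%R) + y1%:E)%E); first exact: leeD2l.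
move: key; case: (phi (z 0%R, z 1%R)) (phiN (z 0%R, z 1%R)) => [p| |]// _ key.
  apply/lee_subgt0Pr => e e0; rewrite -!EFinD addrAC; apply: key.
  by rewrite lte_fin ltrBlDr ltrDl.
(* When [phi] is [+oo] at the endpoints of [z], [key] makes the infimum exceed every real, and the
   comparison is trivial. *)
rewrite [leRHS](_ : _ = +oo%E) ?leey//; apply: eq_infty => a.
by rewrite -(subrK y1 a); apply: key; rewrite ltry.
Unshelve. all: by end_near.
Qed.

Lemma control_pairs_nonempty : exists xa, control_pairs f xa.
Proof.
have B0 : eball n.+1 1 (0 : 'rV[R]_n.+1) by rewrite /eball/= enorm0.
have n0 : 0 < n%:R :> R by rewrite ltr0n.
(* The Lipschitz factor of (A1) at radius [n r], because the max-norm ball of radius [r] lies in the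
   Euclidean ball of radius [n r]. The leading [n] converts [enorm (x - y)] to the max norm. *)
pose K r t := n%:R * (10 * n.+1%:R) * (omega H lam c (n%:R * r) t + 3 * (1 + n%:R * r) * k (n%:R * r) t + 1).
have [||||r r0|r t r0 tI|r t x y r0 tI xr yr|x [acx xE]] :=
    @caratheodory_ode R n n_ge1 (fun t x => f t x 0) (fun t => n%:R * c t) K.
- move=> x mx i; have := f_comp_measurable i mx (a := fun=> 0) (fun i => _).
  rewrite (retract_id B0); apply => j; under eq_fun do rewrite mxE.
  exact: measurable01_cst.
- exact: integrable01Z.
- by move=> t tI; rewrite mulr_ge0// c_ge0.
- move=> t x tI; apply: le_trans (norm_le_enorm _) _; apply: le_trans (repr_A2 fl_repr x tI B0) _.
  rewrite [leRHS]mulrAC [leRHS]mulrC; apply: ler_wpM2l; first exact: c_ge0.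
  have n1 : 1 <= n%:R :> R by rewrite ler1n.
  by have := enorm_le_norm x; rewrite mulrDr mulr1; lra.
- have nr0 : 0 < n%:R * r by rewrite mulr_gt0.
  apply: integrable01Z; apply: integrable01D; last exact: integrable01_cst.
  apply: integrable01D; last by apply: integrable01Z; exact: k_int.
  rewrite (_ : omega _ _ _ _ = fun t => `|lam t 0| + `|H t 0 0| + (2 + n%:R * r) * c t).
    by apply: integrable01D; [apply: integrable01D; exact: integrable01_norm|exact: integrable01Z].
  by apply/funext => t; rewrite /omega (mulrC (c t)).
- have nr0 : 0 < n%:R * r by rewrite mulr_gt0.
  rewrite /K /omega !(mulr_ge0, addr_ge0)// ?c_ge0 ?k_ge0// ?addr_ge0// ltW//.
- have nr0 : 0 < n%:R * r by rewrite mulr_gt0.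
  have ball z : `|z| <= r -> eball n (n%:R * r) z.
    by move=> zr; apply: le_trans (enorm_le_norm _) _; rewrite ler_wpM2l.
  have [+ _] := repr_A1 fl_repr nr0 tI (ball _ xr) (ball _ yr) B0 B0.
  rewrite subrr enorm0 addr0 => h; apply: le_trans (norm_le_enorm _) _; apply: le_trans h _.
  have Q0 : 0 <= 10 * n.+1%:R * (omega H lam c (n%:R * r) t + 3 * (1 + n%:R * r) * k (n%:R * r) t + 1).
    rewrite /omega !(mulr_ge0, addr_ge0)// ?c_ge0 ?k_ge0// ?addr_ge0// ltW//.
  have := ler_wpM2l Q0 (enorm_le_norm (x - y)).
  move=> {}h; apply: le_trans h _; rewrite /K le_eqVlt; apply/orP; left; apply/eqP; ring.
exists (x, fun=> 0); split => //=.
  by move=> i; under eq_fun do rewrite mxE; exact: integrable01_cst.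
by apply: ae01S xE => t _ ->.
Qed.

End lagrangian_problem.

(** * Equality of the two minima *)

Lemma ereal_inf_minimizer (R : realType) (T : Type) (A : set T) (F : T -> \bar R) x :
  minimizer A F x -> ereal_inf (F @` A) = F x.
Proof.
move=> [Ax xmin]; apply/eqP; rewrite eq_le ereal_inf_lbound//=; last by exists x.
by apply: le_ereal_inf_tmp => _ [y Ay <-]; exact: xmin.
Qed.

Theorem theorem3p13 (R : realType) (n : nat) (n_ge1 : (1 <= n)%N)
    (H : R -> 'rV[R]_n -> 'rV[R]_n -> R)
    (c : R -> R) (k : R -> R -> R) (lam : R -> 'rV[R]_n -> R)
    (H_meas : forall x p, measurable01 (fun t => H t x p))
    (H_cont : forall (t : R), I01 t ->
       continuous (fun z : 'rV[R]_n * 'rV[R]_n => H t z.1 z.2))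
    (H_convex : forall (t : R) x, I01 t ->
       @convex_function R 'rV[R]_n [set: 'rV[R]_n] (H t x))
    (c_ge0 : forall (t : R), I01 t -> 0 <= c t)
    (c_int : integrable01 c)
    (H_lip_p : forall (t : R) x p q, I01 t ->
       `|H t x p - H t x q| <= c t * (1 + enorm x) * enorm (p - q))
    (k_ge0 : forall (r t : R), 0 < r -> I01 t -> 0 <= k r t)
    (k_int : forall r : R, 0 < r -> integrable01 (k r))
    (H_lip_x : forall (r t : R) x y p, 0 < r -> I01 t -> eball n r x -> eball n r y ->
       `|H t x p - H t y p| <= k r t * (1 + enorm p) * enorm (x - y))
    (lam_meas : forall x, measurable01 (fun t => lam t x))
    (lam_cont : forall (t : R), I01 t -> continuous (lam t))
    (L_le_lam : forall (t : R) x v, I01 t -> edom (lagrangian H t x) v ->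
       (lagrangian H t x v <= (lam t x)%:E)%E)
    (lam_lip : forall (r t : R) x y, 0 < r -> I01 t -> eball n r x -> eball n r y ->
       `|lam t x - lam t y| <= k r t * enorm (x - y))
    (H00_int : integrable01 (fun t => H t 0 0))
    (lam0_int : integrable01 (fun t => lam t 0))
    (f : R -> 'rV[R]_n -> 'rV[R]_n.+1 -> 'rV[R]_n)
    (l : R -> 'rV[R]_n -> 'rV[R]_n.+1 -> R)
    (fl_repr : faithful_representation H c k lam f l)
    (phi : 'rV[R]_n * 'rV[R]_n -> \bar R)
    (phi_proper : proper_efun phi)
    (phi_lsc : lower_semicontinuous phi)
    (M : R) (M_ge0 : 0 <= M)
    (phi_dom : forall z x, edom phi (z, x) ->
       Num.min (enorm z) (enorm x) <= M) :
  [/\ exists x, minimizer (arcs R n) (Gamma phi H) x,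
      exists xa, minimizer (control_pairs f) (Lambda phi l) xa,
      ereal_inf (Gamma phi H @` arcs R n)
        = ereal_inf (Lambda phi l @` control_pairs f),
      forall x, minimizer (arcs R n) (Gamma phi H) x -> edom (Gamma phi H) x ->
        exists2 a, minimizer (control_pairs f) (Lambda phi l) (x, a)
                 & edom (Lambda phi l) (x, a)
    & forall x a, minimizer (control_pairs f) (Lambda phi l) (x, a) ->
        minimizer (arcs R n) (Gamma phi H) x].
Proof.
have phiN z : phi z <> -oo%E by case: phi_proper.
pose L := Lambda phi l; pose G := Gamma phi H.
have GL xa : control_pairs f xa -> (G xa.1 <= L xa)%E by move=> ?; apply: Gamma_le_Lambda; eassumption.
have ctrl x : arcs R n x -> (G x < +oo)%E ->
    exists2 a, control_pairs f (x, a) & L (x, a) = G x.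
  move=> acx Gx; apply: control_of_arc; try eassumption.
  by have [] := Gamma_finite H_meas H_cont k_ge0 k_int H_lip_x L_le_lam lam_lip H00_int lam0_int
    phiN acx Gx.
have [x0 [acx0 x0min]] : exists x, minimizer (arcs R n) G x by apply: Gamma_minimizer; eassumption.
(* The optimal pair comes with its value [G x0], from which both the equality of the minima and the
   converse implication follow. *)
have [xa0 [cxa0 xa0min LG0]] : exists xa, [/\ control_pairs f xa,
    forall xa', control_pairs f xa' -> (L xa <= L xa')%E & L xa = G x0].
  have x0L xa : control_pairs f xa -> (G x0 <= L xa)%E.
    by move=> cxa; apply: le_trans (GL _ cxa); apply: x0min; case: cxa.
  have [Goo|] := eqVneq (G x0) +oo%E; last rewrite -ltey => Gfin.
    have [xa cxa] : exists xa, control_pairs f xa by apply: control_pairs_nonempty; eassumption.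
    have Loo xa' : control_pairs f xa' -> L xa' = +oo%E.
      by move=> /x0L; rewrite Goo leye_eq => /eqP.
    by exists xa; split => // [xa' /Loo ->|]; [exact: leey|rewrite Loo].
  have [a ca La] := ctrl x0 acx0 Gfin.
  by exists (x0, a); split => // xa cxa; rewrite La; exact: x0L.
have xa0minimizer : minimizer (control_pairs f) L xa0 by [].
have x0minimizer : minimizer (arcs R n) G x0 by [].
split; first by exists x0.
- by exists xa0.
- by rewrite (ereal_inf_minimizer xa0minimizer) (ereal_inf_minimizer x0minimizer) LG0.
- move=> x [acx xmin] Gx; have Gfin : (G x < +oo)%E by rewrite ltey; case/fin_numPlt/andP: Gx => _ /lt_eqF ->.
  have [a ca La] := ctrl x acx Gfin; exists a; last by rewrite /edom/= -/L La.
  split; first exact: ca.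
  by move=> xa cxa; rewrite -/L La; apply: le_trans (GL _ cxa); apply: xmin; case: cxa.
move=> x a [cxa xamin]; have acx : arcs R n x by case: cxa.
split; first exact: acx.
(* The chain is [G x <= L (x, a) <= L xa0 = G x0 <= G y], valid also when the common value is
   [+oo]. *)
move=> y acy; apply: le_trans (GL _ cxa) _; apply: le_trans (xamin _ cxa0) _.
by rewrite -/L LG0; exact: x0min.
Qed.
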